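(* Assume that $\mathbb{E}[\|N\|_2^2+\|\Lambda^{\mathsf T}\Lambda\|_2^2]<\infty$ and that $\mathbb{E}[N]$ is positive definite. Let $(Q_t)_{t\ge 0}$ be the Q-learning sequence $$Q_{t+1}=Q_t+\alpha_t\big(N_{t+1}+\Lambda_{t+1}^{\mathsf T}\Pi(Q_t)\Lambda_{t+1}-Q_t\big),\quad t=0,1,2,\dots,$$ with initial matrix $Q_0\in\mathbb{S}_+^d$. For an initial state $x\in\mathbb{R}^n$ let $x^{\mathrm a}_t$ be the state under the adaptive feedback control $u_t^{\mathrm a}=\Gamma(Q_t)x_t^{\mathrm a}$, i.e. $x_0^{\mathrm a}=x$ and $x^{\mathrm a}_{t+1}=\Lambda_{t+1}\begin{bmatrix} x_t^{\mathrm a} \\ u_t^{\mathrm a} \end{bmatrix}$. If the LQ problem is well-posed, i.e. $V(x)<\infty$ for all $x\in\mathbb{R}^n$, then for any initial state $x\in\mathbb{R}^n$, almost surely, $$J(x,u_\cdot^{\mathrm a})<\infty\quad\text{and}\quad\sum_{t=0}^\infty\big(|x_t^{\mathrm a}|^2+|u_t^{\mathrm a}|^2\big)<\infty;$$ consequently, the adaptive feedback control $u^{\mathrm a}_\cdot$ stabilizes the system almost surely, i.e. $x_t^{\mathrm a}\to0$ almost surely as $t\to\infty$.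
   Context: Let $n,m\ge1$ be integers and $d=n+m$. $\mathbb{S}_+^d$ is the set of real symmetric positive semidefinite $d\times d$ matrices, $\|\cdot\|_2$ is the matrix $2$-norm, and $|\cdot|$ the Euclidean norm. For $P\in\mathbb{S}_+^d$ write $P=\begin{bmatrix} P_{xx} & P_{xu} \\ P_{ux} & P_{uu} \end{bmatrix}$ with $P_{xx}\in\mathbb{R}^{n\times n}$, and define $$\Pi(P)=P_{xx}-P_{xu}P_{uu}^{+}P_{ux},\qquad \Gamma(P)=-P_{uu}^{+}P_{ux},$$ where $P_{uu}^+$ is the Moore--Penrose pseudoinverse. On a probability space $(\Omega,\mathcal F,\mathbb P)$ let $(\Lambda_t,N_t)$, $t=1,2,\dots$, be independent and identically distributed random pairs with $\Lambda_t\in\mathbb{R}^{n\times d}$ and $N_t\in\mathbb{S}_+^d$; $(\Lambda,N)$ denotes an independent copy of $(\Lambda_1,N_1)$. Let $\mathcal F_0=\{\varnothing,\Omega\}$ and $\mathcal F_t=\sigma\{\Lambda_s,N_s:s=1,\dots,t\}$. Given an initial state $x_0=x\in\mathbb{R}^n$ and an admissible control, i.e. any $(\mathcal F_t)$-adapted $\mathbb{R}^m$-valued process $u_\cdot=(u_t)_{t\ge0}$, the state evolves by $x_{t+1}=\Lambda_{t+1}\begin{bmatrix} x_t \\ u_t \end{bmatrix}$, and the cost is $J(x,u_\cdot)=\sum_{t=0}^\infty [x_t^{\mathsf T},u_t^{\mathsf T}]N_{t+1}\begin{bmatrix} x_t \\ u_t \end{bmatrix}\in[0,\infty]$. The value function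 is $V(x)=\inf_{u_\cdot}\mathbb{E}[J(x,u_\cdot)]$, the infimum being over admissible controls. The learning rates $\alpha_t\in[0,1]$, $t=0,1,\dots$, may be random, with $\alpha_t$ being $\mathcal F_t$-measurable, and satisfy $\sum_{t}\alpha_t=\infty$ and $\sum_t\alpha_t^2<\infty$ (almost surely). The initial matrix $Q_0$ is deterministic. *)

(* Defs.v *)
From HB Require Import structures.
From mathcomp Require Import all_boot all_order all_algebra.
From mathcomp Require Import all_classical all_reals all_analysis.

Set Implicit Arguments.
Unset Strict Implicit.
Unset Printing Implicit Defensive.

Import Order.TTheory GRing.Theory Num.Theory.
Import numFieldNormedType.Exports.

Local Open Scope classical_set_scope.
Local Open Scope ring_scope.

(* The sigma-algebra on 'M[T]_(m, n) generated by the entries, as the library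
   does for tuples; for T = R it is the Borel sigma-algebra of R^(m x n). *)
Definition measure_matrix_display : measure_display -> measure_display.
Proof. exact. Qed.

Section measurable_matrix.
Context {d : measure_display} {T : measurableType d} (m n : nat).

Definition g_sigma_entries : set (set 'M[T]_(m, n)) :=
  <<s \bigcup_(ij in [set: 'I_m * 'I_n])
        preimage_set_system setT
          (fun A : 'M[T]_(m, n) => A ij.1 ij.2) measurable >>.

Let entries_set0 : g_sigma_entries set0.
Proof. exact: sigma_algebra0. Qed.

Let entries_setC A : g_sigma_entries A -> g_sigma_entries (~` A).
Proof. exact: sigma_algebraC. Qed.

Let entries_bigcup (F : (set 'M[T]_(m, n))^nat) :
  (forall i, g_sigma_entries (F i)) -> g_sigma_entries (\bigcup_i F i).
Proof. exact: sigma_algebra_bigcup. Qed.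

HB.instance Definition _ := @isMeasurable.Build (measure_matrix_display d)
  'M[T]_(m, n) g_sigma_entries entries_set0 entries_setC entries_bigcup.

End measurable_matrix.

Section linear_algebra.
Context {R : realType}.

Definition eucl_norm k (x : 'cV[R]_k) : R :=
  Num.sqrt (\sum_(i < k) x i ord0 ^+ 2).

(* The matrix 2-norm; `|A| on matrices is the maximum norm. *)
Definition mx_norm2 p q (A : 'M[R]_(p, q)) : R :=
  sup [set eucl_norm (A *m x) | x in [set x : 'cV[R]_q | eucl_norm x <= 1]].

Definition quad_form k (A : 'M[R]_k) (x : 'cV[R]_k) : R :=
  (x^T *m A *m x) ord0 ord0.

Definition psd k (A : 'M[R]_k) : Prop :=
  A^T = A /\ forall x : 'cV[R]_k, 0 <= quad_form A x.

Definition posdef k (A : 'M[R]_k) : Prop :=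
  A^T = A /\ forall x : 'cV[R]_k, x != 0 -> 0 < quad_form A x.

Definition penrose p q (A : 'M[R]_(p, q)) (X : 'M[R]_(q, p)) : Prop :=
  [/\ A *m X *m A = A, X *m A *m X = X,
      (A *m X)^T = A *m X & (X *m A)^T = X *m A].

(* The Moore-Penrose pseudoinverse; the default value 0 is never used, see
   pinvP and penrose_uniq. *)
Definition pinv p q (A : 'M[R]_(p, q)) : 'M[R]_(q, p) :=
  xget 0 [set X | penrose A X].

Lemma penrose_uniq p q (A : 'M[R]_(p, q)) X Y :
  penrose A X -> penrose A Y -> X = Y.
Proof.
move=> [x1 x2 x3 x4] [y1 y2 y3 y4].
have AXY : A *m X = A *m Y.
  have AX : A *m X = (A *m Y) *m (A *m X) by rewrite !mulmxA y1.
  by rewrite -x3 AX trmx_mul x3 y3 mulmxA x1.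
have XAY : X *m A = Y *m A.
  have XA : X *m A = (X *m A) *m (Y *m A) by rewrite -mulmxA (mulmxA A) y1.
  by rewrite -x4 XA trmx_mul x4 y4 -mulmxA (mulmxA A) x1.
by rewrite -x2 XAY -mulmxA AXY mulmxA y2.
Qed.

Lemma gram_unit r k (B : 'M[R]_(r, k)) : row_free B -> B *m B^T \in unitmx.
Proof.
move=> Bfree; rewrite -row_free_unit; apply/inj_row_free => v vBB0.
suff /eqP : v *m B = 0 by rewrite -(mul0mx _ B) => /eqP /(row_free_inj Bfree).
set u := v *m B.
have uu0 : \sum_j u 0 j ^+ 2 = 0.
  transitivity ((u *m u^T) 0 0).
    by rewrite mxE; apply: eq_bigr => j _; rewrite [u^T _ _]mxE expr2.
  by rewrite trmx_mul mulmxA -(mulmxA v) vBB0 mul0mx mxE.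
apply/rowP => j; apply/eqP; rewrite [X in _ == X]mxE -sqrf_eq0; apply/eqP.
by move: j isT; apply: psumr_eq0P => // j _; exact: sqr_ge0.
Qed.

Lemma pinvP p q (A : 'M[R]_(p, q)) : penrose A (pinv A).
Proof.
suff [X AX] : exists X, penrose A X.
  exact: (@xgetPex _ 0 [set X | penrose A X]) (ex_intro _ X AX).
have [r [C [B [-> freeB freeC]]]] : exists r (C : 'M[R]_(p, r)) (B : 'M[R]_(r, q)),
    [/\ A = C *m B, row_free B & row_free C^T].
  exists (\rank A), (col_base A), (row_base A).
  rewrite mulmx_base row_base_free; split=> //.
  by rewrite /row_free mxrank_tr; exact: col_base_full.
have uB := gram_unit freeB; have := gram_unit freeC; rewrite trmxK => uC.
set G := invmx (B *m B^T); set H := invmx (C^T *m C).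
have GE : G^T = G by rewrite trmx_inv trmx_mul trmxK.
have HE : H^T = H by rewrite trmx_inv trmx_mul trmxK.
exists (B^T *m G *m H *m C^T).
have AX : C *m B *m (B^T *m G *m H *m C^T) = C *m H *m C^T.
  rewrite !mulmxA; congr (_ *m _ *m _).
  by rewrite -(mulmxA C) -(mulmxA C) mulmxV // mulmx1.
have XA : (B^T *m G *m H *m C^T) *m (C *m B) = B^T *m G *m B.
  rewrite !mulmxA; congr (_ *m _).
  by rewrite -(mulmxA _ C^T) -(mulmxA _ H) mulVmx // mulmx1.
split.
- rewrite AX !mulmxA -(mulmxA _ C^T) -(mulmxA _ H).
  by rewrite mulVmx // mulmx1.
- rewrite XA !mulmxA -(mulmxA _ B B^T) -(mulmxA _ G (B *m B^T)).
  by rewrite mulVmx // mulmx1.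
- by rewrite AX !trmx_mul trmxK HE mulmxA.
- by rewrite XA !trmx_mul trmxK GE mulmxA.
Qed.

End linear_algebra.

Section lq_control.
Context {R : realType} {n m : nat}.

(* Blocks of P : ulsubmx = P_xx, ursubmx = P_xu, dlsubmx = P_ux,
   drsubmx = P_uu. *)
Definition lq_Pi (P : 'M[R]_(n + m)) : 'M[R]_n :=
  ulsubmx P - ursubmx P *m pinv (drsubmx P) *m dlsubmx P.

Definition lq_Gamma (P : 'M[R]_(n + m)) : 'M[R]_(m, n) :=
  - (pinv (drsubmx P) *m dlsubmx P).

(* The dynamics are defined along one realization: L t and N t, t >= 1, are the
   values of Lambda_t and N_t (the entries of index 0 are never used). *)

Fixpoint state (L : nat -> 'M[R]_(n, n + m)) (x : 'cV[R]_n)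
    (u : nat -> 'cV[R]_m) (t : nat) : 'cV[R]_n :=
  if t is s.+1 then L s.+1 *m col_mx (state L x u s) (u s) else x.

Definition cost (L : nat -> 'M[R]_(n, n + m)) (N : nat -> 'M[R]_(n + m))
    (x : 'cV[R]_n) (u : nat -> 'cV[R]_m) : \bar R :=
  (\sum_(0 <= t <oo)
     (quad_form (N t.+1) (col_mx (state L x u t) (u t)))%:E)%E.

Fixpoint Qlearning (L : nat -> 'M[R]_(n, n + m)) (N : nat -> 'M[R]_(n + m))
    (alpha : nat -> R) (Q0 : 'M[R]_(n + m)) (t : nat) : 'M[R]_(n + m) :=
  if t is s.+1 then
    let Q := Qlearning L N alpha Q0 s in
    Q + alpha s *: (N s.+1 + (L s.+1)^T *m lq_Pi Q *m L s.+1 - Q)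
  else Q0.

Fixpoint adaptive_state (L : nat -> 'M[R]_(n, n + m))
    (Q : nat -> 'M[R]_(n + m)) (x : 'cV[R]_n) (t : nat) : 'cV[R]_n :=
  if t is s.+1 then
    let xa := adaptive_state L Q x s in
    L s.+1 *m col_mx xa (lq_Gamma (Q s) *m xa)
  else x.

Definition adaptive_control (L : nat -> 'M[R]_(n, n + m))
    (Q : nat -> 'M[R]_(n + m)) (x : 'cV[R]_n) (t : nat) : 'cV[R]_m :=
  lq_Gamma (Q t) *m adaptive_state L Q x t.

Lemma state_adaptive_control L Q x t :
  state L x (adaptive_control L Q x) t = adaptive_state L Q x t.
Proof. by elim: t => //= t ->. Qed.

End lq_control.

Section probability_notions.
Context {d : measure_display} {Omega : measurableType d} {R : realType}.

Definition measurable_wrt {d' : measure_display} {T : measurableType d'}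
    (F : set (set Omega)) (X : Omega -> T) : Prop :=
  forall B, measurable B -> F (X @^-1` B).

Definition mutually_independent (P : probability Omega R)
    {d' : measure_display} {T : measurableType d'} (X : nat -> Omega -> T) :=
  forall (s : seq nat) (B : nat -> set T), uniq s ->
    (forall k, measurable (B k)) ->
    P (\bigcap_(k in [set` s]) (X k @^-1` B k)) =
    (\prod_(k <- s) P (X k @^-1` B k))%E.

Definition identically_distributed (P : probability Omega R)
    {d' : measure_display} {T : measurableType d'} (X : nat -> Omega -> T) :=
  forall k B, measurable B -> P (X k @^-1` B) = P (X 0%N @^-1` B).

Definition iid (P : probability Omega R)
    {d' : measure_display} {T : measurableType d'} (X : nat -> Omega -> T) :=
  [/\ forall k, measurable_fun setT (X k), mutually_independent P X
    & identically_distributed P X].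

Definition mx_expectation (P : probability Omega R) p q
    (A : Omega -> 'M[R]_(p, q)) : 'M[R]_(p, q) :=
  \matrix_(i < p, j < q) fine ('E_P[fun w => A w i j])%E.

End probability_notions.

Section lq_problem.
Context {d : measure_display} {Omega : measurableType d} {R : realType}.
Context {n m : nat}.
Variables (L : nat -> Omega -> 'M[R]_(n, n + m)).
Variables (N : nat -> Omega -> 'M[R]_(n + m)).

Definition sample (t : nat) (w : Omega) : 'M[R]_(n, n + m) * 'M[R]_(n + m) :=
  (L t w, N t w).

Definition filtration (t : nat) : set (set Omega) :=
  <<s \bigcup_(s in [set s | (1 <= s <= t)%N])
        preimage_set_system setT (sample s) measurable >>.

Definition admissible (u : nat -> Omega -> 'cV[R]_m) : Prop :=
  forall t, measurable_wrt (filtration t) (u t).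

Definition value (P : probability Omega R) (x : 'cV[R]_n) : \bar R :=
  ereal_inf [set (\int[P]_w cost (L^~ w) (N^~ w) x (u^~ w))%E
            | u in [set u | admissible u]].

End lq_problem.

(* Main.v *)
(* Let F(Q) = E[N] + E[Lambda^T Pi(Q) Lambda] be the mean Bellman map. The
   variational formula x^T Pi(P) x = min_u [x; u]^T P [x; u] makes F monotone
   and gives F(b Q) = b F(Q) + (1 - b) E[N] for b >= 0.

   Well-posedness bounds the trace of the increasing value iteration F^k(0), so
   some iterate K > 0 is almost fixed: K <= F(K) <= (1 + delta^2/8) K with
   delta K <= E[N]. No exact fixed point is needed.

   With the gain frozen at Gamma(K), Pi is dominated by a linear map, whose mean
   has spectral radius below 1; a linear functional l that it contracts turns
   the square of the positive part of l(Q_t) - b, up to a summable multiplicative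
   error, into a supermartingale, hence Q_t is bounded. The noise series of the
   stochastic approximation then converges, and the pathwise recursion, which
   is an affine contraction towards a neighbourhood of K in the Loewner order,
   traps Q_t between (1 - delta/4) K and (1 + delta/4) K.

   In that regime x^T Pi(K) x is a Lyapunov function of the adaptive closed
   loop, whose decrease pays for the stage cost and for |x|^2 + |u|^2.

   Conditional expectations given F_t are replaced by Fubini: the next sample is
   independent of F_t, so it may be integrated out with the past frozen. *)

Require Import Defs.
From HB Require Import structures.
From mathcomp Require Import all_boot all_order all_algebra.
From mathcomp Require Import all_classical all_reals all_analysis.
From mathcomp Require Import measurable_realfun.
From mathcomp Require Import ring lra.

Set Implicit Arguments.
Unset Strict Implicit.
Unset Printing Implicit Defensive.

Import Order.TTheory GRing.Theory Num.Theory.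
Import numFieldNormedType.Exports.

Local Open Scope classical_set_scope.
Local Open Scope ring_scope.

(** * Independence of the past and a maximal inequality *)

Section independence.
Context {d : measure_display} {Omega : measurableType d} {R : realType}.
Variable P : probability Omega R.

(** The noise scales with Q_t itself, so its series cannot be summed before Q_t is known to be
    bounded, while the contraction in the Loewner order needs the noise already summed. This circle
    is broken by an a priori bound through one scalar functional. Second moments of N and Lambda^T
    Lambda are all that is available, which is why its square is used.

    The time of entry near K depends on the future, and before it the expected state is not
    controlled. Supermartingale estimates are therefore localized on events [G t] of the past, and
    almost sure statements come from countable unions over deterministic starting times and bounds.

    The constants fit as follows. From K <= F(K) <= (1 + delta^2/8) K and delta K <= E[N], the
    factor in front of K obeys an affine recursion with upper fixed point 1/(1 - delta/8) < 1 +
    delta/4 and lower fixed point 1, so the window of half-width delta/4 is reached in finite time.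
    Inside it, (1 + delta/4)(1 - delta/2) <= 1 - delta/4 is exactly the margin that the Lyapunov
    decrease consumes. *)

Lemma ge0_integral_independent (d1 d2 : measure_display)
    (T1 : measurableType d1) (T2 : measurableType d2)
    (Y : Omega -> T1) (X : Omega -> T2) (f : T1 * T2 -> \bar R) :
  measurable_fun setT Y -> measurable_fun setT X ->
  (forall A B, measurable A -> measurable B ->
    P (Y @^-1` A `&` X @^-1` B) = (P (Y @^-1` A) * P (X @^-1` B))%E) ->
  measurable_fun setT f -> (forall z, 0 <= f z)%E ->
  (\int[P]_w f (Y w, X w) = \int[P]_w \int[P]_v f (Y w, X v))%E.
Proof.
move=> mY mX indep mf f0.
have mYX : measurable_fun setT (fun w => (Y w, X w)) by exact: measurable_fun_pair.
pose Z : {mfun Omega >-> (T1 * T2)%type} :=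
  HB.pack (fun w => (Y w, X w)) (@isMeasurableFun.Build _ _ _ _ _ mYX).
pose Y' : {mfun Omega >-> T1} := HB.pack Y (@isMeasurableFun.Build _ _ _ _ _ mY).
pose X' : {mfun Omega >-> T2} := HB.pack X (@isMeasurableFun.Build _ _ _ _ _ mX).
transitivity (\int[distribution P Z]_z f z)%E.
  by rewrite ge0_integral_distribution.
(* Rectangles determine a measure on the product, so independence on rectangles identifies the joint
   law with the product of the laws. *)
transitivity (\int[distribution P Y' \x distribution P X']_z f z)%E.
  apply: eq_measure_integral => A mA _.
  rewrite /=; apply/esym; exact: product_measure_unique.
rewrite fubini_tonelli1//.
rewrite ge0_integral_distribution//=; last 2 first.
- exact: measurable_fun_fubini_tonelli_F.
- by move=> y; apply: integral_ge0.
apply: eq_integral => w _ /=; rewrite /fubini_F ge0_integral_distribution//.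
exact: measurableT_comp.
Qed.

Context {d' : measure_display} {T : measurableType d'}.
Variable X : nat -> Omega -> T.

(** The bound [k < t] is strict: [X t] is the first sample that the past does not see. With [X k]
    the sample of index k + 1, this family generates F_t. *)
Definition past (t : nat) : set (set Omega) :=
  \bigcup_(k in [set k | (k < t)%N]) preimage_set_system setT (X k) measurable.

Local Notation past_type t := (g_sigma_algebraType (past t)).

Hypothesis Xiid : iid P X.

Let mX k : measurable_fun setT (X k).
Proof. by case: Xiid => + _ _; exact. Qed.

Lemma past_measurable t : <<s past t >> `<=` (measurable : set (set Omega)).
Proof.
apply: smallest_sub; first exact: sigma_algebra_measurable.
by move=> _ [k /= kt [B mB <-]]; exact: mX.
Qed.

Lemma past_le s t : (s <= t)%N -> <<s past s >> `<=` <<s past t >>.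
Proof.
move=> st; apply: sub_sigma_algebra2 => A [k /= ks XA].
by exists k => //=; exact: leq_trans st.
Qed.

(** Pi-lambda argument: finite intersections of preimages under the samples before t are stable
    under intersection and generate the past; mutual independence along the list 0, ..., t
    factorizes them against [X t]. *)
Lemma past_indep t A B : <<s past t >> A -> measurable B ->
  P (A `&` X t @^-1` B) = (P A * P (X t @^-1` B))%E.
Proof.
move=> pA mB.
have mXB k C : measurable C -> measurable (X k @^-1` C).
  by move=> mC; rewrite -[_ @^-1` _]setTI; exact: mX.
pose C : set (set Omega) := [set A | exists2 B : nat -> set T,
  (forall k, measurable (B k)) &
  A = \bigcap_(k in [set` iota 0 t]) (X k @^-1` B k)].
pose H : set (set Omega) := [set A | measurable A /\
  P (A `&` X t @^-1` B) = (P A * P (X t @^-1` B))%E].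
have CI : setI_closed C.
  move=> _ _ [B1 mB1 ->] [B2 mB2 ->]; exists (fun k => B1 k `&` B2 k).
    by move=> k; exact: measurableI.
  by rewrite -bigcapI.
have pC : <<s past t >> `<=` <<s C >>.
  apply: sub_sigma_algebra2 => _ [k /= kt [D mD <-]].
  exists (fun j => if j == k then D else setT).
    by move=> j; case: ifP.
  rewrite setTI; apply/seteqP; split=> [w Dw j _ /=|w].
    by case: eqP => // ->.
  by move=> /(_ k); rewrite /= eqxx mem_iota; exact.
suff CH : <<s C >> `<=` H by have [] := CH _ (pC _ pA).
apply: lambda_system_subset => //.
- apply/dynkin_lambda_system; split.
  + by split=> //; rewrite setTI probability_setT mul1e.
  + move=> D [mD PD]; split; first exact: measurableC.
    have mE := mXB t B mB.
    rewrite setIC -setDE measureD//; last first.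
      by rewrite (le_lt_trans (probability_le1 P _)) ?ltry.
    transitivity (P (X t @^-1` B) - P D * P (X t @^-1` B))%E.
      by congr (_ - _)%E; rewrite setIC; exact: PD.
    rewrite probability_setC//.
    by rewrite muleBl ?mul1e// fin_num_measure.
  + move=> F tF FH; split.
      by apply: bigcup_measurable => k _; have [] := FH k.
    have mF k : measurable (F k) by have [] := FH k.
    rewrite setI_bigcupl measure_semi_bigcup; last 3 first.
    * by move=> k; apply: measurableI => //; exact: mXB.
    * apply/trivIsetP => i j _ _ ij; rewrite setIACA setIid.
      by move/trivIsetP : tF => /(_ _ _ _ _ ij) ->//; rewrite set0I.
    * by apply: bigcup_measurable => k _; apply: measurableI => //; exact: mXB.
    rewrite measure_semi_bigcup//; last exact: bigcup_measurable.
    have fB : P (X t @^-1` B) \is a fin_num by rewrite fin_num_measure//; exact: mXB.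
    rewrite muleC -(fineK fB) -nneseriesZl//.
    by apply: eq_eseriesr => k _; rewrite (fineK fB) muleC; have [] := FH k.
- move=> _ [B' mB' ->]; split.
    apply: bigcap_measurableType => k _; exact: mXB.
  case: Xiid => _ indep _.
  have := indep (rcons (iota 0 t) t) (fun k => if k == t then B else B' k).
  rewrite rcons_uniq iota_uniq mem_iota/= ltnn => /(_ isT) h.
  have /h {h} : forall k, measurable (if k == t then B else B' k).
    by move=> k; case: ifP.
  have E : \bigcap_(k in [set` iota 0 t])
        (X k @^-1` (if k == t then B else B' k)) =
      \bigcap_(k in [set` iota 0 t]) (X k @^-1` B' k).
    apply: eq_bigcapr => k /=; rewrite mem_iota add0n => /andP[_ kt].
    by rewrite ltn_eqF.
  rewrite -cats1 big_cat/= big_seq1 eqxx => h.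
  transitivity (P (\bigcap_(k in [set` (iota 0 t ++ [:: t])])
       (X k @^-1` (if k == t then B else B' k)))).
    congr (P _); rewrite -E; apply/seteqP; split => w.
      move=> [wB wt] k /=; rewrite mem_cat inE => /orP[kt|/eqP ->].
        exact: wB.
      by rewrite eqxx.
    move=> wB; split=> [k kt|]; first by apply: wB; rewrite /= mem_cat kt.
    by have /= := wB t; rewrite eqxx; apply; rewrite mem_cat inE eqxx orbT.
  rewrite h; congr (_ * _)%E; rewrite -E.
  have := indep (iota 0 t) (fun k => if k == t then B else B' k) (iota_uniq _ _).
  by move=> ->// k; case: ifP.
Qed.

(** This plays the role of conditioning on the past. The past is the identity map of [Omega], with
    values in [Omega] equipped with the smaller sigma-algebra; it is independent of [X t]. Once the
    past is frozen, [X 0] may replace [X t] because the laws agree. *)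
Lemma integral_freeze t A (f : past_type t * T -> \bar R) :
  <<s past t >> A -> measurable_fun setT f -> (forall z, 0 <= f z)%E ->
  (\int[P]_(w in A) f (w, X t w) = \int[P]_(w in A) \int[P]_v f (w, X 0%N v))%E.
Proof.
move=> pA mf f0.
have same w : (\int[P]_v f (w, X t v) = \int[P]_v f (w, X 0%N v))%E.
  have mfw : measurable_fun setT (fun x => f (w, x)) by exact: measurableT_comp.
  pose Xt : {mfun Omega >-> T} := HB.pack (X t) (@isMeasurableFun.Build _ _ _ _ _ (mX t)).
  pose X0 : {mfun Omega >-> T} := HB.pack (X 0%N) (@isMeasurableFun.Build _ _ _ _ _ (mX 0%N)).
  transitivity (\int[distribution P Xt]_x f (w, x))%E.
    by rewrite ge0_integral_distribution.
  transitivity (\int[distribution P X0]_x f (w, x))%E.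
    apply: eq_measure_integral => B mB _.
    by case: Xiid => _ _; exact.
  by rewrite ge0_integral_distribution.
pose g : (past_type t * T)%type -> \bar R := f \_ (A `*` setT).
have mg : measurable_fun setT g.
  have mAT : measurable (A `*` setT : set (past_type t * T)%type).
    exact: measurableX.
  have [+ _] := measurable_restrictT f mAT; apply; exact: measurable_funTS.
have gE w x : g (w, x) = ((fun w => f (w, x)) \_ A) w.
  rewrite /g !patchE; congr (if _ then _ else _).
  by apply/idP/idP; rewrite !inE => //= -[].
have g0 z : (0 <= g z)%E by apply: erestrict_ge0.
rewrite integral_mkcond [RHS]integral_mkcond.
transitivity (\int[P]_w g (w, X t w))%E.
  by apply: eq_integral => w _; rewrite gE !patchE.
rewrite (@ge0_integral_independent _ _ (past_type t) T (fun w => w) (X t) g)//.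
- apply: eq_integral => w _; rewrite patchE; case: ifPn => wA.
    by rewrite -same; apply: eq_integral => v _; rewrite gE patchE wA.
  by apply: integral0_eq => v _; rewrite gE patchE (negbTE wA).
- by move=> _ B mB; rewrite setTI; exact: (@past_measurable t B mB).
- by move=> B C mB mC; exact: past_indep.
Qed.

Lemma integral_past_le t A (f : past_type t * T -> R) (Z : Omega -> R) :
  <<s past t >> A -> measurable_fun setT f -> (forall z, 0 <= f z) ->
  measurable_fun setT Z ->
  (forall w, A w -> \int[P]_v (f (w, X 0%N v))%:E <= (Z w)%:E)%E ->
  (\int[P]_(w in A) (f (w, X t w))%:E <= \int[P]_(w in A) (Z w)%:E)%E.
Proof.
move=> pA mf f0 mZ fZ.
have mA := past_measurable pA.
have mEf : measurable_fun setT (EFin \o f) by exact/measurable_EFinP.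
rewrite (integral_freeze (f := EFin \o f))//; last first.
apply: ge0_le_integral => //=.
- by move=> w _; apply: integral_ge0 => v _; rewrite lee_fin.
- apply: measurable_funTS.
  have mX0 : measurable_fun setT (fun z : past_type t * Omega => (EFin \o f) (z.1, X 0%N z.2)).
    apply: measurableT_comp => //; apply: measurable_fun_pair => //.
    by apply: measurableT_comp.
  have := @measurable_fun_fubini_tonelli_F _ _ (past_type t) Omega R P _ mX0.
  rewrite /fubini_F /= => mF _ B mB.
  rewrite setTI; apply: (@past_measurable t).
  by rewrite -[_ @^-1` _]setTI; apply: mF => //= z; rewrite lee_fin.
- by apply: measurable_funTS; exact/measurable_EFinP.
Qed.

(** Doob's maximal inequality for a process started at [t0] on [D], stopped when [G] fails, with a
    drift [b]. It decomposes along the first passage above [lam]. The drift is charged only while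
    [G] has held, so it may be large elsewhere. *)
Lemma maximal_inequality (Y b : nat -> Omega -> R) (G : nat -> set Omega)
    (t0 : nat) (D : set Omega) (lam : R) :
  (forall t w, 0 <= Y t w) -> (forall t w, 0 <= b t w) ->
  (forall t, measurable_fun setT (Y t : past_type t -> R)) ->
  (forall t, measurable_fun setT (b t)) ->
  (forall t, <<s past t >> (G t)) -> <<s past t0 >> D -> 0 <= lam ->
  (forall t A, <<s past t >> A -> A `<=` G t ->
    \int[P]_(w in A) (Y t.+1 w)%:E <= \int[P]_(w in A) (Y t w + b t w)%:E)%E ->
  (lam%:E * P (\bigcup_k [set w | [/\ D w, (lam <= Y (t0 + k)%N w)%R
                                  & forall j, (j < k)%N -> G (t0 + j)%N w]]) <=
  \int[P]_(w in D) (Y t0 w)%:E + \sum_(0 <= k <oo)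
    \int[P]_(w in D `&` [set w | forall j, (j <= k)%N -> G (t0 + j)%N w])
       (b (t0 + k)%N w)%:E)%E.
Proof.
move=> Y0 b0 mY mb mG mD lam0 step.
have mYO t : measurable_fun setT (Y t : Omega -> R).
  move=> _ B mB; rewrite setTI; apply: (@past_measurable t).
  by rewrite -[_ @^-1` _]setTI; exact: mY.
pose GG k := [set w | forall j, (j < k)%N -> G (t0 + j)%N w].
pose A k := D `&` GG k `&`
  [set w | forall j, (j < k)%N -> (Y (t0 + j)%N w < lam)%R].
pose H k := A k `&` [set w | (lam <= Y (t0 + k)%N w)%R].
have AE k : A k.+1 = A k `&` [set w | (Y (t0 + k)%N w < lam)%R] `&` G (t0 + k)%N.
  apply/seteqP; split=> [w [[Dw Gw] Yw]|w [[[[Dw Gw] Yw] Yk] Gk]].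
    split; [split; [split; [split=> //|]|]|] => /=.
    - by move=> j jk; apply: Gw; exact: leqW.
    - by move=> j jk; apply: Yw; exact: leqW.
    - exact: Yw.
    - exact: Gw.
  by split; [split=> //|]; move=> j; rewrite ltnS leq_eqVlt => /predU1P[->//|jk];
    [exact: Gw|exact: Yw].
have mlt t : <<s past t >> [set w | (Y t w < lam)%R].
  have -> : [set w | (Y t w < lam)%R] = setT `&` Y t @^-1` `]-oo, lam[.
    by rewrite setTI; apply/seteqP; split => w /=; rewrite in_itv.
  exact: (mY t).
have pI t B C : <<s past t >> B -> <<s past t >> C -> <<s past t >> (B `&` C).
  exact: (@measurableI _ (past_type t)).
have pA k : <<s past (t0 + k)%N >> (A k).
  elim: k => [|k IH].
    rewrite addn0; suff -> : A 0%N = D by [].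
    by apply/seteqP; split => [w [[]]//|w Dw]; split.
  rewrite AE addnS; apply: (past_le (leqnSn _)).
  by apply: (pI) => //; exact: (pI).
have pAS k : <<s past (t0 + k)%N >> (A k.+1).
  by rewrite AE; apply: (pI) => //; exact: (pI).
have mA k : measurable (A k) by exact: past_measurable (pA k).
have mge k : measurable [set w | (lam <= Y k w)%R].
  rewrite [X in measurable X](_ : _ = ~` [set w | (Y k w < lam)%R]).
    by apply: measurableC; exact: past_measurable (mlt _).
  by apply/seteqP; split => w /=; rewrite leNgt => /negP.
have mH k : measurable (H k) by apply: measurableI => //; exact: mge.
have mGk k : measurable (G k) by exact: past_measurable (mG k).
have mGG k : measurable (GG k).
  rewrite [X in measurable X](_ : _ = \bigcap_(j in [set j | (j < k)%N]) G (t0 + j)%N).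
    exact: bigcap_measurableType.
  by [].
have mDO : measurable D by exact: past_measurable mD.
have mEY t B : measurable_fun B (fun w => (Y t w)%:E).
  by apply: measurable_funTS; exact/measurable_EFinP.
have mEb t B : measurable_fun B (fun w => (b t w)%:E).
  by apply: measurable_funTS; exact/measurable_EFinP.
(* Balance of mass: what was collected at first passages [H j] plus what [Y] still carries on [A k],
   where no crossing has occurred yet, never exceeds the initial mass plus the drift. *)
have claim k : (\sum_(0 <= j < k) lam%:E * P (H j) +
    \int[P]_(w in A k) (Y (t0 + k)%N w)%:E <=
    \int[P]_(w in D) (Y t0 w)%:E + \sum_(0 <= j < k)
    \int[P]_(w in D `&` GG j.+1) (b (t0 + j)%N w)%:E)%E.
  elim: k => [|k IH].
    rewrite !big_geq// add0e adde0 addn0.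
    suff -> : A 0%N = D by [].
    by apply/seteqP; split => [w [[]]//|w Dw]; split.
  rewrite !big_nat_recr//= -addeA [leRHS]addeA.
  apply: le_trans (leeD2r _ IH).
  rewrite -[leRHS]addeA; apply: leeD2l.
  have -> : (\int[P]_(w in A k) (Y (t0 + k)%N w)%:E =
      \int[P]_(w in H k) (Y (t0 + k)%N w)%:E +
      \int[P]_(w in A k `\` [set w | (lam <= Y (t0 + k)%N w)%R]) (Y (t0 + k)%N w)%:E)%E.
    rewrite -ge0_integral_setU//=; first by rewrite /H setUIDK.
    - by rewrite setDE; apply: measurableI => //; apply: measurableC; exact: mge.
    - by move=> w _; rewrite lee_fin.
    - by apply/disj_setPS => w [[_ ?] [_]].
  rewrite -addeA; apply: leeD.
    rewrite -integral_cst//; apply: ge0_le_integral => //=.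
    by move=> w [_ /=]; rewrite lee_fin.
  rewrite addnS; apply: le_trans (step _ _ (pAS k) _) _; first by rewrite AE => w [].
  under eq_integral do rewrite EFinD.
  rewrite ge0_integralD//=; last 2 first.
    by move=> w _; rewrite lee_fin.
    by move=> w _; rewrite lee_fin.
  apply: leeD; apply: ge0_subset_integral => //=.
  - by apply: measurableD => //; exact: mge.
  - by move=> w _; rewrite lee_fin.
  - by rewrite AE => w [[Aw Yw] _]; split=> //=; apply/negP; rewrite -ltNge.
  - exact: measurableI.
  - by move=> w _; rewrite lee_fin.
  - by move=> w [].
have sumH : (lam%:E * \sum_(0 <= k <oo) P (H k) <=
    \int[P]_(w in D) (Y t0 w)%:E + \sum_(0 <= k <oo)
    \int[P]_(w in D `&` GG k.+1) (b (t0 + k)%N w)%:E)%E.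
  rewrite -nneseriesZl//.
  apply: lime_le => /=.
    by apply: is_cvg_nneseries => k _ _; rewrite mule_ge0// lee_fin.
  near=> k; apply: le_trans (_ : _ <= \int[P]_(w in D) (Y t0 w)%:E + \sum_(0 <= j < k)
    \int[P]_(w in D `&` GG j.+1) (b (t0 + j)%N w)%:E)%E _.
    apply: le_trans (claim k); rewrite leeDl//.
    by apply: integral_ge0 => w _; rewrite lee_fin.
  apply: leeD2l; apply: nneseries_lim_ge => j _ _.
  by apply: integral_ge0 => w _; rewrite lee_fin.
apply: le_trans sumH; apply: lee_wpmul2l; first by rewrite lee_fin.
apply: measure_sigma_subadditive => //.
  apply: bigcupT_measurable => k.
  rewrite [X in measurable X](_ : _ = D `&` [set w | (lam <= Y (t0 + k)%N w)%R] `&` GG k).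
    by apply: measurableI => //; exact: measurableI.
  by apply/seteqP; split => [w []//|w [[]]].
move=> w [k _ [Dw Yw Gw]].
(* The least crossing index puts the point in a first-passage event; minimality also keeps it inside
   the range where [G] holds. *)
have ex : exists j, (lam <= Y (t0 + j)%N w)%R by exists k.
case: (ex_minnP ex) => j Yj jmin; exists j => //; split=> //; split; first split=> //.
  by move=> i ij; apply: Gw; apply: leq_trans ij _; exact: jmin.
by move=> i ij; rewrite ltNge; apply/negP => /jmin; rewrite leqNgt ij.
Unshelve. all: by end_near.
Qed.
End independence.

(** * Almost sure convergence *)

(** The exceptional sets below are described by quantifiers over all times and bounds; it is enough
    to cover them by measurable sets of small probability, which is what the maximal inequality
    provides. *)
Lemma negligible_small (d : measure_display) (Omega : measurableType d)
    (R : realType) (P : probability Omega R) (N : set Omega) :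
  (forall e : R, 0 < e -> exists U, [/\ measurable U, N `<=` U & (P U <= e%:E)%E]) ->
  P.-negligible N.
Proof.
move=> H; pose e n : R := n.+1%:R^-1.
have e0 n : 0 < e n by rewrite invr_gt0.
pose U n := projT1 (cid (H _ (e0 n))).
have UP n : [/\ measurable (U n), N `<=` U n & (P (U n) <= (e n)%:E)%E].
  by rewrite /U; case: cid.
have mU : measurable (\bigcap_n U n) by apply: bigcapT_measurable => n; have [] := UP n.
exists (\bigcap_n U n); split => //; last first.
  by move=> w Nw n _; have [_ + _] := UP n; exact.
apply/eqP; rewrite eq_le measure_ge0 andbT.
apply/lee_addgt0Pr => r r0; rewrite add0e.
have [n ne] : exists n, e n < r.
  by have [n] := ltr_add_invr r0; rewrite add0r => h; exists n.
apply: (@le_trans _ _ (P (U n))).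
  by apply: le_measure; rewrite ?inE//; [have [] := UP n|exact: bigcap_inf].
by have [_ _ /le_trans] := UP n; apply; rewrite lee_fin ltW.
Qed.

Lemma integral_quadratic (d : measure_display) (Omega : measurableType d)
    (R : realType) (P : probability Omega R) (f g : Omega -> R) (c a b : R) :
  P.-integrable setT (EFin \o f) -> P.-integrable setT (EFin \o g) ->
  (\int[P]_w (c + a * f w + b * g w)%:E =
   (c + a * fine (\int[P]_w (f w)%:E) + b * fine (\int[P]_w (g w)%:E))%:E)%E.
Proof.
move=> If Ig.
have fin h : P.-integrable setT (EFin \o h) -> (\int[P]_w (h w)%:E)%E \is a fin_num.
  by move=> Ih; exact: integrable_fin_num.
rewrite [in LHS](_ : (fun w => _) = ((fun w => c%:E) \+ ((fun w => a%:E * (f w)%:E) \+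
   (fun w => b%:E * (g w)%:E)))%E); last first.
  by apply/funext => w; rewrite /= -!EFinM -!EFinD addrA.
have Iaf : P.-integrable setT (fun w => a%:E * (f w)%:E)%E by exact: integrableZl.
have Ibg : P.-integrable setT (fun w => b%:E * (g w)%:E)%E by exact: integrableZl.
rewrite integralD//; last 2 first.
- exact: finite_measure_integrable_cst.
- exact: integrableD.
have Ec : (\int[P]_w c%:E = c%:E)%E.
  by rewrite integral_cst// [X in (_ * X)%E]probability_setT mule1.
rewrite integralD// !integralZl// Ec.
by rewrite !EFinD !EFinM !fineK ?fin// addeA.
Qed.

Lemma nneseries_le (R : realType) (u : nat -> \bar R) (c : \bar R) :
  (forall t, 0 <= u t)%E -> (forall n, \sum_(0 <= t < n) u t <= c)%E ->
  (\sum_(0 <= t <oo) u t <= c)%E.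
Proof.
by move=> u0 uc; apply: lime_le; [exact: is_cvg_nneseries|exact: nearW].
Qed.

Lemma series_ltyP (R : realType) (u : nat -> R) : (forall t, 0 <= u t) ->
  (\sum_(0 <= t <oo) (u t)%:E < +oo)%E <->
  exists M : R, forall n, \sum_(0 <= t < n) u t <= M.
Proof.
move=> u0; split=> [soo|[M uM]]; last first.
  apply: (@le_lt_trans _ _ M%:E); last exact: ltry.
  apply: nneseries_le => [t|n]; first by rewrite lee_fin.
  by rewrite sumEFin lee_fin.
exists (fine (\sum_(0 <= t <oo) (u t)%:E)%E) => n.
rewrite -lee_fin fineK; last first.
  by rewrite ge0_fin_numE//; apply: nneseries_ge0 => t _ _; rewrite lee_fin.
by rewrite -sumEFin; apply: nneseries_lim_ge => t _ _; rewrite lee_fin.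
Qed.

Section almost_sure.
Context {d : measure_display} {Omega : measurableType d} {R : realType}.
Variable P : probability Omega R.
Context {d' : measure_display} {T : measurableType d'}.
Variable X : nat -> Omega -> T.
Hypothesis Xiid : iid P X.

Local Notation past_type t := (g_sigma_algebraType (past X t)).

Let pm t : <<s past X t >> `<=` (measurable : set (set Omega)).
Proof. exact: past_measurable Xiid t. Qed.

Lemma past_measurable_fun t (Y : Omega -> R) :
  measurable_fun setT (Y : past_type t -> R) -> measurable_fun setT Y.
Proof.
move=> mY _ B mB; rewrite setTI; apply: (pm (t := t)).
by rewrite -[_ @^-1` _]setTI; exact: mY.
Qed.

Lemma past_measurable_fun_le d1 (U : measurableType d1) s t (Y : Omega -> U) : (s <= t)%N ->
  measurable_fun setT (Y : past_type s -> U) -> measurable_fun setT (Y : past_type t -> U).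
Proof.
move=> st mY _ B mB; rewrite setTI; apply: (past_le st).
by rewrite -[_ @^-1` _]setTI; exact: mY.
Qed.

Lemma past_le_set t (Y Z : Omega -> R) :
  measurable_fun setT (Y : past_type t -> R) ->
  measurable_fun setT (Z : past_type t -> R) ->
  <<s past X t >> [set w | Y w <= Z w].
Proof.
move=> mY mZ.
have := @measurable_fun_le _ (past_type t) R setT Y Z measurableT mY mZ.
by rewrite setTI.
Qed.

(** The time from which [G] holds is random and need not be a stopping time, and the integral of
    [Y t0] may be infinite. Both obstacles disappear by splitting into countably many events with
    [t0] and a bound [k] on [Y t0] fixed. *)
Lemma supermartingale_bounded (Y : nat -> Omega -> R) (G : nat -> set Omega) :
  (forall t w, 0 <= Y t w) ->
  (forall t, measurable_fun setT (Y t : past_type t -> R)) ->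
  (forall t, <<s past X t >> (G t)) ->
  (forall t A, <<s past X t >> A -> A `<=` G t ->
    \int[P]_(w in A) (Y t.+1 w)%:E <= \int[P]_(w in A) (Y t w)%:E)%E ->
  {ae P, forall w, (exists t0, forall t, (t0 <= t)%N -> G t w) ->
    exists M : R, forall t, Y t w <= M}.
Proof.
move=> Y0 mY mG step.
pose B (t0 k : nat) := [set w | [/\ Y t0 w <= k%:R, forall t, (t0 <= t)%N -> G t w
  & forall M : R, exists2 t, (t0 <= t)%N & M < Y t w]].
suff negB t0 k : P.-negligible (B t0 k).
  have : P.-negligible (\bigcup_t0 \bigcup_k B t0 k).
    by do 2 (apply: negligible_bigcup => ?).
  apply: negligibleS => w /= /not_implyP [[t0 Gw] Yw].
  exists t0 => //; exists (Num.bound (Y t0 w)) => //; split => //.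
    by apply: ltW; exact: archi_boundP.
  move=> M; apply: contra_notP Yw => /forall2NP H.
  (* The finitely many values before [t0] are absorbed in the bound. *)
  exists (Num.max M (\big[Num.max/0]_(t < t0) Y t w)) => t.
  rewrite le_max; have [tt0|t0t] := ltnP t t0.
    by rewrite (le_bigmax _ (fun i : 'I_t0 => Y i w) (Ordinal tt0)) orbT.
  by have [//|/negP] := H t; rewrite -leNgt => ->.
apply: negligible_small => e e0.
(* The maximal inequality gives at most [k / lam <= e]; the added 1 keeps [lam] positive when [k] is
   0. *)
pose lam : R := (k%:R + 1) / e.
have lam0 : 0 < lam by rewrite divr_gt0// ltr_wpDl.
pose D := [set w | Y t0 w <= k%:R].
have pD : <<s past X t0 >> D by exact: past_le_set.
pose U := \bigcup_j [set w | [/\ D w, (lam <= Y (t0 + j)%N w)%R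
   & forall i, (i < j)%N -> G (t0 + i)%N w]].
have mY' t : measurable_fun setT (Y t) by exact: past_measurable_fun (mY t).
exists U; split.
- apply: bigcupT_measurable => j.
  rewrite [X in measurable X](_ : _ = D `&` [set w | (lam <= Y (t0 + j)%N w)%R] `&`
      \bigcap_(i in [set i | (i < j)%N]) G (t0 + i)%N).
    apply: measurableI; first apply: measurableI.
    + exact: (pm pD).
    + by rewrite -[X in measurable X]setTI; exact: measurable_fun_le.
    + by apply: bigcap_measurableType => i _; exact: (pm (mG _)).
  by apply/seteqP; split => [w []//|w [[]]].
- move=> w [Yk Gw Yw]; have [t t0t lt] := Yw lam.
  exists (t - t0)%N => //; split => //; rewrite ?subnKC// ?ltW//.
  by move=> i _; apply: Gw; exact: leq_addr.
have := @maximal_inequality _ Omega R P _ T X Xiid Y (fun _ _ => 0) G t0 D lam.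
move=> /(_ Y0 (fun _ _ => lexx _) mY (fun _ => measurable_cst _) mG pD (ltW lam0)).
have step' t A : <<s past X t >> A -> A `<=` G t ->
    (\int[P]_(w in A) (Y t.+1 w)%:E <= \int[P]_(w in A) (Y t w + 0)%:E)%E.
  by under [X in (_ <= X)%E]eq_integral do rewrite addr0; exact: step.
move=> /(_ step').
rewrite eseries0 ?adde0; last by move=> i _ _; rewrite integral0.
move=> h.
have {h} : (lam%:E * P U <= k%:R%:E)%E.
  apply: (le_trans h).
  apply: (@le_trans _ _ (\int[P]_(w in D) k%:R%:E)%E).
    apply: ge0_le_integral => //=.
    - exact: (pm pD).
    - by move=> w _; rewrite lee_fin.
    - by apply: measurable_funTS; exact/measurable_EFinP.
  rewrite integral_cst//; last exact: (pm pD).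
  by rewrite -[leRHS]mule1 lee_wpmul2l ?lee_fin// probability_le1//; exact: (pm pD).
rewrite -lee_pdivlMl// -EFinM => /le_trans; apply.
rewrite lee_fin /lam invfM invrK mulrAC ler_piMl ?(ltW e0)//.
by rewrite mulrC ler_pdivrMr ?mul1r ?lerDl// ltr_wpDl.
Qed.

(* Cauchy's criterion phrased with a fixed base point, which is what a maximal
   inequality controls. *)
Lemma oscillation_cvg (u : nat -> R) :
  (forall e : R, 0 < e -> exists t0, forall t, (t0 <= t)%N -> `|u t - u t0| < e) ->
  cvgn u.
Proof.
move=> H; apply/cauchy_cvgP/cauchyP => e e0.
have [t0 Ht] := H _ e0; exists (u t0); exists t0 => // t t0t.
by rewrite /ball /= distrC; exact: Ht.
Qed.

(** The increments have conditional mean zero and conditional variance [b t]. Localizing on the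
    events where the sum of the [b t] is at most [k] makes the expected variances summable, and the
    maximal inequality applied to squared oscillations gives Cauchy's criterion. *)
Lemma martingale_transform_cvg (a : nat -> Omega -> R) (h : T -> R) :
  (forall t, measurable_fun setT (a t : past_type t -> R)) ->
  measurable_fun setT h ->
  P.-integrable setT (fun w => (h (X 0%N w))%:E) ->
  P.-integrable setT (fun w => (h (X 0%N w) ^+ 2)%:E) ->
  (\int[P]_w (h (X 0%N w))%:E = 0)%E ->
  {ae P, forall w, (\sum_(0 <= t <oo) (a t w ^+ 2)%:E < +oo)%E ->
    cvgn (fun t => \sum_(0 <= s < t) a s w * h (X s w))}.
Proof.
move=> ma mh Ih Ih2 Eh0.
pose v := fine (\int[P]_w (h (X 0%N w) ^+ 2)%:E)%E.
have v0 : 0 <= v by apply: fine_ge0; apply: integral_ge0 => w _; rewrite lee_fin sqr_ge0.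
pose S t w := \sum_(0 <= s < t) a s w * h (X s w).
pose b t w := a t w ^+ 2 * v.
have b0 t w : 0 <= b t w by rewrite mulr_ge0 ?sqr_ge0.
have mb t : measurable_fun setT (b t : past_type t -> R).
  by apply: measurable_funM => //; exact: measurable_funX.
have mXS s t : (s < t)%N -> measurable_fun setT (X s : past_type t -> T).
  move=> st _ B mB; apply: sub_sigma_algebra.
  by exists s => //; exists B.
have mS t : measurable_fun setT (S t : past_type t -> R).
  rewrite /S; under eq_fun do rewrite big_mkord.
  apply: measurable_sum => s; apply: measurable_funM.
    by apply: past_measurable_fun_le (ma s); exact: ltnW.
  by apply: measurableT_comp => //; exact: mXS.
(* The sum includes index [t] itself: [b t] depends on [a t] only, hence is already known from
   [past t]. *)
pose G (k : nat) t := [set w | \sum_(0 <= s < t.+1) b s w <= k%:R].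
have mG k t : <<s past X t >> (G k t).
  apply: (@past_le_set t) => //.
  under eq_fun do rewrite big_mkord.
  apply: measurable_sum => s.
  by apply: past_measurable_fun_le (mb s); rewrite -ltnS.
have mbO t : measurable_fun setT (b t) by exact: past_measurable_fun (mb t).
pose B (k : nat) (e : R) := [set w | (forall t, G k t w) /\
  forall t0, exists2 t, (t0 <= t)%N & e <= `|S t w - S t0 w|].
suff negB k e : 0 < e -> P.-negligible (B k e).
  have : P.-negligible (\bigcup_k \bigcup_j B k j.+1%:R^-1).
    by apply: negligible_bigcup => k; apply: negligible_bigcup => j; apply: negB; rewrite invr_gt0.
  apply: negligibleS => w /= /not_implyP [sa Sw].
  have [M aM] : exists M, forall n, \sum_(0 <= t < n) a t w ^+ 2 <= M.
    by apply/series_ltyP => // t; exact: sqr_ge0.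
  have M0 : 0 <= M by have := aM 0%N; rewrite big_geq.
  exists (Num.bound (M * v)) => //.
  have [e e0 He] : exists2 e : R, 0 < e &
      forall t0, exists2 t, (t0 <= t)%N & e <= `|S t w - S t0 w|.
    apply: contra_notP Sw => /forall2NP H.
    apply: oscillation_cvg => e e0.
    have [//|/existsNP[t0 H0]] := H e; exists t0 => t t0t.
    by rewrite ltNge; apply/negP => ?; apply: H0; exists t.
  have [j je] := ltr_add_invr e0; rewrite add0r in je.
  exists j => //; split => [t|t0].
    rewrite /G /=; apply: (@le_trans _ _ (M * v)).
      by rewrite /b -mulr_suml ler_wpM2r.
    by apply: ltW; apply: archi_boundP; exact: mulr_ge0.
  by have [t t0t et] := He t0; exists t => //; exact: le_trans (ltW je) et.
move=> e0.
have mGO t : measurable (G k t) by exact: (pm (mG k t)).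
pose f t := (\int[P]_(w in G k t) (b t w)%:E)%E.
have f0 t : (0 <= f t)%E by apply: integral_ge0 => w _; rewrite lee_fin.
have fk : (\sum_(0 <= t <oo) f t < +oo)%E.
  apply: (@le_lt_trans _ _ k%:R%:E); last exact: ltry.
  apply: nneseries_le => // n.
  rewrite (_ : (\sum_(0 <= t < n) f t)%E =
    (\int[P]_w \sum_(0 <= t < n) (((EFin \o b t) \_ (G k t)) w))%E); last first.
    rewrite ge0_integral_sum//.
    - by apply: eq_bigr => t _; exact: integral_mkcond.
    - move=> t; have [+ _] := measurable_restrictT (EFin \o b t) (mGO t); apply.
      by apply: measurable_funTS; exact/measurable_EFinP.
    - by move=> t w _; apply: erestrict_ge0 => y _; rewrite lee_fin.
  apply: (@le_trans _ _ (\int[P]_w k%:R%:E)%E); last first.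
    by rewrite integral_cst// [X in (_ * X)%E]probability_setT mule1.
  apply: ge0_le_integral => //.
  - by move=> w _; apply: sume_ge0 => t _; apply: erestrict_ge0 => y _; rewrite lee_fin.
  - apply: emeasurable_sum => t.
    have [+ _] := measurable_restrictT (EFin \o b t) (mGO t); apply.
    by apply: measurable_funTS; exact/measurable_EFinP.
  (* Pointwise, if [G k n] holds then the whole partial sum is at most [k]; otherwise the last term
     vanishes and the induction hypothesis applies. *)
  move=> w _; elim: n => [|n IH]; first by rewrite big_geq// lee_fin.
  rewrite big_nat_recr//= [X in (_ + X)%E]patchE; case: ifPn => [|_]; last by rewrite adde0.
  rewrite inE => Gn; apply: (@le_trans _ _ (\sum_(0 <= s < n.+1) b s w)%:E); last first.
    by rewrite lee_fin.
  rewrite big_nat_recr//= EFinD leeD2r// -sumEFin.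
  apply: lee_sum => t _; rewrite patchE; case: ifP => // _.
  by rewrite lee_fin.
have tail := nneseries_tail_cvg fk (fun t _ => f0 t).
apply: negligible_small => r r0.
have re0 : (0 < (e ^+ 2 * r)%:E :> \bar R)%E by rewrite lte_fin mulr_gt0// exprn_gt0.
have [t0 tailt0] : exists t0, (\sum_(t0 <= t <oo) f t <= (e ^+ 2 * r)%:E)%E.
  have /fine_cvgP[[N1 _ finN] /cvgrPdist_le] := tail.
  have er0 : 0 < e ^+ 2 * r by rewrite mulr_gt0// exprn_gt0.
  move=> /(_ _ er0) [N2 _ leN]; exists (maxn N1 N2).
  have := leN _ (leq_maxr N1 N2); have := finN _ (leq_maxl N1 N2).
  rewrite /= => fin; rewrite sub0r normrN => leN0; rewrite -(fineK fin) lee_fin.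
  exact: le_trans (ler_norm _) leN0.
(* Because of [minn], [Y] vanishes up to time [t0]: the step inequality then holds at all times and
   the initial term of the maximal inequality is 0. *)
pose Y t w := (S t w - S (minn t t0) w) ^+ 2.
pose U := \bigcup_j [set w | [/\ setT w, (e ^+ 2 <= Y (t0 + j)%N w)%R
   & forall i, (i < j)%N -> G k (t0 + i)%N w]].
have mY t : measurable_fun setT (Y t : past_type t -> R).
  apply: measurable_funX; apply: measurable_funB => //.
  exact: past_measurable_fun_le (geq_minl _ _) (mS _).
have mYO t : measurable_fun setT (Y t) by exact: past_measurable_fun (mY t).
exists U; split.
- apply: bigcupT_measurable => j.
  rewrite [X in measurable X](_ : _ = [set w | (e ^+ 2 <= Y (t0 + j)%N w)%R] `&`
      \bigcap_(i in [set i | (i < j)%N]) G k (t0 + i)%N).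
    apply: measurableI.
    + by rewrite -[X in measurable X]setTI; exact: measurable_fun_le.
    + by apply: bigcap_measurableType => i _.
  by apply/seteqP; split => [w []//|w []].
- move=> w [Gw Sw]; have [t t0t et] := Sw t0.
  exists (t - t0)%N => //; split => //; rewrite /Y ?subnKC// (minn_idPr t0t).
  by rewrite -[leRHS]real_normK ?num_real// lerXn2r// ?nnegrE ?(ltW e0).
have := @maximal_inequality _ Omega R P _ T X Xiid Y b (G k) t0 setT (e ^+ 2).
have Y0 t w : 0 <= Y t w by exact: sqr_ge0.
have pT : <<s past X t0 >> setT by exact: (@measurableT _ (past_type t0)).
move=> /(_ Y0 b0 mY mbO (mG k) pT (sqr_ge0 _)).
have step t A : <<s past X t >> A -> A `<=` G k t ->
    (\int[P]_(w in A) (Y t.+1 w)%:E <= \int[P]_(w in A) (Y t w + b t w)%:E)%E.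
  move=> pA _; have [tt0|t0t] := ltnP t t0.
    rewrite integral0_eq => [|w _]; last by rewrite /Y (minn_idPl tt0) subrr expr0n.
    by apply: integral_ge0 => w _; rewrite lee_fin addr_ge0.
  pose c w := S t w - S t0 w.
  have mc : measurable_fun setT (c : past_type t -> R).
    by apply: measurable_funB => //; exact: past_measurable_fun_le (mS t0).
  have -> : (\int[P]_(w in A) (Y t.+1 w)%:E =
      \int[P]_(w in A) ((c w + a t w * h (X t w)) ^+ 2)%:E)%E.
    apply: eq_integral => w _; congr (_ ^+ 2)%:E.
    by rewrite /c /S (minn_idPr (leqW t0t)) big_nat_recr//= addrAC.
  apply: (@integral_past_le _ Omega R P _ T X Xiid t A
    (fun z => (c z.1 + a t z.1 * h z.2) ^+ 2) (fun w => Y t w + b t w)) => //.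
  - apply: measurable_funX; apply: measurable_funD.
      exact: (measurableT_comp mc).
    by apply: measurable_funM; [exact: (measurableT_comp (ma t))|exact: measurableT_comp].
  - by move=> z; exact: sqr_ge0.
  - exact: measurable_funD.
  move=> w _ /=.
  (* Expanding the square, the cross term integrates to 0 since [h] is centred, and the last term is
     the variance [b t]. *)
  have -> : (\int[P]_v ((c w + a t w * h (X 0%N v)) ^+ 2)%:E =
    \int[P]_v (c w ^+ 2 + (c w * a t w *+ 2) * h (X 0%N v) +
               a t w ^+ 2 * (h (X 0%N v) ^+ 2))%:E)%E.
    by apply: eq_integral => u _; congr (_ %:E); ring.
  rewrite (integral_quadratic (f := fun v => h (X 0%N v)) (g := fun v => h (X 0%N v) ^+ 2))//.
  by rewrite Eh0 /= mulr0 addr0 /Y /b (minn_idPr t0t).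
move=> /(_ step) {step}.
rewrite [X in (_ <= X + _)%E](_ : _ = 0)%E ?add0e; last first.
  by apply: integral0_eq => w _; rewrite /Y minnn subrr expr0n.
move=> le; have {le} : ((e ^+ 2)%:E * P U <= (e ^+ 2 * r)%:E)%E.
  apply: le_trans le _; apply: le_trans tailt0.
  apply: nneseries_le => [j|n]; first by apply: integral_ge0 => w _; rewrite lee_fin.
  apply: (@le_trans _ _ (\sum_(t0 <= t < t0 + n) f t)%E); last first.
    by apply: nneseries_lim_ge => t _ _.
  rewrite [leRHS](_ : _ = (\sum_(0 <= j < n) f (j + t0)%N)%E); last first.
    by rewrite -{1}[t0]add0n big_addn addKn.
  apply: lee_sum => j _; rewrite [(j + t0)%N]addnC; apply: ge0_subset_integral => //.
  - apply: measurableI => //.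
    rewrite [X in measurable X](_ : _ =
        \bigcap_(i in [set i | (i <= j)%N]) G k (t0 + i)%N)//.
    exact: bigcap_measurableType.
  - by apply: measurable_funTS; exact/measurable_EFinP.
  - by move=> w _; rewrite lee_fin.
  - by move=> w [_ /=]; apply.
by rewrite -lee_pdivlMl ?exprn_gt0// -EFinM mulKf// gt_eqF// exprn_gt0.
Qed.
End almost_sure.

(** * Quadratic forms and the Loewner order *)

Section quadratic_forms.
Context {R : realType}.
Implicit Types (k : nat).

Definition loewner k (A B : 'M[R]_k) : Prop :=
  forall x, quad_form A x <= quad_form B x.

Lemma trmxZ p q c (A : 'M[R]_(p, q)) : (c *: A)^T = c *: A^T.
Proof. exact: linearZ. Qed.

Lemma quad_formE k (A : 'M[R]_k) x :
  quad_form A x = \sum_i \sum_j A i j * (x i 0 * x j 0).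
Proof.
rewrite /quad_form mxE exchange_big; apply: eq_bigr => j _.
rewrite !mxE mulr_suml; apply: eq_bigr => i _; rewrite !mxE.
by rewrite mulrAC mulrC.
Qed.

Lemma quad_formD k (A B : 'M[R]_k) x :
  quad_form (A + B) x = quad_form A x + quad_form B x.
Proof. by rewrite /quad_form mulmxDr mulmxDl mxE. Qed.

Lemma quad_formZ k c (A : 'M[R]_k) x : quad_form (c *: A) x = c * quad_form A x.
Proof. by rewrite /quad_form -scalemxAr -scalemxAl mxE. Qed.

Lemma quad_formN k (A : 'M[R]_k) x : quad_form (- A) x = - quad_form A x.
Proof. by rewrite -scaleN1r quad_formZ mulN1r. Qed.

Lemma quad_formB k (A B : 'M[R]_k) x :
  quad_form (A - B) x = quad_form A x - quad_form B x.
Proof. by rewrite quad_formD quad_formN. Qed.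

Lemma quad_form0 k x : quad_form (0 : 'M[R]_k) x = 0.
Proof. by rewrite /quad_form mulmx0 mul0mx mxE. Qed.

Lemma quad_formr0 k (A : 'M[R]_k) : quad_form A 0 = 0.
Proof. by rewrite /quad_form mulmx0 mxE. Qed.

Lemma quad_form_conj k p (A : 'M[R]_k) (B : 'M[R]_(k, p)) x :
  quad_form (B^T *m A *m B) x = quad_form A (B *m x).
Proof. by rewrite /quad_form trmx_mul !mulmxA. Qed.

Lemma quad_form_delta k (A : 'M[R]_k) i : quad_form A (delta_mx i 0) = A i i.
Proof.
by rewrite /quad_form trmx_delta -rowE -colE !mxE.
Qed.

Lemma quad_form_add k (A : 'M[R]_k) x y :
  quad_form A (x + y) = quad_form A x + (x^T *m A *m y) 0 0
    + (y^T *m A *m x) 0 0 + quad_form A y.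
Proof.
have addE (a b : 'M[R]_1) : (a + b) 0 0 = a 0 0 + b 0 0 by rewrite mxE.
by rewrite /quad_form [(x + y)^T]linearD /= mulmxDr !mulmxDl !addE; ring.
Qed.

Lemma quad_form_scale k (A : 'M[R]_k) c x :
  quad_form A (c *: x) = c ^+ 2 * quad_form A x.
Proof. by rewrite /quad_form trmxZ -scalemxAr -!scalemxAl !mxE expr2 mulrA. Qed.

Lemma bilinear_sym k (A : 'M[R]_k) (x y : 'cV_k) : A^T = A ->
  (x^T *m A *m y) 0 0 = (y^T *m A *m x) 0 0.
Proof.
move=> symA; transitivity ((x^T *m A *m y)^T 0 0); first by rewrite [RHS]mxE.
by rewrite !trmx_mul trmxK symA mulmxA.
Qed.

Lemma bilinear_delta k p (A : 'M[R]_(k, p)) i j (a b : R) :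
  ((a *: delta_mx i 0 : 'cV_k)^T *m A *m (b *: delta_mx j 0 : 'cV_p)) 0 0 = a * b * A i j.
Proof.
rewrite trmxZ trmx_delta -scalemxAr -!scalemxAl -rowE -colE.
by rewrite !mxE mulrA [b * a]mulrC.
Qed.

Definition sqnorm k (x : 'cV[R]_k) : R := \sum_i x i 0 ^+ 2.

Lemma sqnorm_ge0 k (x : 'cV[R]_k) : 0 <= sqnorm x.
Proof. by apply: sumr_ge0 => i _; exact: sqr_ge0. Qed.

Lemma eucl_norm_sqr k (x : 'cV[R]_k) : eucl_norm x ^+ 2 = sqnorm x.
Proof. by rewrite /eucl_norm sqr_sqrtr// sqnorm_ge0. Qed.

Lemma quad_form1 k (x : 'cV[R]_k) : quad_form 1%:M x = sqnorm x.
Proof.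
by rewrite /quad_form mulmx1 mxE; apply: eq_bigr => i _; rewrite mxE expr2.
Qed.

Lemma loewner_trace k (A B : 'M[R]_k) : loewner A B -> \tr A <= \tr B.
Proof. by move=> AB; apply: ler_sum => i _; rewrite -!quad_form_delta. Qed.

(** Substitute for an eigenvalue bound, at the price of a factor [k]: the form at x_i e_i - x_j e_j
    is nonnegative, so each pair of off-diagonal terms is dominated by the two diagonal ones. *)
Lemma quad_form_le_trace k (A : 'M[R]_k) x : loewner 0 A ->
  quad_form A x <= k%:R * \tr A * sqnorm x.
Proof.
move=> A0; have pos y : 0 <= quad_form A y by have := A0 y; rewrite quad_form0.
have diag i : 0 <= A i i by rewrite -quad_form_delta.
have bnd i j : A i j * (x i 0 * x j 0) + A j i * (x j 0 * x i 0) <=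
    A i i * x i 0 ^+ 2 + A j j * x j 0 ^+ 2.
  pose u : 'cV_k := x i 0 *: delta_mx i 0; pose v : 'cV_k := (- x j 0) *: delta_mx j 0.
  have /= := pos (u + v); rewrite quad_form_add !quad_form_scale !quad_form_delta.
  by rewrite !bilinear_delta; nra.
have h : 2%:R * quad_form A x <= 2%:R * (k%:R * \sum_i A i i * x i 0 ^+ 2).
  rewrite quad_formE mulr_natl mulr2n {2}exchange_big -big_split/=.
  rewrite (_ : 2%:R * _ = \sum_i \sum_j (A i i * x i 0 ^+ 2 + A j j * x j 0 ^+ 2)).
    by apply: ler_sum => i _; rewrite -big_split; apply: ler_sum => j _; exact: bnd.
  under [RHS]eq_bigr do rewrite big_split/= sumr_const card_ord -mulr_natl.
  by rewrite big_split/= sumr_const card_ord -mulr_sumr -mulr_natl; ring.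
have {}h : quad_form A x <= k%:R * \sum_i A i i * x i 0 ^+ 2 by lra.
apply: (le_trans h); rewrite -mulrA ler_wpM2l// /mxtrace mulr_suml.
apply: ler_sum => i _; rewrite ler_wpM2l// /sqnorm (bigD1 i)//= lerDl.
by apply: sumr_ge0 => j _; exact: sqr_ge0.
Qed.

Lemma psd_entry_le k (A : 'M[R]_k) i j : psd A -> `|A i j| <= \tr A.
Proof.
move=> [symA pos].
have Aji : A j i = A i j by rewrite -[in LHS]symA mxE.
have diag l : 0 <= A l l by rewrite -quad_form_delta.
have trge l : A l l <= \tr A by rewrite /mxtrace (bigD1 l)//= lerDl sumr_ge0.
have tri := trge i; have trj := trge j.
have bnd c : 0 <= A i i + c ^+ 2 * A j j + c * (A i j *+ 2).
  have := pos (delta_mx i 0 + c *: delta_mx j 0).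
  rewrite quad_form_add !quad_form_scale !quad_form_delta.
  by rewrite -[delta_mx i 0]scale1r !bilinear_delta Aji; lra.
have h1 := bnd 1; have h2 := bnd (-1).
by rewrite ler_norml; lra.
Qed.

Lemma posdef_unitmx k (A : 'M[R]_k) : posdef A -> A \in unitmx.
Proof.
move=> [symA pos]; rewrite -row_free_unit; apply/inj_row_free => v vA0.
apply/eqP; apply: contraT => v0.
have : 0 < quad_form A v^T by apply: pos; rewrite trmx_eq0.
by rewrite /quad_form trmxK vA0 mul0mx mxE ltxx.
Qed.

Lemma sqnorm_gt0 k (x : 'cV[R]_k) : x != 0 -> 0 < sqnorm x.
Proof.
move=> x0; rewrite lt_neqAle sqnorm_ge0 andbT eq_sym; apply: contra x0.
rewrite /sqnorm psumr_eq0 => [/allP h|i _]; last exact: sqr_ge0.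
apply/eqP/colP => i; rewrite mxE; apply/eqP.
by have := h i; rewrite mem_index_enum sqrf_eq0; exact.
Qed.

(** Neither eigenvalues nor compactness are used. The inverse is at most a scalar [K], and
    nonnegativity of the form at x - K^-1 A^-1 x gives the form of A at x at least 2|x|^2/K -
    |x|^2/K. *)
Lemma posdef_ge_scalar k (A : 'M[R]_k) : posdef A ->
  exists2 c : R, 0 < c & forall x, c * sqnorm x <= quad_form A x.
Proof.
move=> [symA pos].
have uA := posdef_unitmx (conj symA pos).
have pos0 x : 0 <= quad_form A x.
  have [->|/pos/ltW//] := eqVneq x 0.
  by rewrite quad_formr0.
have invE x : quad_form (invmx A) x = quad_form A (invmx A *m x).
  by rewrite -quad_form_conj trmx_inv symA mulVmx// mul1mx.
have inv0 : loewner 0 (invmx A) by move=> x; rewrite quad_form0 invE.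
pose K := k%:R * \tr (invmx A) + 1.
have K0 : 0 < K.
  have : 0 <= \tr (invmx A) by have := loewner_trace inv0; rewrite mxtrace0.
  by rewrite /K => ?; rewrite ltr_wpDl// mulr_ge0.
exists K^-1; first by rewrite invr_gt0.
move=> x; have := pos0 (x + (- K^-1) *: (invmx A *m x)).
rewrite quad_form_add quad_form_scale -invE.
have cross c : (x^T *m A *m (c *: (invmx A *m x))) 0 0 = c * sqnorm x.
  rewrite -scalemxAr -mulmxA mulKVmx// mxE; congr (_ * _).
  by rewrite -quad_form1 /quad_form mulmx1.
rewrite [((_ *: _)^T *m A *m x) 0 0]bilinear_sym// !cross.
have : quad_form (invmx A) x <= K * sqnorm x.
  apply: le_trans (quad_form_le_trace x inv0) _.
  by rewrite ler_wpM2r ?sqnorm_ge0// lerDl.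
move: (quad_form (invmx A) x) (quad_form A x) (sqnorm x) => q r s qs.
have : K^-1 ^+ 2 * q <= K^-1 ^+ 2 * (K * s) by rewrite ler_wpM2l// sqr_ge0.
rewrite mulrA (_ : K^-1 ^+ 2 * K = K^-1); first by rewrite sqrrN; lra.
by rewrite expr2 mulfVK// gt_eqF.
Qed.
End quadratic_forms.

(** * The maps Pi and Gamma *)

Section pi_operator.
Context {R : realType} {n m : nat}.
Implicit Types (P : 'M[R]_(n + m)) (x : 'cV[R]_n) (u : 'cV[R]_m).

Lemma quad_form_col_mx P x u : P^T = P ->
  quad_form P (col_mx x u) = quad_form (ulsubmx P) x
    + (u^T *m dlsubmx P *m x) 0 0 *+ 2 + quad_form (drsubmx P) u.
Proof.
move=> symP; have urE : ursubmx P = (dlsubmx P)^T by rewrite trmx_dlsub symP.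
have addE (a b : 'M[R]_1) : (a + b) 0 0 = a 0 0 + b 0 0 by rewrite mxE.
rewrite /quad_form -{1}[P]submxK tr_col_mx mul_row_block mul_row_col.
rewrite !mulmxDl !addE urE.
have -> : (x^T *m (dlsubmx P)^T *m u) 0 0 = (u^T *m dlsubmx P *m x) 0 0.
  transitivity ((x^T *m (dlsubmx P)^T *m u)^T 0 0); first by rewrite [RHS]mxE.
  by rewrite !trmx_mul !trmxK mulmxA.
by ring.
Qed.

Lemma psd_drsubmx P : psd P -> psd (drsubmx P).
Proof.
move=> [symP pos]; split; first by rewrite trmx_drsub symP.
move=> u; have := pos (col_mx 0 u).
by rewrite quad_form_col_mx// quad_formr0 mulmx0 mxE mul0rn !add0r.
Qed.

Lemma pinv_sym k (A : 'M[R]_k) : A^T = A -> (Defs.pinv A)^T = Defs.pinv A.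
Proof.
move=> symA; apply: penrose_uniq (Defs.pinvP A).
have [h1 h2 h3 h4] := Defs.pinvP A; move: h1 h2 h3 h4.
set X := Defs.pinv A => h1 h2 h3 h4.
have AX : A *m X^T = X *m A by rewrite -[RHS]h4 trmx_mul symA.
have XA : X^T *m A = A *m X by rewrite -[RHS]h3 trmx_mul symA.
split.
- by have := congr1 trmx h1; rewrite !trmx_mul symA mulmxA.
- by have := congr1 trmx h2; rewrite !trmx_mul symA mulmxA.
- by rewrite AX h4.
- by rewrite XA h3.
Qed.

(** The range of P_ux lies in that of P_uu. Otherwise u could move along a direction killed by P_uu,
    on which the form is affine with nonzero slope, and become negative. This is what allows
    completing the square when P_uu is singular. *)
Lemma psd_range P : psd P ->
  drsubmx P *m Defs.pinv (drsubmx P) *m dlsubmx P = dlsubmx P.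
Proof.
move=> Ppsd; have [symP pos] := Ppsd; have [symA posA] := psd_drsubmx Ppsd.
set A := drsubmx P in symA posA *; set B := dlsubmx P; set X := Defs.pinv A.
have [h1 h2 h3 h4] := Defs.pinvP A; rewrite -/X in h1 h2 h3 h4.
pose D := 1%:M - A *m X.
have symD : D^T = D by rewrite /D linearB /= trmx1 h3.
have DA : D *m A = 0 by rewrite /D mulmxBl mul1mx h1 subrr.
have AD : A *m D = 0 by rewrite -(trmxK (A *m D)) trmx_mul symD symA DA trmx0.
suff DB : D *m B = 0.
  by apply/eqP; rewrite eq_sym -subr_eq0 -{1}[B]mul1mx -mulmxBl; exact/eqP.
apply/matrixP => i j; rewrite [RHS]mxE.
pose v : 'cV[R]_m := delta_mx i 0; pose x : 'cV[R]_n := delta_mx j 0.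
have -> : (D *m B) i j = ((D *m v)^T *m B *m x) 0 0.
  rewrite trmx_mul symD -(mulmxA v^T) -[v]scale1r -[x]scale1r bilinear_delta.
  by rewrite !mul1r.
set b := (_ *m x) 0 0; apply/eqP/negPn/negP => b0.
(* Chosen so that the form takes the value -1. *)
pose s := - (quad_form (ulsubmx P) x + 1) / (b *+ 2).
have := pos (col_mx x (s *: (D *m v))).
rewrite quad_form_col_mx// quad_form_scale.
have -> : quad_form A (D *m v) = 0.
  by rewrite /quad_form -mulmxA (mulmxA A) AD mul0mx mulmx0 mxE.
rewrite mulr0 addr0 trmxZ -!scalemxAl mxE -/b -mulrnAr /s.
have b20 : b *+ 2 != 0 by rewrite mulrn_eq0.
by rewrite divfK// opprD addrA subrr add0r leNgt ltrN10.
Qed.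

(** Completion of the square in u. It shows that Gamma(P) x is a minimizer with minimum x^T Pi(P) x,
    from which positivity, monotonicity and homogeneity of Pi follow by comparing controls. *)
Lemma quad_form_Pi P x u : psd P ->
  quad_form P (col_mx x u) =
    quad_form (lq_Pi P) x + quad_form (drsubmx P) (u - lq_Gamma P *m x).
Proof.
move=> Ppsd; have [symP _] := Ppsd; have [symA _] := psd_drsubmx Ppsd.
have rng := psd_range Ppsd.
have [_ h2 _ _] := Defs.pinvP (drsubmx P); have symX := pinv_sym symA.
have urE : ursubmx P = (dlsubmx P)^T by rewrite trmx_dlsub symP.
rewrite quad_form_col_mx// /lq_Gamma mulNmx opprK quad_form_add quad_formB urE.
move: symA rng h2 symX.
set A := drsubmx P; set B := dlsubmx P; set X := Defs.pinv A => symA rng h2 symX.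
rewrite [((X *m B *m x)^T *m A *m u) 0 0]bilinear_sym//.
have -> : u^T *m A *m (X *m B *m x) = u^T *m B *m x.
  by rewrite !mulmxA -(mulmxA u^T) -(mulmxA u^T) rng.
have -> : quad_form A (X *m B *m x) = quad_form (B^T *m X *m B) x.
  rewrite -quad_form_conj trmx_mul symX !mulmxA.
  have -> // : B^T *m X *m A *m X = B^T *m X.
  by rewrite -[in RHS]h2 !mulmxA.
by ring.
Qed.

Lemma quad_form_Pi_le P x u : psd P ->
  quad_form (lq_Pi P) x <= quad_form P (col_mx x u).
Proof.
by move=> Ppsd; rewrite quad_form_Pi// lerDl; have [_] := psd_drsubmx Ppsd; exact.
Qed.

Lemma quad_form_Gamma P x : psd P ->
  quad_form P (col_mx x (lq_Gamma P *m x)) = quad_form (lq_Pi P) x.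
Proof.
by move=> Ppsd; rewrite quad_form_Pi// subrr quad_formr0 addr0.
Qed.

Lemma psd_Pi P : psd P -> psd (lq_Pi P).
Proof.
move=> Ppsd; have [symP pos] := Ppsd; have [symA _] := psd_drsubmx Ppsd.
split; last by move=> x; rewrite -quad_form_Gamma.
rewrite /lq_Pi linearB /= trmx_ulsub symP; congr (_ - _).
by rewrite !trmx_mul pinv_sym// trmx_dlsub trmx_ursub symP mulmxA.
Qed.

Lemma loewner_Pi P P' : psd P -> psd P' -> loewner P P' ->
  loewner (lq_Pi P) (lq_Pi P').
Proof.
move=> Ppsd P'psd PP' x; rewrite -(quad_form_Gamma x P'psd).
by apply: le_trans (PP' _); exact: quad_form_Pi_le.
Qed.

Lemma psdZ k c (A : 'M[R]_k) : 0 <= c -> psd A -> psd (c *: A).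
Proof.
move=> c0 [symA pos]; split; first by rewrite trmxZ symA.
by move=> x; rewrite quad_formZ mulr_ge0.
Qed.

Lemma psdD k (A B : 'M[R]_k) : psd A -> psd B -> psd (A + B).
Proof.
move=> [symA posA] [symB posB]; split; first by rewrite linearD /= symA symB.
by move=> x; rewrite quad_formD addr_ge0.
Qed.

Lemma psd_conj k p (A : 'M[R]_k) (B : 'M[R]_(k, p)) : psd A -> psd (B^T *m A *m B).
Proof.
move=> [symA pos]; split; first by rewrite !trmx_mul trmxK symA mulmxA.
by move=> x; rewrite quad_form_conj.
Qed.

Lemma psd0 k : psd (0 : 'M[R]_k).
Proof. by split=> [|x]; rewrite ?trmx0// quad_form0. Qed.

Lemma quad_form_PiZ c P x : 0 <= c -> psd P ->
  quad_form (lq_Pi (c *: P)) x = c * quad_form (lq_Pi P) x.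
Proof.
move=> c0 Ppsd; have cP := psdZ c0 Ppsd; apply/eqP; rewrite eq_le.
rewrite -{1}(quad_form_Gamma x Ppsd) -quad_formZ quad_form_Pi_le//=.
by rewrite -(quad_form_Gamma x cP) quad_formZ ler_wpM2l// quad_form_Pi_le.
Qed.

Lemma trace_Pi P : psd P -> \tr (lq_Pi P) <= \tr P.
Proof.
move=> Ppsd; have [_ posA] := psd_drsubmx Ppsd.
rewrite -[in leRHS](submxK P) mxtrace_block.
apply: (@le_trans _ _ (\tr (ulsubmx P))).
  apply: loewner_trace => x; apply: le_trans (quad_form_Pi_le x 0 Ppsd) _.
  have [symP _] := Ppsd.
  rewrite quad_form_col_mx// trmx0 !mul0mx mxE mul0rn.
  by rewrite quad_formr0 !addr0.
by rewrite lerDl; apply: sumr_ge0 => i _; rewrite -quad_form_delta.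
Qed.
End pi_operator.

(** * Measurability of matrix operations *)

Section measurable_matrices.
Context {R : realType} {d : measure_display} {T : measurableType d}.

Lemma measurable_mxP p q (f : T -> 'M[R]_(p, q)) :
  measurable_fun setT f <-> forall i j, measurable_fun setT (fun w => f w i j).
Proof.
split=> [mf i j|mf].
  apply: (@measurableT_comp _ _ _ _ _ _ (fun A : 'M[R]_(p, q) => A i j)) => //.
  move=> _ B mB; apply: sub_sigma_algebra; exists (i, j) => //=.
  by exists B.
apply: measurability => // _ [_ [[i j] _ [B mB <-]] <-].
by have := mf i j measurableT B mB; rewrite !setTI.
Qed.

Lemma measurable_entry p q (f : T -> 'M[R]_(p, q)) i j :
  measurable_fun setT f -> measurable_fun setT (fun w => f w i j).
Proof. by move=> /measurable_mxP. Qed.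

Lemma measurable_addmx p q (f g : T -> 'M[R]_(p, q)) :
  measurable_fun setT f -> measurable_fun setT g ->
  measurable_fun setT (fun w => f w + g w).
Proof.
move=> /measurable_mxP mf /measurable_mxP mg; apply/measurable_mxP => i j.
by under eq_fun do rewrite mxE; exact: measurable_funD.
Qed.

Lemma measurable_oppmx p q (f : T -> 'M[R]_(p, q)) :
  measurable_fun setT f -> measurable_fun setT (fun w => - f w).
Proof.
move=> /measurable_mxP mf; apply/measurable_mxP => i j.
by under eq_fun do rewrite mxE; exact: measurableT_comp.
Qed.

Lemma measurable_scalemx p q (c : T -> R) (f : T -> 'M[R]_(p, q)) :
  measurable_fun setT c -> measurable_fun setT f ->
  measurable_fun setT (fun w => c w *: f w).
Proof.
move=> mc /measurable_mxP mf; apply/measurable_mxP => i j.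
by under eq_fun do rewrite mxE; exact: measurable_funM.
Qed.

Lemma measurable_mulmx p q r (f : T -> 'M[R]_(p, q)) (g : T -> 'M[R]_(q, r)) :
  measurable_fun setT f -> measurable_fun setT g ->
  measurable_fun setT (fun w => f w *m g w).
Proof.
move=> /measurable_mxP mf /measurable_mxP mg; apply/measurable_mxP => i j.
under eq_fun do rewrite mxE.
by apply: measurable_sum => l; exact: measurable_funM.
Qed.

Lemma measurable_reindex_mx p q p' q' (s : 'I_p' -> 'I_q' -> 'I_p * 'I_q)
    (f : T -> 'M[R]_(p, q)) (g : T -> 'M[R]_(p', q')) :
  (forall w i j, g w i j = f w (s i j).1 (s i j).2) ->
  measurable_fun setT f -> measurable_fun setT g.
Proof.
move=> gE /measurable_mxP mf; apply/measurable_mxP => i j.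
by under eq_fun do rewrite gE; exact: mf.
Qed.

Lemma measurable_trmx p q (f : T -> 'M[R]_(p, q)) :
  measurable_fun setT f -> measurable_fun setT (fun w => (f w)^T).
Proof.
by move=> mf; apply: (measurable_reindex_mx (s := fun i j => (j, i)) _ mf) => w i j; rewrite mxE.
Qed.

Lemma measurable_col_mx p q r (f : T -> 'M[R]_(p, r)) (g : T -> 'M[R]_(q, r)) :
  measurable_fun setT f -> measurable_fun setT g ->
  measurable_fun setT (fun w => col_mx (f w) (g w)).
Proof.
move=> /measurable_mxP mf /measurable_mxP mg; apply/measurable_mxP => i j.
under eq_fun do rewrite mxE.
by case: (fintype.split i) => l; [exact: mf|exact: mg].
Qed.

Lemma measurable_quad_form k (A : T -> 'M[R]_k) (x : T -> 'cV[R]_k) :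
  measurable_fun setT A -> measurable_fun setT x ->
  measurable_fun setT (fun w => quad_form (A w) (x w)).
Proof.
move=> mA mx; apply: measurable_entry; apply: measurable_mulmx => //.
by apply: measurable_mulmx => //; exact: measurable_trmx.
Qed.

Lemma measurable_det k (A : T -> 'M[R]_k) :
  measurable_fun setT A -> measurable_fun setT (fun w => \det (A w)).
Proof.
move=> /measurable_mxP mA; apply: measurable_sum => s.
by apply: measurable_funM => //; apply: measurable_prod.
Qed.

Lemma measurable_adjmx k (A : T -> 'M[R]_k) :
  measurable_fun setT A -> measurable_fun setT (fun w => \adj (A w)).
Proof.
move=> mA; apply/measurable_mxP => i j; under eq_fun do rewrite mxE.
apply: measurable_funM => //; apply: measurable_det.
apply: (measurable_reindex_mx (s := fun a b => (lift j a, lift i b)) _ mA) => w a b.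
by rewrite !mxE.
Qed.

Lemma measurable_funVr (f : T -> R) :
  measurable_fun setT f -> measurable_fun setT (fun w => (f w)^-1).
Proof.
move=> mf; suff mV : measurable_fun setT (@GRing.inv R) by exact: (measurableT_comp mV mf).
have -> : @GRing.inv R = fun x : R => if x == 0 then 0 else x^-1.
  by apply/funext => x; case: eqP => // ->; rewrite invr0.
apply: measurable_fun_if => //.
- apply: (measurable_fun_bool true); rewrite setTI.
  rewrite [X in measurable X](_ : _ = [set 0])//.
  by apply/seteqP; split => x /=; [move/eqP|move=> ->; rewrite eqxx].
- rewrite setTI; apply: open_continuous_measurable_fun.
    rewrite [X in open X](_ : _ = ~` [set 0]); first exact: closed_openC.
    by apply/seteqP; split => x /= => [/negbT/eqP|/eqP/negbTE].
  by move=> x; rewrite inE /= => /negbT; exact: inv_continuous.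
Qed.

Lemma gram_pinv p q (A : 'M[R]_(p, q)) : A^T *m A *m Defs.pinv A = A^T.
Proof.
have [h1 h2 h3 h4] := Defs.pinvP A.
by rewrite -mulmxA -h3 -trmx_mul h1.
Qed.

Lemma pinv_gram p q (A : 'M[R]_(p, q)) :
  A^T *m A *m (Defs.pinv A *m (Defs.pinv A)^T *m Defs.pinv A) = Defs.pinv A.
Proof.
have [h1 h2 h3 h4] := Defs.pinvP A.
by rewrite !mulmxA gram_pinv -trmx_mul h4 h2.
Qed.

Lemma posdef_regularized p q (A : 'M[R]_(p, q)) (e : R) : 0 < e ->
  posdef (A^T *m A + e%:M).
Proof.
move=> e0; split; first by rewrite linearD /= trmx_mul trmxK tr_scalar_mx.
move=> x x0; rewrite quad_formD -scalemx1 quad_formZ quad_form1.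
rewrite -[A^T]mulmx1 quad_form_conj quad_form1 ltr_wpDl ?sqnorm_ge0//.
by rewrite mulr_gt0// sqnorm_gt0.
Qed.

(** Tikhonov regularization with an explicit rate: (A^T A + e)^-1 A^T tends to the pseudoinverse as
    e tends to 0. *)
Lemma regularized_pinv p q (A : 'M[R]_(p, q)) (e : R) i j W : 0 < e <= 1 ->
  W = Defs.pinv A *m (Defs.pinv A)^T *m Defs.pinv A ->
  `|(invmx (A^T *m A + e%:M) *m A^T) i j - Defs.pinv A i j| <=
    e * (1 + `|W i j| + sqnorm (col j W)).
Proof.
move=> /andP[e0 e1] WE.
set B := A^T *m A; set C := invmx (B + e%:M).
have uC : B + e%:M \in unitmx by apply: posdef_unitmx; exact: posdef_regularized.
have CB Y : C *m (B *m Y) = Y - e *: (C *m Y).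
  apply/eqP; rewrite eq_sym subr_eq; apply/eqP.
  by rewrite scalemxAr -mulmxDr -mul_scalar_mx -mulmxDl mulKmx.
(* [CB] is used twice: A^T is B times the pseudoinverse, and the pseudoinverse is B times [W]. *)
have -> : C *m A^T = Defs.pinv A - e *: W + e ^+ 2 *: (C *m W).
  rewrite -[A^T]gram_pinv -/B CB -[in X in e *: (C *m X)]pinv_gram -/B -WE CB.
  by rewrite scalerBr scalerA -expr2 opprB addrA addrAC.
rewrite 5!mxE [X in `|X|](_ : _ = - (e * W i j) + e ^+ 2 * (C *m W) i j); last by ring.
set z := (C *m W) i j.
have B0 x : 0 <= quad_form B x.
  by rewrite /B -[A^T]mulmx1 quad_form_conj quad_form1 sqnorm_ge0.
(* Column j of [W] is B y + e y, where y is column j of [C *m W]; since B is positive semidefinite,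
   its norm is at least e|y|. *)
have ez : e ^+ 2 * z ^+ 2 <= sqnorm (col j W).
  pose y := col j (C *m W).
  have yE : col j W = B *m y + e *: y.
    by rewrite -mul_scalar_mx -mulmxDl /y !colE mulmxA mulKVmx.
  apply: (@le_trans _ _ (e ^+ 2 * sqnorm y)).
    rewrite ler_wpM2l ?sqr_ge0// /sqnorm (bigD1 i)//= mxE lerDl.
    by apply: sumr_ge0 => l _; exact: sqr_ge0.
  rewrite yE -[leRHS]quad_form1 quad_form_add quad_form_scale !quad_form1.
  rewrite [((e *: y)^T *m _ *m _) 0 0]bilinear_sym ?trmx1// mulmx1.
  rewrite -scalemxAr mxE trmx_mul /B trmx_mul trmxK -/B.
  have := B0 y; rewrite /quad_form; have := sqnorm_ge0 (B *m y); nra.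
have : e * `|z| <= 1 + sqnorm (col j W).
  have := sqnorm_ge0 (col j W); move: ez; rewrite -[z ^+ 2]real_normK ?num_real//.
  have := normr_ge0 z; move: `|z| (sqnorm _) => r s; nra.
move=> ez'; apply: (le_trans (ler_normD _ _)).
rewrite normrN expr2 !normrM !(gtr0_norm e0).
rewrite -mulrA -mulrDr ler_wpM2l ?(ltW e0)//; lra.
Qed.

(** The pseudoinverse is not continuous where the rank drops. It is however a pointwise limit of
    regularized inverses, which are rational in the entries by Cramer's formula. *)
Lemma measurable_pinv p q (A : T -> 'M[R]_(p, q)) :
  measurable_fun setT A -> measurable_fun setT (fun w => Defs.pinv (A w)).
Proof.
move=> mA; apply/measurable_mxP => i j.
pose e k : R := k.+1%:R^-1.
have e01 k : 0 < e k <= 1 by rewrite invr_gt0 ltr0Sn invf_le1 ?ltr0Sn// ler1n.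
pose B k w := (A w)^T *m A w + (e k)%:M.
apply: (measurable_fun_cvg
    (h := fun k w => ((\det (B k w))^-1 *: (\adj (B k w) *m (A w)^T)) i j)).
  move=> k; apply: measurable_entry.
  have mB : measurable_fun setT (B k).
    apply: measurable_addmx => //; apply: measurable_mulmx => //.
    exact: measurable_trmx.
  apply: measurable_scalemx.
    by apply: measurable_funVr; exact: measurable_det.
  by apply: measurable_mulmx; [exact: measurable_adjmx|exact: measurable_trmx].
move=> w _; apply/cvgrPdist_le => r r0.
pose W := Defs.pinv (A w) *m (Defs.pinv (A w))^T *m Defs.pinv (A w).
pose c := 1 + `|W i j| + sqnorm (col j W).
have c0 : 0 < c by rewrite /c -addrA ltr_pwDl// addr_ge0// sqnorm_ge0.
have [N Nr] := ltr_add_invr (divr_gt0 r0 c0); rewrite add0r in Nr.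
exists N => // k /= Nk.
have -> : (\det (B k w))^-1 *: (\adj (B k w) *m (A w)^T) = invmx (B k w) *m (A w)^T.
  have uB : B k w \in unitmx.
    by apply: posdef_unitmx; apply: posdef_regularized; have /andP[] := e01 k.
  by rewrite /invmx uB scalemxAl.
rewrite distrC; apply: le_trans (regularized_pinv _ _ (e01 k) (erefl W)) _.
rewrite -/c -ler_pdivlMr//; apply: le_trans (ltW Nr).
by rewrite lef_pV2 ?posrE ?ltr0Sn// ler_nat.
Qed.

End measurable_matrices.

Section measurable_feedback.
Context {R : realType} {d : measure_display} {T : measurableType d} {n m : nat}.
Implicit Types Q : T -> 'M[R]_(n + m).

Lemma measurable_drsubmx Q :
  measurable_fun setT Q -> measurable_fun setT (fun w => drsubmx (Q w)).
Proof.
move=> mQ.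
by apply: (measurable_reindex_mx (s := fun i j => (rshift n i, rshift n j)) _ mQ) => w i j;
  rewrite !mxE.
Qed.

Lemma measurable_dlsubmx Q :
  measurable_fun setT Q -> measurable_fun setT (fun w => dlsubmx (Q w)).
Proof.
move=> mQ.
by apply: (measurable_reindex_mx (s := fun i j => (rshift n i, lshift m j)) _ mQ) => w i j;
  rewrite !mxE.
Qed.

Lemma measurable_ursubmx Q :
  measurable_fun setT Q -> measurable_fun setT (fun w => ursubmx (Q w)).
Proof.
move=> mQ.
by apply: (measurable_reindex_mx (s := fun i j => (lshift m i, rshift n j)) _ mQ) => w i j;
  rewrite !mxE.
Qed.

Lemma measurable_ulsubmx Q :
  measurable_fun setT Q -> measurable_fun setT (fun w => ulsubmx (Q w)).
Proof.
move=> mQ.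
by apply: (measurable_reindex_mx (s := fun i j => (lshift m i, lshift m j)) _ mQ) => w i j;
  rewrite !mxE.
Qed.

Lemma measurable_Gamma Q :
  measurable_fun setT Q -> measurable_fun setT (fun w => lq_Gamma (Q w)).
Proof.
move=> mQ; apply: measurable_oppmx; apply: measurable_mulmx.
  by apply: measurable_pinv; exact: measurable_drsubmx.
exact: measurable_dlsubmx.
Qed.

Lemma measurable_Pi Q :
  measurable_fun setT Q -> measurable_fun setT (fun w => lq_Pi (Q w)).
Proof.
move=> mQ; apply: measurable_addmx; first exact: measurable_ulsubmx.
apply: measurable_oppmx; apply: measurable_mulmx; last exact: measurable_dlsubmx.
apply: measurable_mulmx; first exact: measurable_ursubmx.
by apply: measurable_pinv; exact: measurable_drsubmx.
Qed.

End measurable_feedback.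

(** * Moments and the mean Bellman map *)

(** The integral of a nonnegative function is a supremum over simple functions below it, hence
    monotone for arbitrary functions. This serves integrands such as the 2-norm or the total cost,
    whose measurability is not established. *)
Lemma ge0_le_integral_nonmeasurable (d : measure_display) (T : measurableType d)
    (R : realType) (mu : {measure set T -> \bar R}) (f g : T -> \bar R) :
  (forall x, 0 <= f x)%E -> (forall x, f x <= g x)%E ->
  (\int[mu]_x f x <= \int[mu]_x g x)%E.
Proof.
move=> f0 fg; have g0 x : (0 <= g x)%E by exact: le_trans (f0 x) (fg x).
rewrite !ge0_integralTE//; apply: le_ereal_sup => _ [h hf <-].
by exists h => // x; exact: le_trans (hf x) (fg x).
Qed.

(** * The 2-norm dominates entries and products of entries *)

Section matrix_norm.
Context {R : realType}.

Lemma eucl_norm_ge0 k (x : 'cV[R]_k) : 0 <= eucl_norm x.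
Proof. exact: sqrtr_ge0. Qed.

Lemma eucl_norm_le_norm2 p q (A : 'M[R]_(p, q)) (x : 'cV[R]_q) :
  eucl_norm x <= 1 -> eucl_norm (A *m x) <= mx_norm2 A.
Proof.
move=> x1; apply: ub_le_sup; last by exists x.
(* The supremum must be shown to be over a bounded set: the squares are at most q tr(A^T A), and 1 +
   s bounds the square root of s. *)
exists (1 + q%:R * \tr (A^T *m A)) => _ [y /= y1 <-].
have AA0 : loewner 0 (A^T *m A).
  move=> z; rewrite quad_form0 -[A^T]mulmx1 quad_form_conj quad_form1.
  exact: sqnorm_ge0.
have tr0 : 0 <= \tr (A^T *m A) by have := loewner_trace AA0; rewrite mxtrace0.
have c0 : 0 <= q%:R * \tr (A^T *m A) by rewrite mulr_ge0.
have : eucl_norm (A *m y) ^+ 2 <= q%:R * \tr (A^T *m A).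
  rewrite eucl_norm_sqr -quad_form1 -quad_form_conj mulmx1.
  apply: (le_trans (quad_form_le_trace _ AA0)).
  by rewrite ler_piMr// -eucl_norm_sqr expr_le1// eucl_norm_ge0.
have := eucl_norm_ge0 (A *m y); nra.
Qed.

Lemma mx_norm2_ge0 p q (A : 'M[R]_(p, q)) : 0 <= mx_norm2 A.
Proof.
have : eucl_norm (0 : 'cV[R]_q) <= 1.
  by rewrite /eucl_norm big1 ?sqrtr0// => i _; rewrite mxE expr0n.
by move=> /(eucl_norm_le_norm2 A); apply: le_trans; exact: eucl_norm_ge0.
Qed.

Lemma entry_le_norm2 p q (A : 'M[R]_(p, q)) i j : `|A i j| <= mx_norm2 A.
Proof.
have sq1 : eucl_norm (delta_mx j 0 : 'cV[R]_q) <= 1.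
  rewrite -(@expr_le1 _ 2)// ?eucl_norm_ge0// eucl_norm_sqr -quad_form1.
  by rewrite quad_form_delta mxE eqxx.
apply: le_trans (eucl_norm_le_norm2 A sq1).
rewrite -(@ler_pXn2r _ 2) ?nnegrE ?eucl_norm_ge0// eucl_norm_sqr.
rewrite real_normK ?num_real// -colE /sqnorm (bigD1 i)//= mxE lerDl.
by apply: sumr_ge0 => l _; exact: sqr_ge0.
Qed.

(** Through this bound the moment assumption on Lambda^T Lambda makes every product of two entries
    of Lambda square integrable. The squares of the entries sit inside diagonal entries of A^T A,
    and products follow by the arithmetic-geometric inequality. *)
Lemma gram_entry_le_norm2 p q (A : 'M[R]_(p, q)) k l i j :
  `|A k i * A l j| <= mx_norm2 (A^T *m A).
Proof.
have diag r s : A r s ^+ 2 <= mx_norm2 (A^T *m A).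
  apply: le_trans (le_trans (ler_norm _) (entry_le_norm2 (A^T *m A) s s)).
  rewrite mxE (bigD1 r)//= mxE -expr2 lerDl.
  by apply: sumr_ge0 => t _; rewrite mxE -expr2 sqr_ge0.
have := diag k i; have := diag l j; rewrite normrM.
rewrite -[A k i ^+ 2]real_normK ?num_real// -[A l j ^+ 2]real_normK ?num_real//.
move: `|_| `|_| (mx_norm2 _) => a b c; nra.
Qed.

End matrix_norm.

Section linear_expectation.
Context {d : measure_display} {Omega : measurableType d} {R : realType}.
Variable P : probability Omega R.

Lemma linear_entries p q (f : 'M[R]_(p, q) -> R) (A : 'M[R]_(p, q)) :
  (forall a u v, f (a *: u + v) = a * f u + f v) ->
  f A = \sum_(ij : 'I_p * 'I_q) f (delta_mx ij.1 ij.2) * A ij.1 ij.2.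
Proof.
move=> linf.
have f0 : f 0 = 0 by have := linf (-1) 0 0; rewrite scaler0 addr0; lra.
have fD u v : f (u + v) = f u + f v by rewrite -[u]scale1r linf mul1r scale1r.
rewrite [in LHS](matrix_sum_delta A) pair_bigA /= (big_morph f fD f0).
by apply: eq_bigr => ij _; rewrite -[_ *: _]addr0 linf f0 addr0 mulrC.
Qed.

Lemma expectation_linear p q (f : 'M[R]_(p, q) -> R) (A : Omega -> 'M[R]_(p, q)) :
  (forall a u v, f (a *: u + v) = a * f u + f v) ->
  (forall i j, P.-integrable setT (fun w => (A w i j)%:E)) ->
  P.-integrable setT (fun w => (f (A w))%:E) /\
  (\int[P]_w (f (A w))%:E = (f (mx_expectation P A))%:E)%E.
Proof.
move=> linf IA.
have fE w : (f (A w))%:E = (\sum_(ij : 'I_p * 'I_q)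
    (f (delta_mx ij.1 ij.2))%:E * (A w ij.1 ij.2)%:E)%E.
  by rewrite (linear_entries (A w) linf) -sumEFin.
have If (ij : 'I_p * 'I_q) : P.-integrable setT
    (fun w => (f (delta_mx ij.1 ij.2))%:E * (A w ij.1 ij.2)%:E)%E.
  exact: integrableZl.
under eq_fun do rewrite fE.
split; first exact: integrable_sum.
rewrite integral_sum// (linear_entries (mx_expectation P A) linf) -sumEFin.
apply: eq_bigr => -[i j] _ /=; rewrite integralZl// mxE EFinM; congr (_ * _)%E.
by rewrite unlock fineK// integrable_fin_num.
Qed.

End linear_expectation.

(** * Mean of a random conjugation and order properties of the Bellman map *)

Section lq_moments.
Context {d : measure_display} {Omega : measurableType d} {R : realType} {n m : nat}.
Variable P : probability Omega R.
Variables (L1 : Omega -> 'M[R]_(n, n + m)) (N1 : Omega -> 'M[R]_(n + m)).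
Hypothesis mL : measurable_fun setT L1.
Hypothesis mN : measurable_fun setT N1.
Hypothesis moment :
  ('E_P[fun w => (mx_norm2 (N1 w) ^+ 2 + mx_norm2 ((L1 w)^T *m L1 w) ^+ 2)%R] < +oo)%E.

Lemma integrable_dominated (f : Omega -> R) : measurable_fun setT f ->
  (forall w, `|f w| <= mx_norm2 (N1 w) ^+ 2 + mx_norm2 ((L1 w)^T *m L1 w) ^+ 2) ->
  P.-integrable setT (fun w => (f w)%:E).
Proof.
move=> mf fD; apply/integrableP; split; first exact/measurable_EFinP.
apply: le_lt_trans moment; rewrite unlock.
by apply: ge0_le_integral_nonmeasurable => // w; rewrite /= lee_fin.
Qed.

Lemma integrable_of_sqr (f : Omega -> R) : measurable_fun setT f ->
  P.-integrable setT (fun w => (f w ^+ 2)%:E) -> P.-integrable setT (fun w => (f w)%:E).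
Proof.
move=> mf If2.
apply: (@le_integrable _ _ _ _ _ measurableT _ (fun w => 1%:E + (f w ^+ 2)%:E)%E).
- exact/measurable_EFinP.
- move=> w _; rewrite -EFinD /= lee_fin [leRHS]ger0_norm ?addr_ge0 ?sqr_ge0//.
  by rewrite -[f w ^+ 2]real_normK ?num_real//; have := normr_ge0 (f w); nra.
- by apply: integrableD => //; exact: finite_measure_integrable_cst.
Qed.

Lemma sqr_integrable_center (f : Omega -> R) (c : R) : measurable_fun setT f ->
  P.-integrable setT (fun w => (f w ^+ 2)%:E) ->
  P.-integrable setT (fun w => ((f w - c) ^+ 2)%:E).
Proof.
move=> mf If2; have If := integrable_of_sqr mf If2.
rewrite (_ : (fun w => _) = ((fun w => (f w ^+ 2)%:E) \+
  (fun w => (- c *+ 2)%:E * (f w)%:E) \+ (fun w => (c ^+ 2)%:E))%E); last first.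
  by apply/funext => w /=; rewrite -EFinM -!EFinD; congr (_%:E); ring.
apply: integrableD => //; last exact: finite_measure_integrable_cst.
by apply: integrableD => //; exact: integrableZl.
Qed.

Lemma integrable_N_sqr i j : P.-integrable setT (fun w => (N1 w i j ^+ 2)%:E).
Proof.
apply: integrable_dominated.
  by apply: measurable_funX; exact: measurable_entry.
move=> w; rewrite normrX; apply: (@le_trans _ _ (mx_norm2 (N1 w) ^+ 2)).
  by rewrite ler_pXn2r ?nnegrE ?normr_ge0// ?entry_le_norm2// (le_trans _ (entry_le_norm2 _ i j)).
by rewrite lerDl sqr_ge0.
Qed.

Lemma integrable_LL_sqr k l i j :
  P.-integrable setT (fun w => ((L1 w k i * L1 w l j) ^+ 2)%:E).
Proof.
apply: integrable_dominated.
  by apply: measurable_funX; apply: measurable_funM; exact: measurable_entry.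
move=> w; rewrite normrX.
apply: (@le_trans _ _ (mx_norm2 ((L1 w)^T *m L1 w) ^+ 2)).
  by rewrite ler_pXn2r ?nnegrE ?normr_ge0// ?gram_entry_le_norm2//
    (le_trans _ (gram_entry_le_norm2 _ k l i j)).
by rewrite lerDr sqr_ge0.
Qed.

Lemma integrable_N i j : P.-integrable setT (fun w => (N1 w i j)%:E).
Proof. by apply: integrable_of_sqr (integrable_N_sqr i j); exact: measurable_entry. Qed.

Lemma integrable_LL k l i j : P.-integrable setT (fun w => (L1 w k i * L1 w l j)%:E).
Proof.
apply: integrable_of_sqr (integrable_LL_sqr k l i j).
by apply: measurable_funM; exact: measurable_entry.
Qed.

Lemma conj_entryE p (A : 'M[R]_(n, p)) (K : 'M[R]_n) i j :
  (A^T *m K *m A) i j = \sum_(kl : 'I_n * 'I_n) K kl.1 kl.2 * (A kl.1 i * A kl.2 j).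
Proof.
rewrite mxE -(pair_bigA _ (fun k l => K k l * (A k i * A l j))) exchange_big /=.
apply: eq_bigr => l _; rewrite mxE mulr_suml; apply: eq_bigr => k _.
by rewrite mxE; ring.
Qed.

Lemma integrable_conj K i j :
  P.-integrable setT (fun w => (((L1 w)^T *m K *m L1 w) i j)%:E).
Proof.
rewrite (_ : (fun w => _) = (fun w => \sum_(kl : 'I_n * 'I_n)
    (K kl.1 kl.2)%:E * (L1 w kl.1 i * L1 w kl.2 j)%:E)%E); last first.
  by apply/funext => w; rewrite conj_entryE -sumEFin.
by apply: integrable_sum => // kl _; apply: integrableZl => //; exact: integrable_LL.
Qed.

Definition mean_conj (K : 'M[R]_n) : 'M[R]_(n + m) :=
  mx_expectation P (fun w => (L1 w)^T *m K *m L1 w).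

Definition bellman (Q : 'M[R]_(n + m)) : 'M[R]_(n + m) :=
  mx_expectation P N1 + mean_conj (lq_Pi Q).

Lemma mean_conjE K i j : mean_conj K i j = \sum_(kl : 'I_n * 'I_n)
  K kl.1 kl.2 * fine (\int[P]_w (L1 w kl.1 i * L1 w kl.2 j)%:E)%E.
Proof.
apply: EFin_inj; rewrite mxE unlock fineK; last first.
  by apply: integrable_fin_num => //; exact: integrable_conj.
transitivity (\int[P]_w \sum_(kl : 'I_n * 'I_n)
    (K kl.1 kl.2)%:E * (L1 w kl.1 i * L1 w kl.2 j)%:E)%E.
  by apply: eq_integral => w _; rewrite /= conj_entryE -sumEFin.
have I (kl : 'I_n * 'I_n) : P.-integrable setT (fun w =>
    (K kl.1 kl.2)%:E * (L1 w kl.1 i * L1 w kl.2 j)%:E)%E.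
  by apply: integrableZl => //; exact: integrable_LL.
rewrite (integral_sum measurableT I) -sumEFin.
apply: eq_bigr => kl _; rewrite integralZl//; last exact: integrable_LL.
by rewrite EFinM fineK//; apply: integrable_fin_num => //; exact: integrable_LL.
Qed.

Lemma mean_conj_linear a K K' : mean_conj (a *: K + K') = a *: mean_conj K + mean_conj K'.
Proof.
apply/matrixP => i j; rewrite [RHS]mxE [X in _ = X + _]mxE !mean_conjE mulr_sumr -big_split /=.
by apply: eq_bigr => kl _; rewrite !mxE; ring.
Qed.

Lemma integral_quad_form_conj K z :
  (\int[P]_w (quad_form K (L1 w *m z))%:E = (quad_form (mean_conj K) z)%:E)%E.
Proof.
under eq_integral do rewrite -quad_form_conj.
have [//|_ ->//] := @expectation_linear _ Omega R P _ _ (fun A => quad_form A z)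
  (fun w => (L1 w)^T *m K *m L1 w) _ (integrable_conj K).
by move=> a u v; rewrite quad_formD quad_formZ.
Qed.

Lemma integral_quad_form_N z :
  (\int[P]_w (quad_form (N1 w) z)%:E = (quad_form (mx_expectation P N1) z)%:E)%E.
Proof.
have [//|_ ->//] := @expectation_linear _ Omega R P _ _ (fun A => quad_form A z)
  N1 _ integrable_N.
by move=> a u v; rewrite quad_formD quad_formZ.
Qed.

Lemma mx_expectation_sym p (A : Omega -> 'M[R]_p) : (forall w, (A w)^T = A w) ->
  (mx_expectation P A)^T = mx_expectation P A.
Proof.
move=> symA; apply/matrixP => i j; rewrite !mxE; congr (fine _); congr expectation.
by apply/funext => w; rewrite -[in LHS]symA mxE.
Qed.

Lemma psd_mean_conj K : psd K -> psd (mean_conj K).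
Proof.
move=> [symK pos]; split.
  by apply: mx_expectation_sym => w; rewrite !trmx_mul trmxK symK mulmxA.
move=> z; rewrite -lee_fin -integral_quad_form_conj.
by apply: integral_ge0 => w _; rewrite lee_fin.
Qed.

Lemma loewner_mean_conj K K' : loewner K K' -> loewner (mean_conj K) (mean_conj K').
Proof.
move=> KK' z; rewrite -subr_ge0 -quad_formB.
have -> : mean_conj K' - mean_conj K = mean_conj (K' - K).
  by rewrite [K' - K]addrC -[- K]scaleN1r mean_conj_linear scaleN1r addrC.
rewrite -lee_fin -integral_quad_form_conj.
by apply: integral_ge0 => w _; rewrite lee_fin quad_formB subr_ge0.
Qed.

Hypothesis psdN : forall w, psd (N1 w).

Lemma psd_mean_N : psd (mx_expectation P N1).
Proof.
split; first by apply: mx_expectation_sym => w; have [] := psdN w.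
move=> z; rewrite -lee_fin -integral_quad_form_N.
by apply: integral_ge0 => w _; rewrite lee_fin; have [_] := psdN w; exact.
Qed.

Lemma psd_bellman Q : psd Q -> psd (bellman Q).
Proof.
move=> Qpsd; apply: psdD; first exact: psd_mean_N.
by apply: psd_mean_conj; exact: psd_Pi.
Qed.

Lemma loewner_bellman Q Q' : psd Q -> psd Q' -> loewner Q Q' ->
  loewner (bellman Q) (bellman Q').
Proof.
move=> Qpsd Qpsd' QQ' z; rewrite !quad_formD lerD2l.
by apply: loewner_mean_conj; exact: loewner_Pi.
Qed.

Lemma quad_form_bellmanZ c Q z : 0 <= c -> psd Q ->
  quad_form (bellman (c *: Q)) z =
  c * quad_form (bellman Q) z + (1 - c) * quad_form (mx_expectation P N1) z.
Proof.
move=> c0 Qpsd; rewrite !quad_formD.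
suff -> : quad_form (mean_conj (lq_Pi (c *: Q))) z = c * quad_form (mean_conj (lq_Pi Q)) z.
  by ring.
apply: EFin_inj; rewrite EFinM -!integral_quad_form_conj.
rewrite -[RHS]ge0_integralZl//.
- by apply: eq_integral => w _; rewrite quad_form_PiZ.
- apply/measurable_EFinP; apply: measurable_quad_form => //.
  by apply: measurable_mulmx.
- by move=> w _; rewrite lee_fin; have [_] := psd_Pi Qpsd; exact.
Qed.

End lq_moments.

(** * Value iteration *)

Section lq.
Context {d : measure_display} {Omega : measurableType d} {R : realType} {n m : nat}.
Variable P : probability Omega R.
Variables (L : nat -> Omega -> 'M[R]_(n, n + m)) (N : nat -> Omega -> 'M[R]_(n + m)).

Let X k := sample L N k.+1.

Local Notation past_type t := (g_sigma_algebraType (past X t)).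

Hypothesis Xiid : iid P X.
Hypothesis psdN : forall t w, (1 <= t)%N -> psd (N t w).
Hypothesis moment : ('E_P[fun w => (mx_norm2 (N 1%N w) ^+ 2
                 + mx_norm2 ((L 1%N w)^T *m L 1%N w) ^+ 2)%R] < +oo)%E.

Let EN := mx_expectation P (N 1%N).
Let MC := mean_conj P (L 1%N).
Let F := bellman P (L 1%N) (N 1%N).

Lemma filtration_past t : filtration L N t = <<s past X t >>.
Proof.
rewrite /filtration; congr (<<s _ >>); apply/seteqP; split => A.
  by case=> -[//|s] /= st [B mB <-]; exists s => //; exists B.
by case=> s /= st [B mB <-]; exists s.+1 => //; exists B.
Qed.

Let mX k : measurable_fun setT (X k).
Proof. by case: Xiid => + _ _; exact. Qed.

Let mL1 : measurable_fun setT (L 1%N).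
Proof. exact: (measurableT_comp measurable_fst (mX 0%N)). Qed.

Let mN1 : measurable_fun setT (N 1%N).
Proof. exact: (measurableT_comp measurable_snd (mX 0%N)). Qed.

Let psdN1 w : psd (N 1%N w). Proof. exact: psdN. Qed.

Let ENpsd : psd EN. Proof. exact: psd_mean_N mN1 moment psdN1. Qed.

Let MCpsd K : psd K -> psd (MC K). Proof. exact: psd_mean_conj mL1 moment K. Qed.

Let Fpsd Q : psd Q -> psd (F Q). Proof. exact: psd_bellman mL1 mN1 moment psdN1 Q. Qed.

Let Fle Q Q' : psd Q -> psd Q' -> loewner Q Q' -> loewner (F Q) (F Q').
Proof. exact: loewner_bellman mL1 moment Q Q'. Qed.

Lemma past_measurable_wrt t (d' : measure_display) (U : measurableType d') (Y : Omega -> U) :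
  measurable_wrt (filtration L N t) Y <-> measurable_fun setT (Y : past_type t -> U).
Proof.
rewrite filtration_past; split=> [mY _ B mB|mY B mB]; first by rewrite setTI; exact: mY.
by rewrite -[_ @^-1` _]setTI; exact: mY.
Qed.

Lemma past_measurable_sample s t : (s < t)%N ->
  measurable_fun setT (L s.+1 : past_type t -> _) /\
  measurable_fun setT (N s.+1 : past_type t -> _).
Proof.
move=> st; have mXs : measurable_fun setT (X s : past_type t -> _).
  by move=> _ B mB; apply: sub_sigma_algebra; exists s => //; exists B.
by split; [exact: (measurableT_comp measurable_fst mXs)
          |exact: (measurableT_comp measurable_snd mXs)].
Qed.

(** One stage of the dynamics integrated against the past. It serves dynamic programming with
    [c = 1] and the Lyapunov argument with a small positive [c]. *)
Lemma integral_step t A c K (Z : Omega -> 'cV[R]_(n + m)) : 0 <= c -> psd K ->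
  <<s past X t >> A -> measurable_fun setT (Z : past_type t -> _) ->
  (\int[P]_(w in A)
     (c * quad_form (N t.+1 w) (Z w) + quad_form K (L t.+1 w *m Z w))%:E =
   \int[P]_(w in A) (quad_form (c *: EN + MC K) (Z w))%:E)%E.
Proof.
move=> c0 [_ K0] pA mZ.
(* Freezing the past needs a function nonnegative on all pairs of matrices, whereas N is positive
   semidefinite only along the samples; the truncation at 0 is inactive there. *)
pose f (z : past_type t * ('M[R]_(n, n + m) * 'M[R]_(n + m))) : R :=
  c * Num.max 0 (quad_form z.2.2 (Z z.1)) + quad_form K (z.2.1 *m Z z.1).
have mZ1 : measurable_fun setT
    (fun z : past_type t * ('M[R]_(n, n + m) * 'M[R]_(n + m)) => Z z.1).
  exact: (measurableT_comp mZ).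
have mf : measurable_fun setT (EFin \o f).
  apply/measurable_EFinP; apply: measurable_funD.
    apply: measurable_funM => //; apply: measurable_maxr => //.
    apply: measurable_quad_form => //.
    exact: (measurableT_comp measurable_snd measurable_snd).
  apply: measurable_quad_form => //; apply: measurable_mulmx => //.
  exact: (measurableT_comp measurable_fst measurable_snd).
have f0 z : (0 <= (EFin \o f) z)%E.
  by rewrite lee_fin addr_ge0// mulr_ge0// le_max lexx.
have maxN s w z : Num.max 0 (quad_form (N s.+1 w) z) = quad_form (N s.+1 w) z.
  by apply/max_idPr; have [_] := psdN w (ltn0Sn s); exact.
transitivity (\int[P]_(w in A) (EFin \o f) (w, X t w))%E.
  by apply: eq_integral => w _; rewrite /f /= maxN.
rewrite (integral_freeze Xiid)//; apply: eq_integral => w _.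
transitivity (\int[P]_v (c%:E * (quad_form (N 1%N v) (Z w))%:E +
    (quad_form K (L 1%N v *m Z w))%:E))%E.
  by apply: eq_integral => v _; rewrite /f /= maxN EFinD EFinM.
have N0 v : 0 <= quad_form (N 1%N v) (Z w) by have [_] := psdN1 v; exact.
have mqN : measurable_fun setT (fun v => (quad_form (N 1%N v) (Z w))%:E).
  by apply/measurable_EFinP; exact: measurable_quad_form.
have mqK : measurable_fun setT (fun v => (quad_form K (L 1%N v *m Z w))%:E).
  by apply/measurable_EFinP; apply: measurable_quad_form => //; exact: measurable_mulmx.
rewrite ge0_integralD//.
- rewrite ge0_integralZl//; last by move=> v _; rewrite lee_fin.
  rewrite (integral_quad_form_N mN1 moment) (integral_quad_form_conj mL1 moment).
  by rewrite quad_formD quad_formZ EFinD EFinM.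
- by move=> v _; rewrite -EFinM lee_fin mulr_ge0.
- exact: measurable_funeM.
- by move=> v _; rewrite lee_fin.
Qed.

Definition value_iteration k : 'M[R]_(n + m) := iter k F 0.

Local Notation VI := value_iteration.

Lemma psd_value_iteration k : psd (VI k).
Proof. by elim: k => [|k IH] /=; [exact: psd0|exact: Fpsd]. Qed.

Lemma value_iteration_mono k : loewner (VI k) (VI k.+1).
Proof.
elim: k => [|k IH].
  by move=> x; rewrite quad_form0; have [_] := psd_value_iteration 1; exact.
exact: (Fle (psd_value_iteration k) (psd_value_iteration k.+1) IH).
Qed.

(** Dynamic programming against an arbitrary admissible control: the first [k] stages already cost
    at least what the optimal [k]-stage problem costs. *)
Lemma value_iteration_le_value k x :
  ((quad_form (lq_Pi (VI k)) x)%:E <= value L N P x)%E.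
Proof.
apply: le_ereal_inf_tmp => _ [u uadm <-].
pose xs t w := state (L^~ w) x (u^~ w) t.
pose z t w := col_mx (xs t w) (u t w).
have mu t : measurable_fun setT (u t : past_type t -> _).
  by apply/past_measurable_wrt; exact: uadm.
have mxs t : measurable_fun setT (xs t : past_type t -> _).
  elim: t => [|t IH]; first exact: measurable_cst.
  have [mLt _] := past_measurable_sample (ltnSn t).
  apply: measurable_mulmx => //; apply: measurable_col_mx.
    exact: past_measurable_fun_le (leqnSn t) IH.
  exact: past_measurable_fun_le (leqnSn t) (mu t).
have mz t : measurable_fun setT (z t : past_type t -> _) by exact: measurable_col_mx.
(* Expected optimal cost of the [k - t] remaining stages from the current state; it decreases by at
   most the stage cost [c t]. *)
pose a t := (\int[P]_w (quad_form (lq_Pi (VI (k - t))) (xs t w))%:E)%E.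
pose c t := (\int[P]_w (quad_form (N t.+1 w) (z t w))%:E)%E.
have mO t (Y : Omega -> R) : measurable_fun setT (Y : past_type t -> R) ->
    measurable_fun setT (EFin \o Y).
  by move=> mY; apply/measurable_EFinP; exact: (past_measurable_fun Xiid mY).
have N0 t w : 0 <= quad_form (N t.+1 w) (z t w) by have [_] := psdN w (ltn0Sn t); exact.
have mN t : measurable_fun setT (fun w => (quad_form (N t.+1 w) (z t w))%:E).
  apply: (mO t.+1); apply: measurable_quad_form.
    by have [] := past_measurable_sample (ltnSn t).
  exact: past_measurable_fun_le (leqnSn t) (mz t).
have ac t : (t < k)%N -> (a t <= c t + a t.+1)%E.
  move=> tk; set K := lq_Pi (VI (k - t.+1)).
  have Kpsd : psd K by apply: psd_Pi; exact: psd_value_iteration.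
  have kt : (k - t = (k - t.+1).+1)%N by rewrite subnSK.
  have pT : <<s past X t >> setT by exact: (@measurableT _ (past_type t)).
  have := integral_step ler01 Kpsd pT (mz t).
  have -> : 1 *: EN + MC K = VI (k - t) by rewrite scale1r kt.
  under eq_integral do rewrite mul1r EFinD.
  rewrite ge0_integralD//; last 3 first.
  - by move=> w _; rewrite lee_fin.
  - by move=> w _; rewrite lee_fin; have [_] := Kpsd; exact.
  - by have := mO t.+1 _ (measurable_quad_form (measurable_cst K) (mxs t.+1)).
  rewrite -/(c t) /a => ->.
  apply: ge0_le_integral => //.
  - by move=> w _; rewrite lee_fin; have [_] := psd_Pi (psd_value_iteration (k - t)); exact.
  - exact: (mO t _ (measurable_quad_form (measurable_cst _) (mxs t))).
  - exact: (mO t _ (measurable_quad_form (measurable_cst _) (mz t))).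
  - by move=> w _; rewrite lee_fin quad_form_Pi_le//; exact: psd_value_iteration.
have c0 t : (0 <= c t)%E by apply: integral_ge0 => w _; rewrite lee_fin.
have telescope j : (j <= k)%N -> (a 0%N <= \sum_(0 <= t < j) c t + a j)%E.
  elim: j => [|j IH] jk; first by rewrite big_geq// add0e.
  apply: le_trans (IH (ltnW jk)) _.
  by rewrite big_nat_recr//= -addeA leeD2l// ac.
have -> : (quad_form (lq_Pi (VI k)) x)%:E = a 0%N.
  by rewrite /a subn0 /xs /= integral_cst// [X in (_ * X)%E]probability_setT mule1.
(* At the horizon no stage remains, since [VI 0 = 0]. *)
apply: le_trans (telescope k (leqnn k)) _.
have -> : a k = 0%E.
  apply: integral0_eq => w _; congr EFin; apply/eqP; rewrite eq_le subnn /=.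
  have [_ ->] := psd_Pi (psd_value_iteration 0); rewrite andbT.
  by apply: le_trans (quad_form_Pi_le _ 0 (psd_value_iteration 0)) _; rewrite quad_form0.
rewrite adde0 /c -ge0_integral_sum//; last by move=> t w _; rewrite lee_fin.
apply: ge0_le_integral_nonmeasurable => w.
  by apply: sume_ge0 => t _; rewrite lee_fin.
by apply: nneseries_lim_ge => t _ _; rewrite lee_fin; exact: N0.
Qed.

Hypothesis posEN : posdef EN.
Hypothesis wellposed : forall x, (value L N P x < +oo)%E.

(** The value function controls only Pi of the iterates, through its values at the basis vectors.
    One more Bellman step, with Pi bounded by a multiple of the identity, controls the full
    matrices. *)
Lemma trace_value_iteration_bounded : exists C : R, forall k, \tr (VI k) <= C.
Proof.
pose v := \sum_(i < n) fine (value L N P (delta_mx i 0)).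
have trPi k : \tr (lq_Pi (VI k)) <= v.
  apply: ler_sum => i _; rewrite -quad_form_delta -lee_fin fineK.
    exact: value_iteration_le_value.
  rewrite fin_numElt wellposed andbT.
  apply: lt_le_trans (value_iteration_le_value k _); exact: ltNyr.
have v0 : 0 <= v.
  apply: le_trans (trPi 0%N); rewrite -(mxtrace0 R n); apply: loewner_trace => x.
  by rewrite quad_form0; have [_] := psd_Pi (psd_value_iteration 0); exact.
exists (\tr EN + \tr (MC ((n%:R * v) *: 1%:M))) => -[|k].
  rewrite mxtrace0 addr_ge0//; rewrite -(mxtrace0 R (n + m)); apply: loewner_trace => x.
    by rewrite quad_form0; have [_] := ENpsd; exact.
  rewrite quad_form0.
  have [|_] := @MCpsd ((n%:R * v) *: 1%:M); last exact.
  apply: psdZ; first by rewrite mulr_ge0.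
  by split=> [|y]; rewrite ?trmx1// quad_form1 sqnorm_ge0.
rewrite /= /F /bellman linearD /= lerD2l; apply: loewner_trace.
apply: (loewner_mean_conj mL1 moment) => x.
rewrite quad_formZ quad_form1.
have Pi0 : loewner 0 (lq_Pi (VI k)).
  by move=> y; rewrite quad_form0; have [_] := psd_Pi (psd_value_iteration k); exact.
apply: le_trans (quad_form_le_trace x Pi0) _.
by rewrite ler_wpM2r ?sqnorm_ge0// ler_wpM2l.
Qed.

(* Value iteration increases with bounded trace, so one step of it eventually
   changes the iterate by an arbitrarily small factor. *)
Lemma approximate_fixed_point : exists (K : 'M[R]_(n + m)) (delta c : R),
  [/\ psd K, 0 < delta <= 1, 0 < c &
   [/\ forall z, delta * quad_form K z <= quad_form EN z,
       forall z, c * sqnorm z <= quad_form K z,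
       loewner K (F K) &
       forall z, quad_form (F K) z <= (1 + delta ^+ 2 / 8) * quad_form K z]].
Proof.
have [C trC] := trace_value_iteration_bounded.
have [c c0 cEN] := posdef_ge_scalar posEN.
pose D : R := (n + m)%:R * Num.max C 0.
have D0 : 0 <= D by rewrite mulr_ge0// le_max lexx orbT.
have VI0 k : loewner 0 (VI k).
  by move=> x; rewrite quad_form0; have [_] := psd_value_iteration k; exact.
have VID k z : quad_form (VI k) z <= D * sqnorm z.
  apply: le_trans (quad_form_le_trace z (VI0 k)) _.
  by rewrite ler_wpM2r ?sqnorm_ge0// ler_wpM2l// le_max trC.
(* All iterates are at most [D] and [EN] is at least [c], so any ratio up to c/D would do; adding
   [c] to the denominator keeps it positive and [delta <= 1]. *)
pose delta := c / (D + c).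
have Dc : 0 < D + c by rewrite ltr_wpDl.
have delta0 : 0 < delta by rewrite divr_gt0.
have delta1 : delta <= 1 by rewrite ler_pdivrMr// mul1r lerDr.
have ENVI k z : quad_form EN z <= quad_form (VI k.+1) z.
  rewrite /= /F quad_formD lerDl.
  have [|_] := @MCpsd (lq_Pi (VI k)); last exact.
  by apply: psd_Pi; exact: psd_value_iteration.
(* A trace increment [eta] bounds the increment of the form by (n + m) eta |z|^2, hence by delta^2/8
   times c|z|^2, hence by delta^2/8 times the iterate. *)
pose eta := c * (delta ^+ 2 / 8) / (n + m).+1%:R.
have eta0 : 0 < eta by rewrite divr_gt0// mulr_gt0// divr_gt0// exprn_gt0.
(* If no step were that small the trace would grow linearly. The index is k + 1 because [VI 0 = 0],
   while [VI k.+1] dominates [EN]. *)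
have [k hk] : exists k, \tr (VI k.+2) - \tr (VI k.+1) <= eta.
  apply: contrapT => /forallNP H.
  have grow k : k%:R * eta <= \tr (VI k.+1).
    elim: k => [|k IH].
      rewrite mul0r -(mxtrace0 R (n + m)); exact: loewner_trace.
    rewrite -natr1 mulrDl mul1r; have /negP := H k; rewrite -ltNge; lra.
  have := grow (Num.bound (C / eta)); apply/negP; rewrite -ltNge.
  apply: le_lt_trans (trC _) _; rewrite -ltr_pdivrMr//.
  apply: le_lt_trans (ler_norm _) _.
  by have := archi_boundP (normr_ge0 (C / eta)); rewrite /Num.bound /= normr_id.
exists (VI k.+1), delta, c; split=> //; first exact: psd_value_iteration.
  by rewrite delta0.
split.
- move=> z; apply: le_trans (cEN z).
  apply: (@le_trans _ _ (delta * (D * sqnorm z))); first by rewrite ler_wpM2l ?VID// ltW.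
  rewrite mulrA ler_wpM2r ?sqnorm_ge0// /delta mulrAC ler_pdivrMr//.
  by rewrite ler_wpM2l ?(ltW c0)// lerDl ltW.
- by move=> z; exact: le_trans (cEN z) (ENVI k z).
- exact: value_iteration_mono.
move=> z; rewrite mulrDl mul1r -lerBlDl -quad_formB.
have inc : loewner 0 (VI k.+2 - VI k.+1).
  by move=> x; rewrite quad_form0 quad_formB subr_ge0; exact: value_iteration_mono.
apply: (le_trans (quad_form_le_trace z inc)).
rewrite linearB /=.
apply: (@le_trans _ _ ((n + m)%:R * eta * sqnorm z)).
  by rewrite ler_wpM2r ?sqnorm_ge0// ler_wpM2l.
apply: (@le_trans _ _ (delta ^+ 2 / 8 * (c * sqnorm z))); last first.
  apply: ler_wpM2l; first by rewrite divr_ge0// sqr_ge0.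
  by apply: le_trans (cEN z) (ENVI k z).
rewrite mulrA ler_wpM2r ?sqnorm_ge0// /eta mulrA ler_pdivrMr// mulrC [delta ^+ 2 / _ * c]mulrC.
by rewrite ler_wpM2l// ?ler_nat// mulr_ge0 ?(ltW c0)// divr_ge0// sqr_ge0.
Qed.

End lq.

(** * Boundedness of the Q-learning iterates *)

(** The trace itself need not decrease under [A], but it does under a high power: Q is at most a
    multiple of K, and A^j K <= rho^j K. Summing the traces of Q, AQ, ..., A^J Q, a truncated
    Neumann series, gives a functional that decreases at every step. *)
Lemma linear_lyapunov (R : realType) (k : nat) (A : 'M[R]_k -> 'M[R]_k)
    (K : 'M[R]_k) (rho c : R) :
  (forall a u v, A (a *: u + v) = a *: A u + A v) ->
  (forall u v, loewner u v -> loewner (A u) (A v)) ->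
  0 < c -> (forall z, c * sqnorm z <= quad_form K z) ->
  0 <= rho < 1 -> (forall z, quad_form (A K) z <= rho * quad_form K z) ->
  exists (l : 'M[R]_k -> R) (C eps : R),
    [/\ forall a u v, l (a *: u + v) = a * l u + l v,
        forall Q, loewner 0 Q -> \tr Q <= l Q <= C * \tr Q,
        0 <= C, 0 < eps <= 1 &
        forall Q, loewner 0 Q -> l (A Q) <= (1 - eps) * l Q].
Proof.
move=> linA monoA c0 cK /andP[rho0 rho1] AK.
have A0 : A 0 = 0.
  by have := linA (-1) 0 0; rewrite scaler0 addr0 scaleN1r addNr.
have linAk j a u v : iter j A (a *: u + v) = a *: iter j A u + iter j A v.
  by elim: j => //= j ->; rewrite linA.
have monoAk j u v : loewner u v -> loewner (iter j A u) (iter j A v).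
  by move=> uv; elim: j => //= j; exact: monoA.
have A0k j : iter j A 0 = 0 by elim: j => //= j ->.
have posAk j Q : loewner 0 Q -> loewner 0 (iter j A Q).
  by move=> /(monoAk j); rewrite A0k.
have tr_ge0 Q : loewner 0 Q -> 0 <= \tr Q by move=> /loewner_trace; rewrite mxtrace0.
have AkK j z : quad_form (iter j A K) z <= rho ^+ j * quad_form K z.
  elim: j z => [|j IH] z /=; first by rewrite expr0 mul1r.
  have h : loewner (iter j A K) (rho ^+ j *: K) by move=> y; rewrite quad_formZ.
  apply: (le_trans (monoA _ _ h z)); rewrite -[_ *: K]addr0 linA A0 addr0 quad_formZ.
  by rewrite exprSr -mulrA ler_wpM2l// exprn_ge0.
have K0 : loewner 0 K.
  move=> z; rewrite quad_form0; apply: le_trans (cK z).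
  by rewrite mulr_ge0 ?sqnorm_ge0// ltW.
pose M := k%:R / c * \tr K.
have M0 : 0 <= M by rewrite mulr_ge0 ?tr_ge0// divr_ge0// ltW.
have trAk j Q : loewner 0 Q -> \tr (iter j A Q) <= rho ^+ j * M * \tr Q.
  move=> Q0; pose q := k%:R / c * \tr Q.
  have q0 : 0 <= q by rewrite mulr_ge0 ?tr_ge0// divr_ge0// ltW.
  have Qq : loewner Q (q *: K).
    move=> z; rewrite quad_formZ; apply: (le_trans (quad_form_le_trace z Q0)).
    have -> : q * quad_form K z = k%:R * \tr Q * (c^-1 * quad_form K z).
      by rewrite /q; ring.
    rewrite ler_wpM2l ?mulr_ge0 ?tr_ge0//.
    by rewrite ler_pdivlMl.
  have /loewner_trace : loewner (iter j A Q) ((q * rho ^+ j) *: K).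
    move=> z; apply: (le_trans (monoAk j _ _ Qq z)).
    rewrite -[q *: K]addr0 linAk A0k addr0 !quad_formZ.
    by rewrite -[leRHS]mulrA; apply: ler_wpM2l.
  move=> /le_trans; apply; rewrite mxtraceZ /q /M le_eqVlt; apply/orP; left.
  by apply/eqP; ring.
(* After J + 1 steps the trace is at most halved, uniformly in Q. *)
have [J hJ] : exists J, rho ^+ J.+1 * M <= 2^-1.
  have /cvgrPdist_le : rho ^+ j @[j --> \oo] --> (0 : R).
    by apply: cvg_expr; rewrite ger0_norm.
  have e0 : 0 < 2^-1 / (M + 1) by rewrite divr_gt0// ltr_wpDl.
  move=> /(_ _ e0) [J _ HJ]; exists J.
  have := HJ J.+1 (leqnSn J); rewrite /= sub0r normrN ger0_norm ?exprn_ge0// => h.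
  have : rho ^+ J.+1 * M <= rho ^+ J.+1 * (M + 1) by rewrite ler_wpM2l ?exprn_ge0// lerDl.
  by move=> /le_trans; apply; rewrite -ler_pdivlMr// ltr_wpDl.
pose l Q := \sum_(j < J.+1) \tr (iter j A Q).
pose C := J.+1%:R * M + 1.
have C1 : 1 <= C by rewrite lerDr mulr_ge0.
have lle Q : loewner 0 Q -> \tr Q <= l Q <= C * \tr Q.
  move=> Q0; apply/andP; split.
    by rewrite /l big_ord_recl lerDl sumr_ge0// => i _; apply: tr_ge0; exact: posAk.
  apply: (@le_trans _ _ (\sum_(j < J.+1) M * \tr Q)).
    apply: ler_sum => j _; apply: (le_trans (trAk j Q Q0)).
    by rewrite ler_wpM2r ?tr_ge0// ler_piMl// exprn_ile1// ltW.
  rewrite sumr_const card_ord -mulr_natl mulrA ler_wpM2r ?tr_ge0//.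
  by rewrite lerDl.
exists l, C, (2 * C)^-1; split=> //.
- move=> a u v; rewrite /l mulr_sumr -big_split; apply: eq_bigr => j _.
  by rewrite linAk mxtraceD mxtraceZ.
- by apply: le_trans C1.
- by rewrite invr_gt0 mulr_gt0 ?(lt_le_trans _ C1)//= invf_le1 ?mulr_gt0 ?(lt_le_trans _ C1)//; lra.
move=> Q Q0.
(* Shifting the sum loses tr Q and gains tr A^(J+1) Q, at most half of it; the net loss tr Q / 2 is
   at least l(Q) / (2 C). *)
have -> : l (A Q) = l Q - \tr Q + \tr (iter J.+1 A Q).
  rewrite /l big_ord_recr [in RHS]big_ord_recl /= [\tr Q + _]addrC addrK -iterSr.
  by congr (_ + _); apply: eq_bigr => j _; rewrite -iterSr.
have h1 := trAk J.+1 Q Q0.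
have h2 : rho ^+ J.+1 * M * \tr Q <= 2^-1 * \tr Q by rewrite ler_wpM2r ?tr_ge0.
have /andP[_ h3] := lle Q Q0.
have h4 : (2 * C)^-1 * l Q <= 2^-1 * \tr Q.
  rewrite invfM -mulrA ler_wpM2l// -ler_pdivlMl ?invrK//.
  by rewrite invr_gt0 (lt_le_trans _ C1).
rewrite mulrBl mul1r; lra.
Qed.

(** Second-order Taylor bound: the squared positive part has a derivative that is Lipschitz with
    constant 2. *)
Lemma pos_part_sqr_le (R : realType) (x t b : R) :
  Num.max 0 (x + t - b) ^+ 2 <=
  Num.max 0 (x - b) ^+ 2 + 2 * (Num.max 0 (x - b) * t) + t ^+ 2.
Proof.
have [h1|h1] := leP 0 (x - b); have [h2|h2] := leP 0 (x + t - b); nra.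
Qed.

Lemma sqrD_le (R : realType) (x y : R) : (x + y) ^+ 2 <= 2 * x ^+ 2 + 2 * y ^+ 2.
Proof.
rewrite -subr_ge0 (_ : _ - _ = (x - y) ^+ 2); first exact: sqr_ge0.
by ring.
Qed.

(** * One-step drift and variance of the iterates *)

Section stability_of_the_iterates.
Context {d : measure_display} {Omega : measurableType d} {R : realType} {n m : nat}.
Variable P : probability Omega R.
Variables (L1 : Omega -> 'M[R]_(n, n + m)) (N1 : Omega -> 'M[R]_(n + m)).
Hypothesis mL : measurable_fun setT L1.
Hypothesis mN : measurable_fun setT N1.
Hypothesis psdN : forall w, psd (N1 w).
Hypothesis moment :
  ('E_P[fun w => (mx_norm2 (N1 w) ^+ 2 + mx_norm2 ((L1 w)^T *m L1 w) ^+ 2)%R] < +oo)%E.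

Let EN := mx_expectation P N1.
Let MC := mean_conj P L1.
Let F := bellman P L1 N1.

Let trN w := \tr (N1 w).
Let sqL w := \sum_(ki : 'I_n * 'I_(n + m)) L1 w ki.1 ki.2 ^+ 2.

Lemma integrable_sqr_of_bound (f : Omega -> R) (B : R) : measurable_fun setT f -> 0 < B ->
  (forall w, f w ^+ 2 <= B *
    (mx_norm2 (N1 w) ^+ 2 + mx_norm2 ((L1 w)^T *m L1 w) ^+ 2)) ->
  P.-integrable setT (fun w => (f w ^+ 2)%:E).
Proof.
move=> mf B0 fB.
have I : P.-integrable setT (fun w => (B^-1 * f w ^+ 2)%:E).
  apply: (integrable_dominated moment).
    by apply: measurable_funM => //; exact: measurable_funX.
  move=> w; rewrite ger0_norm; first by rewrite ler_pdivrMl.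
  by apply: mulr_ge0; [rewrite invr_ge0 ltW|exact: sqr_ge0].
apply: eq_integrable (integrableZl measurableT B I) => // w _.
by rewrite /= -EFinM mulVKf// gt_eqF.
Qed.

Let mtrN : measurable_fun setT trN.
Proof. by apply: measurable_sum => i; exact: measurable_entry. Qed.

Let msqL : measurable_fun setT sqL.
Proof.
by apply: measurable_sum => ki; apply: measurable_funX; exact: measurable_entry.
Qed.

Let ItrN : P.-integrable setT (fun w => (trN w ^+ 2)%:E).
Proof.
apply: (@integrable_sqr_of_bound _ (1 + (n + m)%:R ^+ 2)) => //.
move=> w; apply: (@le_trans _ _ ((n + m)%:R ^+ 2 * mx_norm2 (N1 w) ^+ 2)).
  rewrite -exprMn -[leLHS]real_normK ?num_real//.
  apply: lerXn2r; rewrite ?nnegrE ?mulr_ge0 ?mx_norm2_ge0//.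
  rewrite /trN (le_trans (ler_norm_sum _ _ _))// mulr_natl -[X in _ *+ X]card_ord.
  by rewrite -sumr_const; apply: ler_sum => i _; exact: entry_le_norm2.
have : 0 <= (n + m)%:R ^+ 2 * mx_norm2 ((L1 w)^T *m L1 w) ^+ 2.
  by rewrite mulr_ge0// sqr_ge0.
have := sqr_ge0 (mx_norm2 (N1 w)); have := sqr_ge0 (mx_norm2 ((L1 w)^T *m L1 w)); lra.
Qed.

Let IsqL : P.-integrable setT (fun w => (sqL w ^+ 2)%:E).
Proof.
pose k : R := #|{: 'I_n * 'I_(n + m)}|%:R.
apply: (@integrable_sqr_of_bound _ (1 + k ^+ 2)) => //.
  by rewrite ltr_wpDr// sqr_ge0.
move=> w; apply: (@le_trans _ _ (k ^+ 2 * mx_norm2 ((L1 w)^T *m L1 w) ^+ 2)).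
  rewrite -exprMn -[leLHS]real_normK ?num_real//.
  apply: lerXn2r; rewrite ?nnegrE ?mulr_ge0 ?mx_norm2_ge0//.
  rewrite /sqL (le_trans (ler_norm_sum _ _ _))// /k mulr_natl.
  rewrite -sumr_const; apply: ler_sum => ki _.
  by rewrite expr2; exact: gram_entry_le_norm2.
have : 0 <= k ^+ 2 * mx_norm2 (N1 w) ^+ 2 by rewrite mulr_ge0// sqr_ge0.
have := sqr_ge0 (mx_norm2 (N1 w)); have := sqr_ge0 (mx_norm2 ((L1 w)^T *m L1 w)); lra.
Qed.

Lemma loewner_trace_conj (K : 'M[R]_n) w : loewner 0 K ->
  \tr ((L1 w)^T *m K *m L1 w) <= n%:R * \tr K * sqL w.
Proof.
move=> K0; rewrite /mxtrace.
have -> : sqL w = \sum_i sqnorm (L1 w *m delta_mx i 0).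
  rewrite /sqL -(pair_bigA _ (fun k i => L1 w k i ^+ 2)) exchange_big.
  by apply: eq_bigr => i _; rewrite -colE; apply: eq_bigr => k _; rewrite mxE.
rewrite mulr_sumr; apply: ler_sum => i _.
by rewrite -quad_form_delta quad_form_conj; exact: quad_form_le_trace.
Qed.

Variables (K : 'M[R]_(n + m)) (rho c : R).
Hypothesis Kpsd : psd K.
Hypothesis c0 : 0 < c.
Hypothesis cK : forall z, c * sqnorm z <= quad_form K z.
Hypothesis rho01 : 0 <= rho < 1.
Hypothesis rhoK : forall z, quad_form (MC (lq_Pi K)) z <= rho * quad_form K z.

(* Freezing the gain at Gamma(K) dominates the nonlinear map Pi by a linear
   one, whose spectral radius is less than 1 because of rhoK. *)
Let G : 'M[R]_(n + m, n) := col_mx 1%:M (lq_Gamma K).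
Let A (Q : 'M[R]_(n + m)) := MC (G^T *m Q *m G).

Let GE (x : 'cV[R]_n) : G *m x = col_mx x (lq_Gamma K *m x).
Proof. by rewrite /G mul_col_mx mul1mx. Qed.

(** The first-order term is nonpositive because l(Q) drifts downwards above the level [b]. The
    second-order term is a^2 times a quadratic in l(Q), of the same growth as the Lyapunov function,
    and goes into the factor 1 + C a^2. *)
Lemma lyapunov_step : exists (l : 'M[R]_(n + m) -> R) (b C : R),
  [/\ forall a u v, l (a *: u + v) = a * l u + l v,
      forall Q, psd Q -> \tr Q <= l Q,
      0 <= C &
      forall Q a, psd Q -> 0 <= a <= 1 ->
      (\int[P]_w (1 + Num.max 0
          (l (Q + a *: (N1 w + (L1 w)^T *m lq_Pi Q *m L1 w - Q)) - b) ^+ 2)%:E <=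
       ((1 + C * a ^+ 2) * (1 + Num.max 0 (l Q - b) ^+ 2))%:E)%E].
Proof.
have [l [C [eps [linl lC C0 /andP[eps0 eps1] leps]]]] :
    exists (l : 'M[R]_(n + m) -> R) (C eps : R),
    [/\ forall a u v, l (a *: u + v) = a * l u + l v,
        forall Q, loewner 0 Q -> \tr Q <= l Q <= C * \tr Q,
        0 <= C, 0 < eps <= 1 &
        forall Q, loewner 0 Q -> l (A Q) <= (1 - eps) * l Q].
  apply: (linear_lyapunov (K := K) (rho := rho) (c := c)) => //.
  - move=> a u v; rewrite /A mulmxDr mulmxDl -scalemxAr -scalemxAl.
    exact: (mean_conj_linear mL moment).
  - move=> u v uv; apply: (loewner_mean_conj mL moment) => z.
    by rewrite !quad_form_conj.
  - move=> z; apply: le_trans (rhoK z).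
    apply: (loewner_mean_conj mL moment) => x.
    by rewrite quad_form_conj GE quad_form_Gamma.
have psd_loewner k (Q : 'M[R]_k) : psd Q -> loewner 0 Q.
  by move=> [_ pos] z; rewrite quad_form0.
have l0 : l 0 = 0 by have := linl (-1) 0 0; rewrite scaler0 addr0; lra.
have lD u v : l (u + v) = l u + l v by rewrite -[u]scale1r linl mul1r scale1r.
have lZ a u : l (a *: u) = a * l u by rewrite -[_ *: _]addr0 linl l0 addr0.
have lB u v : l (u - v) = l u - l v by rewrite -[- v]scaleN1r lD lZ mulN1r.
have lpos Q : loewner 0 Q -> 0 <= l Q.
  move=> Q0; have /andP[h _] := lC _ Q0; apply: le_trans h.
  by have := loewner_trace Q0; rewrite mxtrace0.
have lle u v : loewner u v -> l u <= l v.
  move=> uv; rewrite -subr_ge0 -lB; apply: lpos => z.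
  by rewrite quad_form0 quad_formB subr_ge0.
(* The level at which the contraction [eps] balances the constant input [l EN]. *)
pose b := l EN / eps.
have ENpsd : psd EN := psd_mean_N mN moment psdN.
have b0 : 0 <= b by rewrite divr_ge0 ?(ltW eps0)//; apply: lpos; exact: psd_loewner.
pose v1 := fine (\int[P]_w (trN w ^+ 2)%:E)%E.
pose v2 := fine (\int[P]_w (sqL w ^+ 2)%:E)%E.
have v10 : 0 <= v1 by apply: fine_ge0; apply: integral_ge0 => w _; rewrite lee_fin sqr_ge0.
have v20 : 0 <= v2 by apply: fine_ge0; apply: integral_ge0 => w _; rewrite lee_fin sqr_ge0.
pose c1 := 4 * C ^+ 2 * v1.
pose c2 := 4 * C ^+ 2 * n%:R ^+ 2 * v2 + 2.
have c10 : 0 <= c1 by rewrite !mulr_ge0// ?sqr_ge0.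
have c20 : 0 <= c2 by rewrite addr_ge0// !mulr_ge0// ?sqr_ge0.
exists l, b, (c1 + 2 * c2 * (1 + b ^+ 2)); split=> //.
- by move=> Q /psd_loewner /lC /andP[].
- by rewrite addr_ge0// !mulr_ge0// addr_ge0// sqr_ge0.
move=> Q a Qpsd /andP[a0 a1].
have Q0 := psd_loewner _ _ Qpsd.
pose q := l Q; have q0 : 0 <= q by exact: lpos.
pose H w := N1 w + (L1 w)^T *m lq_Pi Q *m L1 w.
pose h w := l (H w).
have Pipsd := psd_Pi Qpsd.
have Hpsd w : psd (H w) by apply: psdD => //; exact: psd_conj.
have h0 w : 0 <= h w by apply: lpos; exact: psd_loewner.
have trPi : \tr (lq_Pi Q) <= q.
  by apply: le_trans (trace_Pi Qpsd) _; have /andP[] := lC _ Q0.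
have hle w : h w <= C * trN w + C * (n%:R * q * sqL w).
  have /andP[_] := lC _ (psd_loewner _ _ (Hpsd w)).
  move=> /le_trans; apply; rewrite /H linearD /= mulrDr lerD2l ler_wpM2l//.
  apply: le_trans (loewner_trace_conj w (psd_loewner _ _ Pipsd)) _.
  rewrite ler_wpM2r//; last by rewrite ler_wpM2l.
  by apply: sumr_ge0 => ki _; exact: sqr_ge0.
have IH i j : P.-integrable setT (fun w => (H w i j)%:E).
  rewrite (_ : (fun w => _) = (fun w => (N1 w i j)%:E) \+
    (fun w => (((L1 w)^T *m lq_Pi Q *m L1 w) i j)%:E))%E; last first.
    by apply/funext => w; rewrite /H mxE EFinD.
  apply: integrableD => //; first exact: (integrable_N mN moment).
  exact: (integrable_conj mL moment).
have [Ih Eh] := expectation_linear linl IH.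
have EHE : mx_expectation P H = F Q.
  apply/matrixP => i j; rewrite mxE unlock; apply: EFin_inj.
  rewrite fineK; last exact: integrable_fin_num.
  transitivity (\int[P]_w (N1 w i j)%:E +
    \int[P]_w (((L1 w)^T *m lq_Pi Q *m L1 w) i j)%:E)%E.
    rewrite -integralD//.
    - by apply: eq_integral => w _; rewrite /H /= mxE EFinD.
    - exact: (integrable_N mN moment).
    - exact: (integrable_conj mL moment).
  rewrite /F /bellman mxE EFinD !mxE !unlock !fineK//.
  - by apply: integrable_fin_num => //; exact: (integrable_conj mL moment).
  - by apply: integrable_fin_num => //; exact: (integrable_N mN moment).
rewrite EHE in Eh.
have drift : l (F Q) - q <= eps * (b - q).
  rewrite /F /bellman lD mulrBr /b mulrCA divff ?gt_eqF// mulr1.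
  have : l (MC (lq_Pi Q)) <= l (A Q).
    apply: lle; apply: (loewner_mean_conj mL moment) => x.
    by rewrite quad_form_conj GE quad_form_Pi_le.
  have := leps _ Q0; rewrite -/q -/EN -/MC; lra.
pose e := Num.max 0 (q - b).
(* [g] bounds 2 h^2, so (h - q)^2 <= 2 q^2 + g with an integrable right-hand side; its mean is
   [c1 + c2 * q ^+ 2]. *)
pose g w := 4 * C ^+ 2 * trN w ^+ 2 + 4 * C ^+ 2 * n%:R ^+ 2 * q ^+ 2 * sqL w ^+ 2.
have Ig : P.-integrable setT (fun w => (g w)%:E).
  rewrite (_ : (fun w => _) = (fun w => (4 * C ^+ 2)%:E * (trN w ^+ 2)%:E) \+
    (fun w => (4 * C ^+ 2 * n%:R ^+ 2 * q ^+ 2)%:E * (sqL w ^+ 2)%:E))%E; last first.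
    by apply/funext => w; rewrite /= -!EFinM -EFinD.
  by apply: integrableD => //; exact: integrableZl.
have Eg : (\int[P]_w (g w)%:E = (c1 + (c2 - 2) * q ^+ 2)%:E)%E.
  have := integral_quadratic 0 (4 * C ^+ 2) (4 * C ^+ 2 * n%:R ^+ 2 * q ^+ 2) ItrN IsqL.
  rewrite -/v1 -/v2 => E; transitivity (\int[P]_w (0 + 4 * C ^+ 2 * trN w ^+ 2 +
     4 * C ^+ 2 * n%:R ^+ 2 * q ^+ 2 * sqL w ^+ 2)%:E)%E.
    by apply: eq_integral => w _; rewrite add0r.
  by rewrite E /c1 /c2; congr (_%:E); ring.
apply: (@le_trans _ _ (\int[P]_w ((1 + e ^+ 2 - 2 * (e * a) * q + 2 * a ^+ 2 * q ^+ 2)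
   + (2 * (e * a)) * h w + a ^+ 2 * g w)%:E)%E).
  apply: ge0_le_integral_nonmeasurable => w; rewrite lee_fin.
    by rewrite addr_ge0// sqr_ge0.
  have -> : l (Q + a *: (N1 w + (L1 w)^T *m lq_Pi Q *m L1 w - Q)) = q + a * (h w - q).
    by rewrite lD lZ lB.
  have := pos_part_sqr_le q (a * (h w - q)) b; rewrite -/e.
  have : (h w - q) ^+ 2 <= 2 * q ^+ 2 + g w.
    have s1 : h w ^+ 2 <= (C * trN w + C * (n%:R * q * sqL w)) ^+ 2.
      by rewrite ler_pXn2r// ?nnegrE// (le_trans (h0 w)).
    have s2 := sqrD_le (C * trN w) (C * (n%:R * q * sqL w)).
    have s3 := sqrD_le (h w) (- q); rewrite sqrrN in s3.
    have -> : g w = 2 * (2 * (C * trN w) ^+ 2 + 2 * (C * (n%:R * q * sqL w)) ^+ 2).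
      by rewrite /g; ring.
    lra.
  move=> /(ler_wpM2l (sqr_ge0 a)).
  rewrite [(a * (h w - q)) ^+ 2]exprMn; lra.
rewrite (integral_quadratic _ _ _ Ih Ig) Eh Eg /= lee_fin.
have e0 : 0 <= e by rewrite le_max lexx.
have ed : e * (l (F Q) - q) <= 0.
  rewrite /e; have [qb|qb] := leP 0 (q - b); last by rewrite mul0r.
  apply: (@le_trans _ _ ((q - b) * (eps * (b - q)))); first exact: ler_wpM2l.
  have : 0 <= eps * (q - b) ^+ 2 by rewrite mulr_ge0 ?sqr_ge0// ltW.
  nra.
have qe : q ^+ 2 <= 2 * (1 + b ^+ 2) * (1 + e ^+ 2).
  have : q <= e + b by rewrite -lerBlDr le_max lexx orbT.
  move=> qeb; apply: (@le_trans _ _ ((e + b) ^+ 2)); first by rewrite ler_pXn2r// nnegrE addr_ge0.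
  have := sqr_ge0 (e - b); have := mulr_ge0 (sqr_ge0 b) (sqr_ge0 e); nra.
rewrite -/e.
have ea : 2 * (e * a) * (l (F Q) - q) <= 0.
  rewrite (_ : _ * _ = 2 * a * (e * (l (F Q) - q))); last by ring.
  by rewrite mulr_ge0_le0// mulr_ge0.
have e2 : 0 <= e ^+ 2 by exact: sqr_ge0.
have cq : c1 + c2 * q ^+ 2 <= (c1 + 2 * c2 * (1 + b ^+ 2)) * (1 + e ^+ 2).
  have : c2 * q ^+ 2 <= c2 * (2 * (1 + b ^+ 2) * (1 + e ^+ 2)) by rewrite ler_wpM2l.
  have : 0 <= c1 * e ^+ 2 by rewrite mulr_ge0.
  lra.
have : a ^+ 2 * (c1 + c2 * q ^+ 2) <= a ^+ 2 * ((c1 + 2 * c2 * (1 + b ^+ 2)) * (1 + e ^+ 2)).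
  by rewrite ler_wpM2l// sqr_ge0.
lra.
Qed.
End stability_of_the_iterates.

Lemma centered_square_integrable (d : measure_display) (Omega : measurableType d)
    (R : realType) (P : probability Omega R) (f : Omega -> R) :
  measurable_fun setT f -> P.-integrable setT (fun w => (f w ^+ 2)%:E) ->
  let e := fine (\int[P]_w (f w)%:E)%E in
  [/\ P.-integrable setT (fun w => (f w - e)%:E),
      P.-integrable setT (fun w => ((f w - e) ^+ 2)%:E) &
      (\int[P]_w (f w - e)%:E = 0)%E].
Proof.
move=> mf If2 e; have If := integrable_of_sqr mf If2.
have mfe : measurable_fun setT (fun w => f w - e) by exact: measurable_funB.
have Ie2 := sqr_integrable_center e mf If2.
split => //; first exact: integrable_of_sqr.
transitivity (\int[P]_w (- e + 1 * f w + 0 * f w)%:E)%E.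
  by apply: eq_integral => w _; congr (_%:E); ring.
by rewrite (integral_quadratic _ _ _ If If) -/e mul1r mul0r addNr addr0.
Qed.

Lemma sum_cvg (R : realType) (I : finType) (u : I -> nat -> R) :
  (forall i, cvgn (u i)) -> cvgn (fun t => \sum_i u i t).
Proof.
move=> cu; rewrite -fct_sumE; elim/big_ind: _ => [|f g cf cg|i _]; last exact: cu.
  exact: is_cvg_cst.
exact: is_cvgD.
Qed.

(** * Bounded iterates and convergence of the noise series along a trajectory *)

Section trajectory.
Context {d : measure_display} {Omega : measurableType d} {R : realType} {n m : nat}.
Variable P : probability Omega R.
Variables (L : nat -> Omega -> 'M[R]_(n, n + m)) (N : nat -> Omega -> 'M[R]_(n + m)).
Variables (alpha : nat -> Omega -> R) (Q0 : 'M[R]_(n + m)).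

Let X k := sample L N k.+1.

Local Notation past_type t := (g_sigma_algebraType (past X t)).

Hypothesis Xiid : iid P X.
Hypothesis psdN : forall t w, (1 <= t)%N -> psd (N t w).
Hypothesis alpha01 : forall t w, 0 <= alpha t w <= 1.
Hypothesis malpha : forall t, measurable_wrt (filtration L N t) (alpha t).
Hypothesis moment : ('E_P[fun w => (mx_norm2 (N 1%N w) ^+ 2
                 + mx_norm2 ((L 1%N w)^T *m L 1%N w) ^+ 2)%R] < +oo)%E.
Hypothesis psdQ0 : psd Q0.

Let EN := mx_expectation P (N 1%N).
Let MC := mean_conj P (L 1%N).
Let F := bellman P (L 1%N) (N 1%N).

Let Q t w := Qlearning (L^~ w) (N^~ w) (alpha^~ w) Q0 t.

Let mX k : measurable_fun setT (X k).
Proof. by case: Xiid => + _ _; exact. Qed.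

Let mL1 : measurable_fun setT (L 1%N).
Proof. exact: (measurableT_comp measurable_fst (mX 0%N)). Qed.

Let mN1 : measurable_fun setT (N 1%N).
Proof. exact: (measurableT_comp measurable_snd (mX 0%N)). Qed.

Let psdN1 w : psd (N 1%N w). Proof. exact: psdN. Qed.

Let malpha' t : measurable_fun setT (alpha t : past_type t -> R).
Proof. by apply/past_measurable_wrt; exact: malpha. Qed.

Lemma psd_Qlearning t w : psd (Q t w).
Proof.
elim: t => [//|t IH]; rewrite /Q /= -/(Q t w).
have /andP[a0 a1] := alpha01 t w.
have -> : Q t w + alpha t w *: (N t.+1 w + (L t.+1 w)^T *m lq_Pi (Q t w) *m L t.+1 w - Q t w)
  = (1 - alpha t w) *: Q t w +
    alpha t w *: (N t.+1 w + (L t.+1 w)^T *m lq_Pi (Q t w) *m L t.+1 w).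
  by rewrite scalerBr scalerBl scale1r addrA addrAC.
apply: psdD; first by apply: psdZ => //; rewrite subr_ge0.
apply: psdZ => //; apply: psdD; first exact: psdN.
by apply: psd_conj; exact: psd_Pi.
Qed.

Lemma measurable_Qlearning t : measurable_fun setT (Q t : past_type t -> _).
Proof.
elim: t => [|t IH]; first exact: measurable_cst.
have mQ : measurable_fun setT (Q t : past_type t.+1 -> _).
  exact: past_measurable_fun_le (leqnSn t) IH.
have ma : measurable_fun setT (alpha t : past_type t.+1 -> R).
  exact (past_measurable_fun_le (leqnSn t) (@malpha' t)).
have [mLt mNt] := past_measurable_sample L N (ltnSn t).
apply: measurable_addmx => //; apply: measurable_scalemx => //.
apply: measurable_addmx; last exact: measurable_oppmx.
apply: measurable_addmx => //; apply: measurable_mulmx => //.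
apply: measurable_mulmx; first exact: measurable_trmx.
exact: measurable_Pi.
Qed.

Variables (K : 'M[R]_(n + m)) (rho c : R).
Hypothesis Kpsd : psd K.
Hypothesis c0 : 0 < c.
Hypothesis cK : forall z, c * sqnorm z <= quad_form K z.
Hypothesis rho01 : 0 <= rho < 1.
Hypothesis rhoK : forall z, quad_form (MC (lq_Pi K)) z <= rho * quad_form K z.

(** The factors 1 + C alpha^2 are divided out by the product [p], leaving a supermartingale. Since
    [alpha t] is known at time t, [p t.+1] is too, and [p] stays above exp(-C S), where [S] bounds
    the sum of the squared rates. *)
Lemma Qlearning_bounded : {ae P, forall w,
  (\sum_(0 <= t <oo) (alpha t w ^+ 2)%:E < +oo)%E -> exists M : R, forall t, \tr (Q t w) <= M}.
Proof.
have [l [b [C [linl trl C0 step]]]] :=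
  lyapunov_step mL1 mN1 psdN1 moment Kpsd c0 cK rho01 rhoK.
pose p t w := \prod_(0 <= s < t) (1 + C * alpha s w ^+ 2)^-1.
pose f (A : 'M[R]_(n + m)) := 1 + Num.max 0 (l A - b) ^+ 2.
pose Y t w := p t w * f (Q t w).
have C1 s w : 0 < 1 + C * alpha s w ^+ 2 by rewrite ltr_wpDr// mulr_ge0// sqr_ge0.
have p0 t w : 0 <= p t w by apply: prodr_ge0 => s _; rewrite invr_ge0 ltW.
have f0 A : 0 <= f A by rewrite addr_ge0// sqr_ge0.
have Y0 t w : 0 <= Y t w by rewrite mulr_ge0.
have ml d1 (T1 : measurableType d1) (A : T1 -> 'M[R]_(n + m)) :
    measurable_fun setT A -> measurable_fun setT (fun w => l (A w)).
  move=> mA; under eq_fun do rewrite (linear_entries _ linl).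
  by apply: measurable_sum => ij; apply: measurable_funM => //; exact: measurable_entry.
have mf d1 (T1 : measurableType d1) (A : T1 -> 'M[R]_(n + m)) :
    measurable_fun setT A -> measurable_fun setT (fun w => f (A w)).
  move=> mA; apply: measurable_funD => //; apply: measurable_funX.
  by apply: measurable_maxr => //; apply: measurable_funB => //; exact: ml.
have mp s t : (s <= t.+1)%N -> measurable_fun setT (p s : past_type t -> R).
  move=> st; rewrite /p; under eq_fun do rewrite big_mkord.
  apply: measurable_prod => i _; apply: measurable_funVr.
  apply: measurable_funD => //; apply: measurable_funM => //; apply: measurable_funX.
  apply: past_measurable_fun_le (@malpha' i).
  by rewrite -ltnS (leq_trans (ltn_ord i)).
have mY t : measurable_fun setT (Y t : past_type t -> R).
  by apply: measurable_funM; [exact: mp|apply: mf; exact: measurable_Qlearning].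
have pT t : <<s past X t >> setT by exact: (@measurableT _ (past_type t)).
have Ystep t A : <<s past X t >> A -> A `<=` setT ->
    (\int[P]_(w in A) (Y t.+1 w)%:E <= \int[P]_(w in A) (Y t w)%:E)%E.
  move=> pA _.
  pose g (z : past_type t * ('M[R]_(n, n + m) * 'M[R]_(n + m))) : R :=
    p t.+1 z.1 * f (Q t z.1 + alpha t z.1 *:
      (z.2.2 + z.2.1^T *m lq_Pi (Q t z.1) *m z.2.1 - Q t z.1)).
  apply: (integral_past_le Xiid pA (f := g) (Z := Y t)).
  - apply: measurable_funM; first exact: (measurableT_comp (mp _ _ (leqnn t.+1))).
    apply: mf.
    have mQ : measurable_fun setT
        (fun z : past_type t * ('M[R]_(n, n + m) * 'M[R]_(n + m)) => Q t z.1).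
      exact: (measurableT_comp (@measurable_Qlearning t)).
    have mz1 : measurable_fun setT
        (fun z : past_type t * ('M[R]_(n, n + m) * 'M[R]_(n + m)) => z.2.1).
      exact: (measurableT_comp measurable_fst measurable_snd).
    have mz2 : measurable_fun setT
        (fun z : past_type t * ('M[R]_(n, n + m) * 'M[R]_(n + m)) => z.2.2).
      exact: (measurableT_comp measurable_snd measurable_snd).
    apply: measurable_addmx => //; apply: measurable_scalemx.
      exact: (measurableT_comp (@malpha' t)).
    apply: measurable_addmx; last exact: measurable_oppmx.
    apply: measurable_addmx => //; apply: measurable_mulmx => //.
    apply: measurable_mulmx; first exact: measurable_trmx.
    exact: measurable_Pi.
  - by move=> z; rewrite mulr_ge0.
  - exact: (past_measurable_fun Xiid (mY t)).
  move=> w _; rewrite /g /=.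
  under eq_integral do rewrite EFinM.
  rewrite ge0_integralZl//; last 3 first.
  - apply/measurable_EFinP; apply: mf; apply: measurable_addmx => //.
    apply: measurable_scalemx => //; apply: measurable_addmx => //.
    apply: measurable_addmx => //; apply: measurable_mulmx => //.
    by apply: measurable_mulmx => //; exact: measurable_trmx.
  - by move=> v _; rewrite lee_fin.
  - by rewrite lee_fin.
  have h := step (Q t w) (alpha t w) (psd_Qlearning t w) (alpha01 t w).
  apply: le_trans (lee_wpmul2l _ h) _; first by rewrite lee_fin.
  by rewrite -EFinM lee_fin /Y /p big_nat_recr//= mulrA mulfVK// gt_eqF.
have := supermartingale_bounded Xiid Y0 mY (fun t => pT t) Ystep.
apply: filterS => w /(_ _) [|M YM sa]; first by exists 0%N.
have [S aS] : exists S, forall t, \sum_(0 <= s < t) alpha s w ^+ 2 <= S.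
  by apply/series_ltyP => // t; exact: sqr_ge0.
exists (b + 1 + M * expR (C * S)) => t.
apply: le_trans (trl _ (psd_Qlearning t w)) _.
have pE : 1 <= p t w * expR (C * S).
  rewrite /p prodfV ler_pdivlMl ?mulr1.
    apply: (@le_trans _ _ (expR (C * \sum_(0 <= s < t) alpha s w ^+ 2))).
      rewrite mulr_sumr expR_sum; apply: ler_prod => s _.
      by rewrite (ltW (C1 _ _)) expR_ge1Dx.
    by rewrite ler_expR ler_wpM2l.
  by apply: prodr_gt0 => s _.
have fM : f (Q t w) <= M * expR (C * S).
  apply: (@le_trans _ _ (Y t w * expR (C * S))); last by rewrite ler_wpM2r ?expR_ge0.
  rewrite /Y mulrAC ler_peMl//.
have : l (Q t w) - b <= Num.max 0 (l (Q t w) - b) by rewrite le_max lexx orbT.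
move: fM; rewrite /f; move: (Num.max _ _) => y; nra.
Qed.

(** Each entry of the noise is a finite sum of martingale transforms: centred entries of N weighted
    by alpha, and centred products of entries of Lambda weighted by alpha times an entry of Pi(Q).
    Boundedness of the iterates makes the latter weights square summable. *)
Lemma noise_cvg : {ae P, forall w,
  (\sum_(0 <= t <oo) (alpha t w ^+ 2)%:E < +oo)%E ->
  forall i j, cvgn (fun t => \sum_(0 <= s < t) alpha s w *
    (N s.+1 w + (L s.+1 w)^T *m lq_Pi (Q s w) *m L s.+1 w - F (Q s w)) i j)}.
Proof.
have cN i j : {ae P, forall w, (\sum_(0 <= t <oo) (alpha t w ^+ 2)%:E < +oo)%E ->
    cvgn (fun t => \sum_(0 <= s < t) alpha s w * (N s.+1 w i j - EN i j))}.
  have mNij : measurable_fun setT (fun w => N 1%N w i j) by exact: measurable_entry.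
  have [I1 I2 I3] := centered_square_integrable mNij (integrable_N_sqr mN1 moment i j).
  have E : EN i j = fine (\int[P]_w (N 1%N w i j)%:E)%E by rewrite /EN mxE unlock.
  apply: (martingale_transform_cvg Xiid (a := alpha) (h := fun x => x.2 i j - EN i j) malpha');
    rewrite ?E//.
  apply: measurable_funB => //; apply: measurable_entry; exact: measurable_snd.
pose e i j (kl : 'I_n * 'I_n) := fine (\int[P]_w (L 1%N w kl.1 i * L 1%N w kl.2 j)%:E)%E.
have cL i j (kl : 'I_n * 'I_n) : {ae P, forall w,
    (\sum_(0 <= t <oo) ((alpha t w * lq_Pi (Q t w) kl.1 kl.2) ^+ 2)%:E < +oo)%E ->
    cvgn (fun t => \sum_(0 <= s < t) (alpha s w * lq_Pi (Q s w) kl.1 kl.2) *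
      (L s.+1 w kl.1 i * L s.+1 w kl.2 j - e i j kl))}.
  have mLij : measurable_fun setT (fun w => L 1%N w kl.1 i * L 1%N w kl.2 j).
    by apply: measurable_funM; exact: measurable_entry.
  have [I1 I2 I3] := centered_square_integrable mLij (integrable_LL_sqr mL1 moment kl.1 kl.2 i j).
  apply: (martingale_transform_cvg Xiid (a := fun t w => alpha t w * lq_Pi (Q t w) kl.1 kl.2)
    (h := fun x => x.1 kl.1 i * x.1 kl.2 j - e i j kl)) => //.
    move=> t; apply: measurable_funM => //; apply: measurable_entry.
    by apply: measurable_Pi; exact: measurable_Qlearning.
  by apply: measurable_funB => //; apply: measurable_funM; apply: measurable_entry;
    exact: measurable_fst.
have FF : Filter (almost_everywhere P) by exact: _.
have cNall := filter_forall FF (fun ij : 'I_(n + m) * 'I_(n + m) => cN ij.1 ij.2).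
have cLall := filter_forall FF (fun ijkl : ('I_(n + m) * 'I_(n + m)) * ('I_n * 'I_n) =>
  cL ijkl.1.1 ijkl.1.2 ijkl.2).
have bdd := Qlearning_bounded.
move: bdd cLall cNall; apply: filterS3 => w Hb HL HN sa i j.
have [M trM] := Hb sa.
have [S aS] : exists S, forall t, \sum_(0 <= s < t) alpha s w ^+ 2 <= S.
  by apply/series_ltyP => // t; exact: sqr_ge0.
rewrite (_ : (fun t => _) = (fun t => \sum_(0 <= s < t) alpha s w * (N s.+1 w i j - EN i j) +
  \sum_(kl : 'I_n * 'I_n) \sum_(0 <= s < t) (alpha s w * lq_Pi (Q s w) kl.1 kl.2) *
      (L s.+1 w kl.1 i * L s.+1 w kl.2 j - e i j kl))); last first.
  apply/funext => t; rewrite exchange_big -big_split /=; apply: eq_bigr => s _.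
  rewrite mxE [X in X + _]mxE conj_entryE [X in _ + X]mxE /F /bellman [X in - X]mxE.
  rewrite (mean_conjE mL1 moment) -/EN.
  under [X in _ = _ + X]eq_bigr do rewrite -mulrA mulrBr.
  rewrite -mulr_sumr sumrB; set a := \sum_(_ | _) _; set b := \sum_(_ | _) _.
  by rewrite -mulrDr; congr (_ * _); ring.
apply: is_cvgD; first exact: (HN (i, j)).
apply: sum_cvg => kl; apply: (HL ((i, j), kl)).
have M0 : 0 <= M.
  apply: le_trans (trM 0%N); have [_ pos] := psd_Qlearning 0 w.
  by apply: sumr_ge0 => k _; rewrite -quad_form_delta.
apply/series_ltyP => [t|]; first exact: sqr_ge0.
exists (M ^+ 2 * S) => t; apply: (@le_trans _ _ (\sum_(0 <= s < t) M ^+ 2 * alpha s w ^+ 2)).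
  apply: ler_sum => s _; rewrite exprMn mulrC ler_wpM2r ?sqr_ge0//.
  rewrite -[leLHS]real_normK ?num_real// lerXn2r// ?nnegrE//.
  apply: le_trans (psd_entry_le _ _ (psd_Pi (psd_Qlearning s w))) _.
  by apply: le_trans (trace_Pi (psd_Qlearning s w)) _.
by rewrite -mulr_sumr ler_wpM2l// sqr_ge0.
Qed.
End trajectory.

(** * Pathwise convergence in the Loewner order *)

Section affine_iteration.
Context {R : realType} {k : nat}.

Lemma prod_one_minus_small (a : nat -> R) (t0 : nat) (e : R) :
  (forall t, 0 <= a t <= 1) -> (\sum_(0 <= t <oo) (a t)%:E = +oo)%E -> 0 < e ->
  exists t1, forall t, (t1 <= t)%N -> \prod_(t0 <= s < t) (1 - a s) <= e.
Proof.
move=> a01 aoo e0.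
have a0 t : 0 <= a t by case/andP: (a01 t).
pose M := \sum_(0 <= s < t0) a s - ln e.
have [n Mn] : exists n, M < \sum_(0 <= s < n) a s.
  apply: contrapT => /forallNP H.
  suff : (\sum_(0 <= t <oo) (a t)%:E < +oo)%E by rewrite aoo ltxx.
  by apply/series_ltyP => //; exists M => n; rewrite leNgt; apply/negP.
exists (maxn n t0) => t; rewrite geq_max => /andP[nt t0t].
have mono : \sum_(0 <= s < n) a s <= \sum_(0 <= s < t) a s.
  by rewrite (big_cat_nat (leq0n n) nt)/= lerDl sumr_ge0.
have split_sum : \sum_(0 <= s < t) a s = \sum_(0 <= s < t0) a s + \sum_(t0 <= s < t) a s.
  by rewrite (big_cat_nat (leq0n t0) t0t).
apply: (@le_trans _ _ (expR (- \sum_(t0 <= s < t) a s))).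
  rewrite -sumrN expR_sum; apply: ler_prod => s _.
  have /andP[_ a1] := a01 s.
  by rewrite subr_ge0 a1 expR_ge1Dx.
rewrite -[leRHS]lnK ?posrE// ler_expR.
move: Mn; rewrite /M; lra.
Qed.

Variable K : 'M[R]_k.
Variables (a : nat -> R) (Z Phi U : nat -> 'M[R]_k) (rho gam : R).
Hypothesis K0 : forall z, 0 <= quad_form K z.
Hypothesis a01 : forall t, 0 <= a t <= 1.
Hypothesis aoo : (\sum_(0 <= t <oo) (a t)%:E = +oo)%E.
Hypothesis Zrec : forall t, Z t.+1 = Z t + a t *: (Phi t - Z t) + (U t.+1 - U t).
Hypothesis U0 : forall e, 0 < e -> exists t0, forall t, (t0 <= t)%N ->
  forall z, `|quad_form (U t) z| <= e * quad_form K z.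
Hypothesis rho01 : 0 <= rho < 1.

(** The fixed point of the affine map sending [b] to [rho * b + gam]. *)
Let bs := gam / (1 - rho).

Hypothesis Phi_le : forall b t, bs <= b ->
  (forall z, quad_form (Z t) z <= b * quad_form K z) ->
  (forall z, quad_form (Phi t) z <= (rho * b + gam) * quad_form K z).

Let bsE : rho * bs + gam = bs.
Proof.
have /andP[_ r1] := rho01; rewrite /bs.
have r0 : 1 - rho != 0 by rewrite subr_eq0 gt_eqF.
by field.
Qed.

(** Subtracting [U] removes the noise increments: Z - U is averaged with weight [a t] towards Phi -
    U. Hence a bound [b] improves towards rho b + gam, up to the size of [U] and a transient that
    decays with the product of the 1 - a_s. *)
Lemma affine_iteration_step b t0 : bs < b ->
  (forall t, (t0 <= t)%N -> forall z, quad_form (Z t) z <= b * quad_form K z) ->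
  exists t1, forall t, (t1 <= t)%N ->
    forall z, quad_form (Z t) z <= (bs + (1 + rho) / 2 * (b - bs)) * quad_form K z.
Proof.
move=> bsb Zb; have /andP[r0 r1] := rho01.
(* Three errors of size [e] add up to half of the gap (1 - rho)(b - bs), so the distance to [bs]
   shrinks by the factor (1 + rho)/2. *)
pose e : R := (1 - rho) / 6 * (b - bs).
have e0 : 0 < e by rewrite mulr_gt0 ?subr_gt0// divr_gt0// subr_gt0.
have [t1 Ut1] := U0 e0.
pose T := maxn t0 t1.
(* Excess of the old bound over its image; this is the transient multiplied by [p t]. *)
pose E : R := b - rho * b - gam.
have E0 : 0 <= E.
  have : 0 <= (1 - rho) * (b - bs) by rewrite mulr_ge0 ?subr_ge0// ltW.
  by rewrite /E; move: bsE; lra.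
pose p t : R := \prod_(T <= s < t) (1 - a s).
have eE : 0 < e / (E + 1) by rewrite divr_gt0// ltr_wpDl.
have [t2 pt2] := prod_one_minus_small T a01 aoo eE.
have pE t : (t2 <= t)%N -> p t * E <= e.
  move=> /pt2 pe; apply: (@le_trans _ _ (e / (E + 1) * E)); first by rewrite ler_wpM2r.
  by rewrite mulrAC ler_pdivrMr ?ltr_wpDl// ler_wpM2l ?(ltW e0)// lerDl.
have Y t : (T <= t)%N -> forall z,
    quad_form (Z t) z - quad_form (U t) z <=
    (rho * b + gam + e + p t * E) * quad_form K z.
  elim: t => [|t IH] Tt z.
    have T0 : T = 0%N by apply/eqP; rewrite -leqn0.
    have [h0 h1] : (t0 <= 0)%N /\ (t1 <= 0)%N.
      by move: (leq_maxl t0 t1) (leq_maxr t0 t1); rewrite -/T T0.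
    have := Zb _ h0 z; have := Ut1 _ h1 z; rewrite ler_norml => /andP[+ _].
    by rewrite /p T0 big_geq// mul1r /E; nra.
  move: Tt; rewrite leq_eqVlt => /predU1P[Tt|Tt].
    have [h0 h1] : (t0 <= t.+1)%N /\ (t1 <= t.+1)%N.
      by rewrite -Tt leq_maxl leq_maxr.
    have := Zb _ h0 z; have := Ut1 _ h1 z; rewrite ler_norml => /andP[+ _].
    by rewrite /p Tt big_geq// mul1r /E; nra.
  rewrite ltnS in Tt.
  have h0 : (t0 <= t)%N by apply: leq_trans Tt; exact: leq_maxl.
  have h1 : (t1 <= t)%N by apply: leq_trans Tt; exact: leq_maxr.
  have hU := Ut1 _ h1 z; move: hU; rewrite ler_norml => /andP[hU _].
  have hP := Phi_le (ltW bsb) (Zb _ h0) z.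
  have hY := IH Tt z.
  rewrite Zrec /p big_nat_recr//= -/(p t) !(quad_formD, quad_formZ, quad_formN).
  have /andP[a0 a1] := a01 t.
  have m1 := ler_wpM2l a0 hP.
  have m2 := ler_wpM2l a0 hU.
  have a1' : 0 <= 1 - a t by rewrite subr_ge0.
  have m3 := ler_wpM2l a1' hY.
  lra.
exists (maxn T t2) => t; rewrite geq_max => /andP[Tt t2t] z.
have hY := Y t Tt z.
have h1 : (t1 <= t)%N by apply: leq_trans Tt; exact: leq_maxr.
have := Ut1 _ h1 z; rewrite ler_norml => /andP[_ hU].
have hp := ler_wpM2r (K0 z) (pE t t2t).
have -> : bs + (1 + rho) / 2 * (b - bs) = rho * b + gam + e + e + e.
  by rewrite /e; move: bsE; lra.
lra.
Qed.

Lemma affine_iteration b0 b : bs < b ->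
  (forall t z, quad_form (Z t) z <= b0 * quad_form K z) ->
  exists t1, forall t, (t1 <= t)%N -> forall z, quad_form (Z t) z <= b * quad_form K z.
Proof.
move=> bsb Zb0; have /andP[r0 r1] := rho01.
pose r := (1 + rho) / 2.
have rr : 0 <= r < 1 by rewrite /r; lra.
have /andP[rr0 rr1] := rr.
(* The maximum starts the iteration strictly above [bs], as each step requires. *)
pose c := Num.max b0 (bs + 1) - bs.
have c0 : 0 < c by rewrite subr_gt0 lt_max ltrDl ltr01 orbT.
have iter_bound : 0 < r -> forall j, exists t1, forall t, (t1 <= t)%N ->
    forall z, quad_form (Z t) z <= (bs + r ^+ j * c) * quad_form K z.
  move=> rpos; elim=> [|j [t0 IH]].
    exists 0%N => t _ z; apply: le_trans (Zb0 t z) _.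
    by rewrite ler_wpM2r// expr0 mul1r /c addrC subrK le_max lexx.
  have [|t1 h] := @affine_iteration_step (bs + r ^+ j * c) t0 _ IH.
    by rewrite ltrDl mulr_gt0// exprn_gt0.
  exists t1 => t /h {}h z; apply: le_trans (h z) _.
  by rewrite -/r (_ : bs + r ^+ j * c - bs = r ^+ j * c) ?exprS ?mulrA//; ring.
have rpos : 0 < r by rewrite /r; lra.
have [j hj] : exists j, r ^+ j * c <= b - bs.
  have /cvgrPdist_le : r ^+ j @[j --> \oo] --> (0 : R).
    by apply: cvg_expr; rewrite ger0_norm.
  have e0 : 0 < (b - bs) / c by rewrite divr_gt0// subr_gt0.
  move=> /(_ _ e0) [J _ HJ]; exists J.
  have := HJ J (leqnn J); rewrite /= sub0r normrN ger0_norm ?exprn_ge0//.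
  by rewrite ler_pdivlMr.
have [t1 h] := iter_bound rpos j; exists t1 => t /h {}h z.
by apply: le_trans (h z) _; rewrite ler_wpM2r// -lerBrDl.
Qed.

End affine_iteration.

(** * The adaptive control *)

Lemma quad_form_abs_le (R : realType) (k : nat) (A : 'M[R]_k) (e : R) z :
  (forall i j, `|A i j| <= e) -> `|quad_form A z| <= (k * k)%:R * e * sqnorm z.
Proof.
move=> Ae; rewrite quad_formE.
have zz i j : `|z i 0 * z j 0| <= sqnorm z.
  have le1 l : z l 0 ^+ 2 <= sqnorm z.
    by rewrite /sqnorm (bigD1 l)//= lerDl sumr_ge0// => i' _; exact: sqr_ge0.
  have := le1 i; have := le1 j; have := sqr_ge0 (z i 0 - z j 0).
  have := sqr_ge0 (z i 0 + z j 0); rewrite ler_norml; nra.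
apply: le_trans (ler_norm_sum _ _ _) _.
apply: (@le_trans _ _ (\sum_(i < k) \sum_(j < k) e * sqnorm z)).
  apply: ler_sum => i _; apply: le_trans (ler_norm_sum _ _ _) _.
  by apply: ler_sum => j _; rewrite normrM ler_pM.
rewrite !sumr_const !card_ord le_eqVlt; apply/orP; left; apply/eqP.
by rewrite -mulrnA -[LHS]mulr_natl mulrA.
Qed.

Lemma sqnorm_col_mx (R : realType) (n m : nat) (x : 'cV[R]_n) (u : 'cV[R]_m) :
  sqnorm (col_mx x u) = sqnorm x + sqnorm u.
Proof.
rewrite /sqnorm big_split_ord /=; congr (_ + _); apply: eq_bigr => i _.
  by rewrite col_mxEu.
by rewrite col_mxEd.
Qed.

Section arithmetic.
Context {R : realType}.
Implicit Types b delta u v k q : R.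

(** [u], [v], [k] stand for the values of F(K), E[N] and K. For b >= 1 the weight 1 - b is
    nonpositive, so the lower bound on E[N] yields an upper bound on F(bK). *)
Lemma upper_arith b delta u v k :
  b * u <= b * ((1 + delta ^+ 2 / 8) * k) -> (b - 1) * (delta * k) <= (b - 1) * v ->
  b * u + (1 - b) * v <= ((1 + delta ^+ 2 / 8 - delta) * b + delta) * k.
Proof. lra. Qed.

Lemma lower_arith b delta u v k q :
  - b * u + (1 - - b) * v <= q ->
  - b * k <= - b * u -> (1 - - b) * (delta * k) <= (1 - - b) * v ->
  - q <= ((1 - delta) * b - delta) * k.
Proof. lra. Qed.

Lemma lower_arith_pos b delta v k q :
  v <= q -> delta * k <= v -> 0 <= (1 - delta) * b * k ->
  - q <= ((1 - delta) * b - delta) * k.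
Proof. lra. Qed.

(** Since delta^2/8 <= delta/4, the two costs add up to at most (1 - delta/2) k; multiplied by 1 +
    delta/4 this stays below (1 - delta/4) k, hence below (1 + delta/4) v. *)
Lemma lyapunov_arith delta mc kp k p v : 0 < delta -> delta <= 1 -> 0 <= k ->
  (1 - delta / 4) * k <= p -> p <= (1 + delta / 4) * v ->
  mc <= (1 + delta ^+ 2 / 8 - delta) * k -> kp <= delta / 4 * k -> mc + kp <= v.
Proof.
move=> d0 d1 k0 lo up h1 h2.
have e1 : 0 <= delta * (2 - delta) * k by rewrite !mulr_ge0// ?ltW//; lra.
have e2 : 0 <= delta ^+ 2 * k by rewrite mulr_ge0// sqr_ge0.
have h3 : mc + kp <= (1 - delta / 2) * k by lra.
have h4 : (1 + delta / 4) * ((1 - delta / 2) * k) <= (1 - delta / 4) * k by lra.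
have h5 : (1 + delta / 4) * ((1 - delta / 2) * k) <= (1 + delta / 4) * v.
  by apply: le_trans h4 (le_trans lo up).
by apply: (le_trans h3); rewrite ler_pM2l in h5 => //; lra.
Qed.

End arithmetic.

Section adaptive_control.
Context {d : measure_display} {Omega : measurableType d} {R : realType} {n m : nat}.
Variable P : probability Omega R.
Variables (L : nat -> Omega -> 'M[R]_(n, n + m)) (N : nat -> Omega -> 'M[R]_(n + m)).
Variables (alpha : nat -> Omega -> R) (Q0 : 'M[R]_(n + m)) (x : 'cV[R]_n).

Let X k := sample L N k.+1.

Local Notation past_type t := (g_sigma_algebraType (past X t)).

Hypothesis Xiid : iid P X.
Hypothesis psdN : forall t w, (1 <= t)%N -> psd (N t w).
Hypothesis alpha01 : forall t w, 0 <= alpha t w <= 1.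
Hypothesis malpha : forall t, measurable_wrt (filtration L N t) (alpha t).
Hypothesis moment : ('E_P[fun w => (mx_norm2 (N 1%N w) ^+ 2
                 + mx_norm2 ((L 1%N w)^T *m L 1%N w) ^+ 2)%R] < +oo)%E.
Hypothesis psdQ0 : psd Q0.

Let EN := mx_expectation P (N 1%N).
Let MC := mean_conj P (L 1%N).
Let F := bellman P (L 1%N) (N 1%N).

Let Q t w := Qlearning (L^~ w) (N^~ w) (alpha^~ w) Q0 t.
Let xa t w := adaptive_state (L^~ w) (Q^~ w) x t.
Let z t w := col_mx (xa t w) (lq_Gamma (Q t w) *m xa t w).

Let mX k : measurable_fun setT (X k).
Proof. by case: Xiid => + _ _; exact. Qed.

Let mL1 : measurable_fun setT (L 1%N).
Proof. exact: (measurableT_comp measurable_fst (mX 0%N)). Qed.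

Let mN1 : measurable_fun setT (N 1%N).
Proof. exact: (measurableT_comp measurable_snd (mX 0%N)). Qed.

Let psdN1 w : psd (N 1%N w). Proof. exact: psdN. Qed.

Let psdQ t w : psd (Q t w). Proof. exact: psd_Qlearning. Qed.

Variables (K : 'M[R]_(n + m)) (delta c : R).
Hypothesis Kpsd : psd K.
Hypothesis delta01 : 0 < delta <= 1.
Hypothesis c0 : 0 < c.
Hypothesis deltaK : forall y, delta * quad_form K y <= quad_form EN y.
Hypothesis cK : forall y, c * sqnorm y <= quad_form K y.
Hypothesis KFK : loewner K (F K).
Hypothesis FK : forall y, quad_form (F K) y <= (1 + delta ^+ 2 / 8) * quad_form K y.

Let K0 y : 0 <= quad_form K y. Proof. by have [_] := Kpsd; exact. Qed.

Let rhoK y : quad_form (MC (lq_Pi K)) y <= (1 + delta ^+ 2 / 8 - delta) * quad_form K y.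
Proof.
have := FK y; have := deltaK y; rewrite /F /bellman quad_formD -/EN -/MC; lra.
Qed.

Let rho01 : 0 <= 1 + delta ^+ 2 / 8 - delta < 1.
Proof. by have /andP[d0 d1] := delta01; nra. Qed.

(** The affine iteration is applied to Q_t and to -Q_t, with [U] the partial noise sum minus its
    limit, which tends to 0 relative to K. *)
Lemma Qlearning_sandwich : {ae P, forall w,
  (\sum_(0 <= t <oo) (alpha t w)%:E = +oo)%E ->
  (\sum_(0 <= t <oo) (alpha t w ^+ 2)%:E < +oo)%E ->
  exists t0, forall t, (t0 <= t)%N -> forall y,
    (1 - delta / 4) * quad_form K y <= quad_form (Q t w) y
      <= (1 + delta / 4) * quad_form K y}.
Proof.
have /andP[d0 d1] := delta01.
have bdd := Qlearning_bounded Xiid psdN alpha01 malpha moment psdQ0 Kpsd c0 cK rho01 rhoK.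
have noise := noise_cvg Xiid psdN alpha01 malpha moment psdQ0 Kpsd c0 cK rho01 rhoK.
move: bdd noise; apply: filterS2 => w Hb Hn aoo sa.
have [M trM] := Hb sa; have {}Hn := Hn sa.
pose noise t := N t.+1 w + (L t.+1 w)^T *m lq_Pi (Q t w) *m L t.+1 w - F (Q t w).
pose S t : 'M[R]_(n + m) := \sum_(0 <= s < t) alpha s w *: noise s.
pose Soo : 'M[R]_(n + m) := \matrix_(i, j) limn (fun t => S t i j).
have Scvg i j : (fun t => S t i j) @ \oo --> Soo i j.
  rewrite mxE; suff : cvgn (fun t => S t i j) by [].
  rewrite (_ : (fun t => S t i j) = fun t => \sum_(0 <= s < t) alpha s w * noise s i j).
    exact: Hn.
  by apply/funext => t; rewrite summxE; apply: eq_bigr => s _; rewrite mxE.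
have U0 e : 0 < e -> exists t0, forall t, (t0 <= t)%N ->
    forall y, `|quad_form (S t - Soo) y| <= e * quad_form K y.
  (* Entries of size [r] change the form by at most (n + m)^2 r |y|^2 <= e c |y|^2, and c|y|^2 is at
     most the form of K. *)
  move=> e0; pose r := e * c / ((n + m) * (n + m)).+1%:R.
  have r0 : 0 < r by rewrite divr_gt0// mulr_gt0.
  have : \forall t \near \oo, forall ij : 'I_(n + m) * 'I_(n + m),
      `|Soo ij.1 ij.2 - S t ij.1 ij.2| <= r.
    apply: filter_forall => ij.
    by have /cvgrPdist_le := Scvg ij.1 ij.2; exact.
  move=> [t0 _ Ht0]; exists t0 => t t0t y.
  have ent i j : `|(S t - Soo) i j| <= r.
    by rewrite !mxE distrC; have := Ht0 t t0t (i, j); rewrite /= !mxE.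
  apply: le_trans (quad_form_abs_le y ent) _.
  apply: (@le_trans _ _ (e * (c * sqnorm y))); last by rewrite ler_wpM2l// ltW.
  rewrite [leRHS]mulrA; apply: ler_wpM2r; first exact: sqnorm_ge0.
  rewrite /r mulrA ler_pdivrMr// mulrC.
  by apply: ler_wpM2l; [exact: mulr_ge0 (ltW e0) (ltW c0)|rewrite ler_nat].
have Qrec t : Q t.+1 w = Q t w + alpha t w *: (F (Q t w) - Q t w)
    + ((S t.+1 - Soo) - (S t - Soo)).
  have -> : S t.+1 - Soo - (S t - Soo) = alpha t w *: noise t.
    by rewrite opprB addrA subrK /S big_nat_recr//= addrAC subrr add0r.
  rewrite -[RHS]addrA -scalerDr; congr (_ + _ *: _).
  by rewrite /noise [RHS]addrC addrA subrK.
have F_EN y A : psd A -> quad_form EN y <= quad_form (F A) y.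
  move=> Apsd; rewrite /F /bellman quad_formD lerDl.
  by have [_] := psd_mean_conj mL1 moment (psd_Pi Apsd); exact.
have ENpsd : psd EN := psd_mean_N mN1 moment psdN1.
have M0 : 0 <= M.
  apply: le_trans (trM 0%N); have [_ pos] := psdQ 0 w.
  by apply: sumr_ge0 => k _; rewrite -quad_form_delta.
have Qup t y : quad_form (Q t w) y <= ((n + m)%:R * M / c) * quad_form K y.
  have Q0' : loewner 0 (Q t w).
    by move=> y'; rewrite quad_form0; have [_] := psdQ t w; exact.
  apply: le_trans (quad_form_le_trace y Q0') _.
  apply: (@le_trans _ _ ((n + m)%:R * M * sqnorm y)).
    by apply: ler_wpM2r; [exact: sqnorm_ge0|apply: ler_wpM2l => //; exact: trM].
  rewrite -[leRHS]mulrA; apply: ler_wpM2l; first exact: mulr_ge0.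
  by rewrite ler_pdivlMl.
have upper : exists t0, forall t, (t0 <= t)%N -> forall y,
    quad_form (Q t w) y <= (1 + delta / 4) * quad_form K y.
  pose rho := 1 + delta ^+ 2 / 8 - delta.
  have bsE : delta / (1 - rho) = (1 - delta / 8)^-1.
    have h1 : 1 - delta / 8 != 0 by lra.
    have h2 : delta != 0 by rewrite gt_eqF.
    have h3 : 1 - rho = delta * (1 - delta / 8) by rewrite /rho; field.
    by rewrite h3 invfM mulrA divff// mul1r.
  have bs1 : 1 <= delta / (1 - rho) by rewrite bsE invf_ge1; lra.
  apply: (affine_iteration K0 (alpha01^~ w) aoo Qrec U0 rho01
    (gam := delta) _ _ Qup).
    move=> b t bsb Qb y.
    have b1 : 1 <= b by apply: le_trans bs1 bsb.
    have b0 : 0 <= b by lra.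
    have h := loewner_bellman mL1 moment (psdQ t w) (psdZ b0 Kpsd) _ y.
    apply: le_trans (h _) _ => [y'|]; first by rewrite quad_formZ.
    rewrite (quad_form_bellmanZ mL1 moment)// -/F -/EN.
    have f1 := ler_wpM2l b0 (FK y).
    have b1' : 0 <= b - 1 by rewrite subr_ge0.
    have f2 := ler_wpM2l b1' (deltaK y).
    exact: upper_arith f1 f2.
  rewrite bsE invf_plt ?posrE; [|lra|lra].
  by rewrite -[_^-1]mul1r ltr_pdivrMr; nra.
(* Here [gam = - delta] and [rho = 1 - delta]; K <= F(K) places the fixed point exactly at -1. *)
have lower : exists t0, forall t, (t0 <= t)%N -> forall y,
    quad_form (- Q t w) y <= (- (1 - delta / 4)) * quad_form K y.
  have bsE : - delta / (1 - (1 - delta)) = -1.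
    rewrite (_ : 1 - (1 - delta) = delta); last by ring.
    by rewrite mulNr divff// gt_eqF.
  have Qrec' t : - Q t.+1 w = - Q t w + alpha t w *: ((- F (Q t w)) - (- Q t w))
    + ((Soo - S t.+1) - (Soo - S t)).
    rewrite Qrec opprD [in LHS]opprD; congr (_ + _ + _).
      by rewrite -scalerN opprD.
    rewrite [in LHS]opprB (opprB (S t.+1) Soo) addrA subrK.
    by rewrite (opprB Soo (S t)) [RHS]addrC addrA subrK.
  have U0' e : 0 < e -> exists t0, forall t, (t0 <= t)%N ->
      forall y, `|quad_form (Soo - S t) y| <= e * quad_form K y.
    move=> /U0[t0 h]; exists t0 => t /h {}h y.
    by rewrite -opprB quad_formN normrN.
  have rho01' : 0 <= 1 - delta < 1 by lra.
  have Qle0 t y : quad_form (- Q t w) y <= 0 * quad_form K y.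
    by rewrite mul0r quad_formN oppr_le0; have [_] := psdQ t w; exact.
  apply: (affine_iteration K0 (alpha01^~ w) aoo Qrec' U0' rho01'
    (gam := - delta) _ _ Qle0).
  - rewrite bsE => b t b1 Qb y; rewrite quad_formN.
    (* For positive [b] the hypothesis gives no positive lower bound on Q_t, and F(Q_t) >= E[N]
       suffices; otherwise -b K <= Q_t is pushed through the monotone map F. *)
    have [b0|b0] := leP b 0.
      have a0 : 0 <= - b by lra.
      have h := loewner_bellman mL1 moment (psdZ a0 Kpsd) (psdQ t w) _ y.
      have {}h := h _; have : loewner (- b *: K) (Q t w).
        by move=> y'; rewrite quad_formZ mulNr lerNl -quad_formN.
      move=> /h; rewrite (quad_form_bellmanZ mL1 moment)// -/F -/EN => {}h.
      have f1 := ler_wpM2l a0 (KFK y).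
      have b1' : 0 <= 1 - - b by rewrite opprK addrC -lerBlDr sub0r.
      have f2 := ler_wpM2l b1' (deltaK y).
      exact: lower_arith h f1 f2.
    have f1 := F_EN y _ (psdQ t w); have f2 := deltaK y.
    have f3 : 0 <= (1 - delta) * b * quad_form K y by rewrite !mulr_ge0// ?(ltW b0)//; lra.
    exact: lower_arith_pos f1 f2 f3.
  - rewrite bsE; lra.
have [t1 h1] := upper; have [t2 h2] := lower.
exists (maxn t1 t2) => t; rewrite geq_max => /andP[t1t t2t] y.
by rewrite h1// andbT; have := h2 t t2t y; rewrite quad_formN; lra.
Qed.


Let measurable_xa t : measurable_fun setT (xa t : past_type t -> 'cV[R]_n) /\
  measurable_fun setT (z t : past_type t -> 'cV[R]_(n + m)).
Proof.
have mQ s : measurable_fun setT (Q s : past_type s -> 'M[R]_(n + m)).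
  exact: measurable_Qlearning.
have mz s : measurable_fun setT (xa s : past_type s -> 'cV[R]_n) ->
    measurable_fun setT (z s : past_type s -> 'cV[R]_(n + m)).
  move=> mxa; apply: measurable_col_mx => //; apply: measurable_mulmx => //.
  exact: measurable_Gamma.
suff mxa : measurable_fun setT (xa t : past_type t -> 'cV[R]_n) by split => //; exact: mz.
elim: t => [|t IH]; first exact: measurable_cst.
have [mLt _] := past_measurable_sample L N (ltnSn t).
apply: measurable_mulmx => //.
exact: past_measurable_fun_le (leqnSn t) (mz t IH).
Qed.

(** E[N] <= F(K) <= 2K and |y|^2 is at most the form of K divided by c, so kappa times their sum
    costs at most the margin delta/4 K. *)
Let kappa : R := delta / 4 / (2 + c^-1).

Let kappa0 : 0 < kappa.
Proof.
have /andP[d0 _] := delta01.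
by rewrite divr_gt0 ?divr_gt0// addr_gt0// invr_gt0.
Qed.

Let kappa_le y : kappa * (quad_form EN y + sqnorm y) <= delta / 4 * quad_form K y.
Proof.
have /andP[d0 d1] := delta01.
have c10 : 0 < 2 + c^-1 by rewrite addr_gt0// invr_gt0.
rewrite /kappa mulrAC ler_pdivrMr// -[leRHS]mulrA.
apply: ler_wpM2l; first by rewrite divr_ge0// ltW.
rewrite mulrDr; apply: lerD; last by rewrite mulrC ler_pdivlMl.
have MC0 : 0 <= quad_form (MC (lq_Pi K)) y.
  by have [_] := psd_mean_conj mL1 moment (psd_Pi Kpsd); exact.
apply: (@le_trans _ _ (quad_form (F K) y)).
  by rewrite /F /bellman quad_formD lerDl.
apply: le_trans (FK y) _; rewrite mulrC; apply: ler_wpM2l => //; nra.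
Qed.

(* The stage cost and the squared state are paid for by the decrease of the
   Lyapunov function x^T Pi(K) x, as soon as Q_t is close enough to K. *)
Lemma lyapunov_decrease t w :
  (forall y, (1 - delta / 4) * quad_form K y <= quad_form (Q t w) y
      <= (1 + delta / 4) * quad_form K y) ->
  quad_form (MC (lq_Pi K)) (z t w) + kappa * (quad_form EN (z t w) + sqnorm (z t w)) <=
  quad_form (lq_Pi K) (xa t w).
Proof.
move=> sandwich; have /andP[d0 d1] := delta01.
have lo : (1 - delta / 4) * quad_form K (z t w) <= quad_form (lq_Pi (Q t w)) (xa t w).
  rewrite -(quad_form_Gamma _ (psdQ t w)).
  by have /andP[] := sandwich (z t w).
(* The gain Gamma(K) is only a competitor for Q_t, whose minimizer is Gamma(Q_t). *)
have up : quad_form (lq_Pi (Q t w)) (xa t w) <= (1 + delta / 4) * quad_form (lq_Pi K) (xa t w).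
  rewrite -(quad_form_Gamma _ Kpsd).
  apply: le_trans (quad_form_Pi_le _ (lq_Gamma K *m xa t w) (psdQ t w)) _.
  by have /andP[] := sandwich (col_mx (xa t w) (lq_Gamma K *m xa t w)).
exact: lyapunov_arith d0 d1 (K0 (z t w)) lo up (rhoK (z t w)) (kappa_le (z t w)).
Qed.

Let V t w := quad_form (lq_Pi K) (xa t w).

Let acc t w := \sum_(0 <= s < t) (quad_form (N s.+1 w) (z s w) + sqnorm (z s w)).

Let N0 s w : 0 <= quad_form (N s.+1 w) (z s w).
Proof. by have [_] := psdN w (ltn0Sn s); exact. Qed.

Let acc0 t w : 0 <= acc t w.
Proof. by apply: sumr_ge0 => s _; rewrite addr_ge0 ?sqnorm_ge0. Qed.

(** V + kappa acc is a supermartingale on the past events [G t] where the Lyapunov inequality holds.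
    These occur from some random time on, which is all that the localized boundedness criterion
    requires. *)
Lemma running_cost_bounded : {ae P, forall w,
  (\sum_(0 <= t <oo) (alpha t w)%:E = +oo)%E ->
  (\sum_(0 <= t <oo) (alpha t w ^+ 2)%:E < +oo)%E ->
  exists M : R, forall t, acc t w <= M}.
Proof.
have Pipsd := psd_Pi Kpsd.
pose Y t w := V t w + kappa * acc t w.
pose G t := [set w | quad_form (MC (lq_Pi K)) (z t w)
   + kappa * (quad_form EN (z t w) + sqnorm (z t w)) <= V t w].
have V0 t w : 0 <= V t w by have [_] := Pipsd; exact.
have Y0 t w : 0 <= Y t w by rewrite addr_ge0// mulr_ge0// ltW.
have mxa t : measurable_fun setT (xa t : past_type t -> 'cV[R]_n).
  by have [] := measurable_xa t.
have mz t : measurable_fun setT (z t : past_type t -> 'cV[R]_(n + m)).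
  by have [] := measurable_xa t.
have mV t : measurable_fun setT (V t : past_type t -> R) by exact: measurable_quad_form.
have msq t : measurable_fun setT ((fun w => sqnorm (z t w)) : past_type t -> R).
  by under eq_fun do rewrite -quad_form1; exact: measurable_quad_form.
have macc t : measurable_fun setT (acc t : past_type t -> R).
  rewrite /acc; under eq_fun do rewrite big_mkord.
  apply: measurable_sum => s.
  have [_ mNs] := past_measurable_sample L N (ltn_ord s).
  have mzs : measurable_fun setT (z s : past_type t -> 'cV[R]_(n + m)).
    exact: past_measurable_fun_le (ltnW (ltn_ord s)) (mz s).
  apply: measurable_funD; first exact: measurable_quad_form.
  by under eq_fun do rewrite -quad_form1; exact: measurable_quad_form.
have mY t : measurable_fun setT (Y t : past_type t -> R).
  by apply: measurable_funD => //; exact: measurable_funM.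
have mG t : <<s past X t >> (G t).
  apply: (past_le_set (t := t)) => //.
  apply: measurable_funD; first exact: measurable_quad_form.
  apply: measurable_funM => //; apply: measurable_funD => //.
  exact: measurable_quad_form.
have mO t (f : Omega -> R) A : measurable_fun setT (f : past_type t -> R) ->
    measurable_fun A (fun w => (f w)%:E).
  move=> mf; apply: measurable_funTS; apply/measurable_EFinP.
  exact: (past_measurable_fun Xiid mf).
have step t A : <<s past X t >> A -> A `<=` G t ->
    (\int[P]_(w in A) (Y t.+1 w)%:E <= \int[P]_(w in A) (Y t w)%:E)%E.
  move=> pA AG; have mA : measurable A := past_measurable Xiid pA.
  have mrest : measurable_fun A (fun w => (kappa * (acc t w + sqnorm (z t w)))%:E).
    apply: (mO t (fun w => kappa * (acc t w + sqnorm (z t w)))).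
    by apply: measurable_funM => //; exact: measurable_funD.
  have rest0 w : (0 <= (kappa * (acc t w + sqnorm (z t w)))%:E)%E.
    by rewrite lee_fin mulr_ge0 ?addr_ge0 ?sqnorm_ge0// ltW.
  have mB : psd (kappa *: EN + MC (lq_Pi K)).
    apply: psdD; last exact: psd_mean_conj mL1 moment _ Pipsd.
    by apply: psdZ; [exact: ltW|exact: psd_mean_N mN1 moment psdN1].
  (* Only the new stage cost and the next state involve the fresh sample; [acc t] and
     [sqnorm (z t w)] are known from the past. *)
  have -> : (\int[P]_(w in A) (Y t.+1 w)%:E = \int[P]_(w in A)
      (quad_form (kappa *: EN + MC (lq_Pi K)) (z t w) +
       kappa * (acc t w + sqnorm (z t w)))%:E)%E.
    transitivity (\int[P]_(w in A) ((kappa * quad_form (N t.+1 w) (z t w) +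
        quad_form (lq_Pi K) (L t.+1 w *m z t w))%:E +
        (kappa * (acc t w + sqnorm (z t w)))%:E))%E.
      apply: eq_integral => w _; rewrite -EFinD; congr (_%:E).
      by rewrite /Y /V /acc big_nat_recr//=; ring.
    have [mLt mNt] := past_measurable_sample L N (ltnSn t).
    have mzt : measurable_fun setT (z t : past_type t.+1 -> 'cV[R]_(n + m)).
      exact: past_measurable_fun_le (leqnSn t) (mz t).
    rewrite ge0_integralD//=.
    - rewrite (integral_step Xiid psdN moment (ltW kappa0) Pipsd pA (mz t)).
      rewrite -ge0_integralD//=.
      + by move=> w _; rewrite lee_fin; have [_] := mB; exact.
      + apply: (mO t (fun w => quad_form (kappa *: EN + MC (lq_Pi K)) (z t w))).
        exact: measurable_quad_form.
    - move=> w _; rewrite lee_fin; apply: addr_ge0.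
        by apply: mulr_ge0; [exact: ltW|exact: N0].
      by have [_] := Pipsd; exact.
    - apply: (mO t.+1 (fun w => kappa * quad_form (N t.+1 w) (z t w) +
        quad_form (lq_Pi K) (L t.+1 w *m z t w))).
      apply: measurable_funD.
        by apply: measurable_funM => //; exact: measurable_quad_form.
      by apply: measurable_quad_form => //; exact: measurable_mulmx.
  apply: ge0_le_integral => //.
  - move=> w _; rewrite EFinD adde_ge0//.
    by rewrite lee_fin; have [_] := mB; exact.
  - apply: (mO t (fun w => quad_form (kappa *: EN + MC (lq_Pi K)) (z t w) +
       kappa * (acc t w + sqnorm (z t w)))).
    apply: measurable_funD; first exact: measurable_quad_form.
    by apply: measurable_funM => //; exact: measurable_funD.
  - exact: (mO t (Y t)).
  - move=> w /AG; rewrite /G /= lee_fin /Y quad_formD quad_formZ !mulrDr; lra.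
have bounded := supermartingale_bounded Xiid Y0 mY mG step.
move: bounded Qlearning_sandwich; apply: filterS2 => w Yb sandwich aoo sa.
have [t0 Ht0] := sandwich aoo sa.
have [|M YM] := Yb; first by exists t0 => t t0t; exact: lyapunov_decrease (Ht0 t t0t).
exists (M / kappa) => t; rewrite ler_pdivlMr// mulrC.
by apply: le_trans (YM t); rewrite /Y lerDr.
Qed.

Lemma adaptive_control_stabilizes : {ae P, forall w,
  (\sum_(0 <= t <oo) (alpha t w)%:E = +oo)%E ->
  (\sum_(0 <= t <oo) (alpha t w ^+ 2)%:E < +oo)%E ->
  let ua := adaptive_control (L^~ w) (Q^~ w) x in
  [/\ (cost (L^~ w) (N^~ w) x ua < +oo)%E,
      (\sum_(0 <= t <oo) (eucl_norm (xa t w) ^+ 2 + eucl_norm (ua t) ^+ 2)%:E < +oo)%E &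
      xa t w @[t --> \oo] --> (0 : 'cV[R]_n)]}.
Proof.
move: running_cost_bounded; apply: filterS => w H aoo sa ua.
have [M accM] := H aoo sa.
have sqE t : eucl_norm (xa t w) ^+ 2 + eucl_norm (ua t) ^+ 2 = sqnorm (z t w).
  by rewrite !eucl_norm_sqr /z sqnorm_col_mx.
have sumsq : (\sum_(0 <= t <oo) (sqnorm (z t w))%:E < +oo)%E.
  apply/series_ltyP => [t|]; first exact: sqnorm_ge0.
  exists M => t; apply: le_trans (accM t); apply: ler_sum => s _.
  by rewrite lerDr.
split.
- rewrite (_ : cost _ _ _ _ = (\sum_(0 <= t <oo) (quad_form (N t.+1 w) (z t w))%:E)%E).
    apply/series_ltyP => // ; exists M => t; apply: le_trans (accM t).
    by apply: ler_sum => s _; rewrite lerDl sqnorm_ge0.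
  rewrite /cost; congr (limn _); apply/funext => t /=; apply: eq_bigr => s _.
  by rewrite /ua state_adaptive_control.
- by under eq_eseriesr do rewrite sqE.
have sq0 : sqnorm (z t w) @[t --> \oo] --> (0 : R).
  apply: cvg_series_cvg_0; apply: nondecreasing_is_cvgn.
    apply/nondecreasing_seqP => t.
    by rewrite /series /= big_nat_recr//= lerDl sqnorm_ge0.
  exists M => _ [t _ <-]; apply: le_trans (accM t); apply: ler_sum => s _.
  by rewrite lerDr.
apply/cvg_ballP => e e0.
have e20 : 0 < e ^+ 2 by rewrite exprn_gt0.
have /cvgrPdist_lt /(_ _ e20) [T _ HT] := sq0.
(* Balls of matrices are entrywise, and each squared entry of the state is at most
   [sqnorm (z t w)]. *)
exists T => // t Tt; split=> // i j.
have := HT t Tt; rewrite /= sub0r normrN ger0_norm ?sqnorm_ge0// => h.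
rewrite (ord1 j) /ball /= mxE sub0r normrN -(@ltr_pXn2r _ 2) ?nnegrE ?normr_ge0 ?(ltW e0)//.
rewrite real_normK ?num_real//; apply: le_lt_trans h.
rewrite /z sqnorm_col_mx /sqnorm (bigD1 i)//= -addrA lerDl addr_ge0//.
  by apply: sumr_ge0 => k _; exact: sqr_ge0.
by apply: sumr_ge0 => k _; exact: sqr_ge0.
Qed.
End adaptive_control.

Unset Implicit Arguments.

Theorem theorem1p3 (R : realType) (n m : nat)
  (d : measure_display) (Omega : measurableType d) (P : probability Omega R)
  (L : nat -> Omega -> 'M[R]_(n, n + m)) (N : nat -> Omega -> 'M[R]_(n + m))
  (alpha : nat -> Omega -> R) (Q0 : 'M[R]_(n + m)) :
  (1 <= n)%N -> (1 <= m)%N ->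
  iid P (fun k => sample L N k.+1) ->
  (forall t w, (1 <= t)%N -> psd (N t w)) ->
  (forall t w, 0 <= alpha t w <= 1) ->
  (forall t, measurable_wrt (filtration L N t) (alpha t)) ->
  {ae P, forall w, (\sum_(0 <= t <oo) (alpha t w)%:E = +oo)%E} ->
  {ae P, forall w, (\sum_(0 <= t <oo) (alpha t w ^+ 2)%:E < +oo)%E} ->
  ('E_P[fun w => (mx_norm2 (N 1%N w) ^+ 2
                 + mx_norm2 ((L 1%N w)^T *m L 1%N w) ^+ 2)%R] < +oo)%E ->
  posdef (mx_expectation P (N 1%N)) ->
  psd Q0 ->
  (forall x, (value L N P x < +oo)%E) ->
  forall x : 'cV[R]_n,
    let Q w := Qlearning (L^~ w) (N^~ w) (alpha^~ w) Q0 in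
    let xa w := adaptive_state (L^~ w) (Q w) x in
    let ua w := adaptive_control (L^~ w) (Q w) x in
    {ae P, forall w,
      (cost (L^~ w) (N^~ w) x (ua w) < +oo)%E /\
      (\sum_(0 <= t <oo)
         (eucl_norm (xa w t) ^+ 2 + eucl_norm (ua w t) ^+ 2)%:E < +oo)%E} /\
    {ae P, forall w, xa w t @[t --> \oo] --> (0 : 'cV[R]_n)}.
Proof.
move=> _ _ Xiid psdN alpha01 malpha aoo sa moment posEN psdQ0 wellposed x Q xa ua.
have [K [delta [c [Kpsd delta01 c0 [deltaK cK KFK FK]]]]] :=
  approximate_fixed_point Xiid psdN moment posEN wellposed.
have stable := adaptive_control_stabilizes x Xiid psdN alpha01 malpha moment psdQ0
  Kpsd delta01 c0 deltaK cK KFK FK.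
split; move: aoo sa stable; apply: filterS3 => w aoo sa /(_ aoo sa) /=.
  by case=> ? ? _.
by case=> _ _.
Qed.
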